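(* Let $a_2,a_3,a_{23}\in\mathbb{R}$ and $b\in\mathbb{R}$ with $b\neq 0$. Let $0<\tau_2\le\tau_3$ and $D>\tau_2+\tau_3$ be real numbers. Let $N:[0,\tau_2+\tau_3]\to\mathbb{R}$ and $\tilde M:[0,D]\to\mathbb{R}$ be piecewise continuous functions. Assume that for every $s\in\mathbb{C}$, $$\operatorname{rank}\big(F_0(s),F_1(s)\big)=1,\quad\text{i.e. } (F_0(s),F_1(s))\neq(0,0),$$ where $$F_0(s)=1-a_3e^{-\tau_3 s}-a_2e^{-\tau_2 s}-a_{23}e^{-(\tau_2+\tau_3)s}-\int_0^{\tau_2+\tau_3}N(\nu)e^{-\nu s}\,d\nu,\qquad F_1(s)=be^{-Ds}+\int_0^{D}\tilde M(\nu)e^{-\nu s}\,d\nu .$$ Let $X=L^2(0,D)\times L^2(0,\tau_2)\times L^2(\tau_2,\tau_3)\times L^2(\tau_3,\tau_2+\tau_3)$. For $(g,f_2,f_3,f_{23})\in X$ put $f=\mathbb{1}_{[0,\tau_2)}f_2+\mathbb{1}_{[\tau_2,\tau_3)}f_3+\mathbb{1}_{[\tau_3,\tau_2+\tau_3]}f_{23}$ on $[0,\tau_2+\tau_3]$, write $a_{\tau_2}=a_2$, $a_{\tau_3}=a_3$, $a_{\tau_2+\tau_3}=a_{23}$, and define the linear operator $\mathcal{T}:X\to X$, $\mathcal{T}(g,f_2,f_3,f_{23})=(I_1,I_2,I_3,I_{23})$, by $$I_1(\nu)=g(\nu)-\sum_{\delta\in\{\tau_2,\tau_3,\tau_2+\tau_3\}}a_\delta\,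 g(\nu-\delta)\mathbb{1}_{(\delta,D]}(\nu)+\mathbb{1}_{[0,\tau_2+\tau_3]}(\nu)\int_0^\nu\big(f(\eta)\tilde M(\nu-\eta)-g(\eta)N(\nu-\eta)\big)d\eta$$ $$\qquad+\mathbb{1}_{(\tau_2+\tau_3,D]}(\nu)\Big(\int_0^{\tau_2+\tau_3}f(\eta)\tilde M(\nu-\eta)\,d\eta-\int_{\nu-\tau_2-\tau_3}^{\nu}g(\eta)N(\nu-\eta)\,d\eta\Big),\quad \nu\in(0,D);$$ and, with the common tail term $R(\nu)=\int_\nu^{\tau_2+\tau_3}f(\eta)\tilde M(\nu+D-\eta)\,d\eta-\int_{\nu+D-\tau_2-\tau_3}^{D}g(\eta)N(\nu+D-\eta)\,d\eta$, $$I_2(\nu)=bf_2(\nu)-\sum_{\delta\in\{\tau_2,\tau_3,\tau_2+\tau_3\}}a_\delta\, g(\nu+D-\delta)+R(\nu),\quad \nu\in(0,\tau_2),$$ $$I_3(\nu)=bf_3(\nu)-\sum_{\delta\in\{\tau_3,\tau_2+\tau_3\}}a_\delta\, g(\nu+D-\delta)+R(\nu),\quad \nu\in(\tau_2,\tau_3),$$ $$I_{23}(\nu)=bf_{23}(\nu)-a_{23}\, g(\nu+D-\tau_2-\tau_3)+R(\nu),\quad \nu\in(\tau_3,\tau_2+\tau_3).$$ Then $\mathcal{T}$ is invertible on $X$. Consequently there exists a unique $(g,f_2,f_3,f_{23})\in X$ such that $\mathcal{T}(g,f_2,f_3,f_{23})=\big(-N\mathbb{1}_{[0,\tau_2+\tau_3]},0,0,0\big)$,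 where $-N\mathbb{1}_{[0,\tau_2+\tau_3]}$ denotes $-N$ extended by zero to $(0,D)$.
   Context: This operator arises in designing controller gains $g,f$ for the integral difference equation $x(t)=a_3x(t-\tau_3)+a_2x(t-\tau_2)+a_{23}x(t-\tau_2-\tau_3)+b\bar U(t-D)+\int_0^D\tilde M(\nu)\bar U(t-\nu)d\nu+\int_0^{\tau_2+\tau_3}N(\nu)x(t-\nu)d\nu$ under the dynamic control law $\bar U(t)=\int_0^D g(\nu)\bar U(t-\nu)d\nu+\int_0^{\tau_2+\tau_3}f(\nu)x(t-\nu)d\nu$. In the paper, $D=\tau_1+1/\lambda_2$, $b=q_{32}q_{21}q_{11}$ is nonzero because the boundary coupling coefficients $q_{11},q_{21},q_{32}$ are assumed nonzero, and $N,\tilde M$ are specific piecewise continuous kernels obtained from a backstepping transformation of a chain of three $2\times2$ hyperbolic PDE systems; the rank condition is the paper's controllability-type assumption. *)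

(* Defs.v *)
From HB Require Import structures.
From mathcomp Require Import all_boot all_order all_algebra.
From mathcomp Require Import all_classical all_reals all_analysis.
From mathcomp Require Import complex.

Set Implicit Arguments.
Unset Strict Implicit.
Unset Printing Implicit Defensive.

Import Order.TTheory GRing.Theory Num.Theory.
Import numFieldNormedType.Exports.

Local Open Scope classical_set_scope.
Local Open Scope ring_scope.
Local Open Scope complex_scope.

Section Defs.
Variable R : realType.

Local Notation mu := (@lebesgue_measure R).

Definition Rint (a b : R) (h : R -> R) : R :=
  (\int[mu]_(x in `[a, b]) h x)%R.

Definition piecewise_continuous (a b : R) (h : R -> R) : Prop :=
  exists s : seq R,
    [/\ (1 < size s)%N, sorted <%R s, head 0 s = a, last 0 s = b &
      forall i : nat, (i.+1 < size s)%N ->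
        [/\ forall z, nth 0 s i < z < nth 0 s i.+1 -> {for z, continuous h},
            cvg (h @ (nth 0 s i)^'+) & cvg (h @ (nth 0 s i.+1)^'-)]].

(** complex exponential e^{-nu s}, s = x + i y :
    e^{-nu x} (cos (nu y) - i sin (nu y)). *)
Definition cexpm (nu : R) (s : R[i]) : R[i] :=
  let: Complex x y := s in
  Complex (expR (- (nu * x)) * cos (nu * y))
          (- (expR (- (nu * x)) * sin (nu * y))).

Definition Cint (a b : R) (h : R -> R[i]) : R[i] :=
  Complex (Rint a b (fun x => let: Complex u _ := h x in u))
          (Rint a b (fun x => let: Complex _ v := h x in v)).

Definition F0 (a2 a3 a23 tau2 tau3 : R) (N : R -> R) (s : R[i]) : R[i] :=
  1 - a3%:C * cexpm tau3 s - a2%:C * cexpm tau2 s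
    - a23%:C * cexpm (tau2 + tau3) s
    - Cint 0 (tau2 + tau3) (fun nu => (N nu)%:C * cexpm nu s).

Definition F1 (b D : R) (M : R -> R) (s : R[i]) : R[i] :=
  b%:C * cexpm D s + Cint 0 D (fun nu => (M nu)%:C * cexpm nu s).

(** Elements of X = L2(0,D) x L2(0,tau2) x L2(tau2,tau3) x L2(tau3,tau2+tau3),
    represented by (representatives) functions R -> R. *)
Record Xel := mkX { xg : R -> R; xf2 : R -> R; xf3 : R -> R; xf23 : R -> R }.

Definition L2on (a b : R) (u : R -> R) : Prop :=
  measurable_fun `]a, b[ u /\
  (\int[mu]_(x in `]a, b[) ((u x) ^+ 2)%:E < +oo)%E.

Definition aeeq (a b : R) (u v : R -> R) : Prop :=
  {ae mu, forall x, a < x < b -> u x = v x}.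

Definition L2norm2 (a b : R) (u : R -> R) : \bar R :=
  (\int[mu]_(x in `]a, b[) ((u x) ^+ 2)%:E)%E.

Section X.
Variables (tau2 tau3 D : R).

Definition inX (x : Xel) : Prop :=
  [/\ L2on 0 D (xg x), L2on 0 tau2 (xf2 x), L2on tau2 tau3 (xf3 x)
    & L2on tau3 (tau2 + tau3) (xf23 x)].

Definition Xeq (x y : Xel) : Prop :=
  [/\ aeeq 0 D (xg x) (xg y), aeeq 0 tau2 (xf2 x) (xf2 y),
      aeeq tau2 tau3 (xf3 x) (xf3 y)
    & aeeq tau3 (tau2 + tau3) (xf23 x) (xf23 y)].

Definition Xnorm2 (x : Xel) : \bar R :=
  (L2norm2 0 D (xg x) + L2norm2 0 tau2 (xf2 x) + L2norm2 tau2 tau3 (xf3 x)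
   + L2norm2 tau3 (tau2 + tau3) (xf23 x))%E.

Definition fcat (f2 f3 f23 : R -> R) (eta : R) : R :=
  if eta < tau2 then f2 eta else if eta < tau3 then f3 eta else f23 eta.

Variables (a2 a3 a23 b : R) (N M : R -> R).

Definition T (x : Xel) : Xel :=
  let g := xg x in
  let f := fcat (xf2 x) (xf3 x) (xf23 x) in
  let t23 := tau2 + tau3 in
  let Rtail := fun nu =>
    Rint nu t23 (fun eta => f eta * M (nu + D - eta))
    - Rint (nu + D - t23) D (fun eta => g eta * N (nu + D - eta)) in
  mkX
    (fun nu =>
       g nu
       - (if tau2 < nu then a2 * g (nu - tau2) else 0)
       - (if tau3 < nu then a3 * g (nu - tau3) else 0)
       - (if t23 < nu then a23 * g (nu - t23) else 0)
       + (if nu <= t23 then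
            Rint 0 nu (fun eta => f eta * M (nu - eta) - g eta * N (nu - eta))
          else
            Rint 0 t23 (fun eta => f eta * M (nu - eta))
            - Rint (nu - t23) nu (fun eta => g eta * N (nu - eta))))
    (fun nu =>
       b * xf2 x nu - a2 * g (nu + D - tau2) - a3 * g (nu + D - tau3)
       - a23 * g (nu + D - t23) + Rtail nu)
    (fun nu =>
       b * xf3 x nu - a3 * g (nu + D - tau3) - a23 * g (nu + D - t23)
       + Rtail nu)
    (fun nu => b * xf23 x nu - a23 * g (nu + D - t23) + Rtail nu).

Definition rhs : Xel :=
  mkX (fun nu => if nu <= tau2 + tau3 then - N nu else 0)
      (fun _ => 0) (fun _ => 0) (fun _ => 0).

End X.
End Defs.

(* Main.v *)
(** Glue [g] and [f] into one function [u] on [[0, L)], [L = D + tau2 + tau3], with [g] on [[0, D)]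
    and [f] shifted by [D].  Then [T] becomes a single truncation-free operator
      [u |-> g - A g + b f(. - D) + f * M - g * N],
    where [A] collects the three delays and [*] is convolution on the line.  Up to the invertible
    multiplier [1] or [b], this is the identity minus [P] minus a convolution operator.  [P] is
    nilpotent, because each delay is at least [tau2 > 0]; the convolution operator maps L2 into
    bounded functions and, after composition with [(1 - P)^-1], is a small operator plus a
    finite-rank one in the sup norm.  The Fredholm alternative therefore reduces everything to the
    triviality of the kernel on bounded functions.

    In terms of Laplace transforms the kernel is [{(G, F) : F0 G + F1 F = 0}].  The map
      [(G, F) |-> ((G - q F1) / s, (F + q F0) / s)],
    with [q] chosen so that both numerators vanish at [s = 0], preserves the kernel, which is finite
    dimensional; a nonzero kernel thus contains an eigenvector, of eigenvalue [lam].  If [lam <> 0]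
    then evaluation at [s = 1 / lam] gives [q F1(s) = q F0(s) = 0], so [q = 0] by the rank condition,
    and [g], [f] are multiples of their own primitives, hence vanish.  If [lam = 0] then again
    [q = 0], and the primitives of [g] and [f] vanish. *)
Require Import Defs.
From HB Require Import structures.
From mathcomp Require Import all_boot all_order all_algebra.
From mathcomp Require Import all_classical all_reals all_analysis.
From mathcomp Require Import complex.
From mathcomp Require Import measurable_realfun ring lra.

Set Implicit Arguments.
Unset Strict Implicit.
Unset Printing Implicit Defensive.

Import Order.TTheory GRing.Theory Num.Theory.
Import numFieldNormedType.Exports.

Local Open Scope classical_set_scope.
Local Open Scope ring_scope.

(** The kernels may jump, so no regularity of [Z u] can be read off from them. What survives is a
    modulus of continuity depending only on the sup norm of [u], because the kernels are L1-limits
    of continuous functions. This equicontinuity is the compactness behind the finite-rank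
    splitting; sampling needs values at points, which is why it takes place in the sup norm.
    Division by [s] threatens compact support, since a primitive need not return to zero. At [s = 0]
    the kernel equation says that the masses of [g] and [f] are orthogonal to [(F0(0), F1(0))], a
    nonzero vector by the rank condition; they are therefore [q F1(0)] and [- q F0(0)] for a single
    [q]. Subtracting [q F1] and adding [q F0] removes both masses, so the new functions vanish past
    [D] and past [tau2 + tau3]. The functions are real while [lam] may be complex, hence the pairs
    [u1], [u2] and the real and imaginary parts throughout. When [lam = 0], [q] is the jump at time
    [0] of the primitive attached to [f], where no delayed term has started yet, so it vanishes. *)

Section Lebesgue.
Variable R : realType.
Local Notation mu := (@lebesgue_measure R).

(** Integrals run over the whole line and an interval enters through functions vanishing outside it;
    shifts and reflections are then changes of variable without boundary terms. *)
Definition intg (f : R -> R) := mu.-integrable setT (EFin \o f).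
Definition rint (f : R -> R) : R := (\int[mu]_x f x)%R.

Lemma intg_meas f : intg f -> measurable_fun setT f.
Proof. by move=> /measurable_int /measurable_EFinP. Qed.

Lemma meas_addr (a : R) : measurable_fun setT (fun x : R => x + a).
Proof. exact: measurable_funD. Qed.

(** By uniqueness of Lebesgue measure it is enough to compare on the intervals []x, y]]. *)
Lemma measure_shift (a : R) (A : set R) : measurable A ->
  pushforward mu ((fun x => x + a) : _ -> measurableTypeR R) A = mu A.
Proof.
move=> mA; apply/esym; apply: lebesgue_measure_unique => //=; first exact: meas_addr.
move=> ma _ [[x y]] _ <-.
rewrite /pushforward.
have -> : (fun z : R => z + a) @^-1` `]x, y]%classic = `]x - a, y - a]%classic.
  by apply/seteqP; split=> z /=; rewrite !in_itv/= lerBrDr ltrBlDr.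
rewrite !lebesgue_measure_itv/= !lte_fin ltrD2r.
by case: ifP => // _; congr (_ %:E); ring.
Qed.

Lemma ge0_int_shift (a : R) (f : R -> \bar R) : measurable_fun setT f ->
  (forall x, 0 <= f x)%E -> (\int[mu]_x f (x + a)%R = \int[mu]_x f x)%E.
Proof.
move=> mf f0.
have := @ge0_integral_pushforward _ _ (measurableTypeR R) (measurableTypeR R) R _ (meas_addr a) mu setT f measurableT mf (fun x _ => f0 x).
rewrite preimage_setT => <-.
apply: eq_measure_integral; first exact: meas_addr.
by move=> ma A mA _; exact: measure_shift.
Qed.

Lemma ge0_int_opp (f : R -> \bar R) : measurable_fun setT f ->
  (forall x, 0 <= f x)%E -> (\int[mu]_x f (- x)%R = \int[mu]_x f x)%E.
Proof.
move=> mf f0.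
have mN : measurable_fun setT (-%R : R -> R) by exact: oppr_measurable.
have := @ge0_integral_pushforward _ _ (measurableTypeR R) (measurableTypeR R) R _ mN mu setT f measurableT mf (fun x _ => f0 x).
rewrite preimage_setT => <-.
by apply: eq_measure_integral => //= A mA _; exact: lebesgue_measureN.
Qed.

Lemma intg_P (f : R -> R) : intg f <-> measurable_fun setT f /\ (\int[mu]_x `|f x|%:E < +oo)%E.
Proof.
split=> [/integrableP[/measurable_EFinP mf lf]|[mf lf]]; first by split.
by apply/integrableP; split; first exact/measurable_EFinP.
Qed.

Lemma intg_shift f a : intg f -> intg (fun x => f (x + a)).
Proof.
move=> /intg_P[mf lf]; apply/intg_P; split.
  by apply: measurableT_comp => //; exact: meas_addr.
rewrite (@ge0_int_shift a (fun x => `|f x|%:E))//.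
by apply/measurable_EFinP; exact: measurableT_comp.
Qed.

Lemma intg_opp f : intg f -> intg (fun x => f (- x)).
Proof.
move=> /intg_P[mf lf]; apply/intg_P; split.
  by apply: measurableT_comp => //; exact: oppr_measurable.
rewrite (@ge0_int_opp (fun x => `|f x|%:E))//.
by apply/measurable_EFinP; exact: measurableT_comp.
Qed.

(** Positive and negative parts are shifted separately, so measurability suffices. *)
Lemma rint_shift f a : measurable_fun setT f -> rint (fun x => f (x + a)) = rint f.
Proof.
move=> mf; congr fine; rewrite integralE [RHS]integralE.
have mf' : measurable_fun setT (EFin \o f) by exact/measurable_EFinP.
have := @ge0_int_shift a ((EFin \o f)^\+%E) (measurable_funepos mf') (fun=> funepos_ge0 _ _).
have := @ge0_int_shift a ((EFin \o f)^\-%E) (measurable_funeneg mf') (fun=> funeneg_ge0 _ _).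
move=> <- <-; congr (_ - _)%E; apply: eq_integral => x _.
  by rewrite (funepos_comp (EFin \o f)).
by rewrite (funeneg_comp (EFin \o f)).
Qed.

Lemma rint_opp f : measurable_fun setT f -> rint (fun x => f (- x)) = rint f.
Proof.
move=> mf; congr fine; rewrite integralE [RHS]integralE.
have mf' : measurable_fun setT (EFin \o f) by exact/measurable_EFinP.
have := @ge0_int_opp ((EFin \o f)^\+%E) (measurable_funepos mf') (fun=> funepos_ge0 _ _).
have := @ge0_int_opp ((EFin \o f)^\-%E) (measurable_funeneg mf') (fun=> funeneg_ge0 _ _).
move=> <- <-; congr (_ - _)%E; apply: eq_integral => x _.
  by rewrite (funepos_comp (EFin \o f)).
by rewrite (funeneg_comp (EFin \o f)).
Qed.

Lemma intg_le (f g : R -> R) : measurable_fun setT f -> intg g -> (forall x, `|f x| <= g x) -> intg f.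
Proof.
move=> mf ig fg; apply: (le_integrable measurableT _ _ ig).
  exact/measurable_EFinP.
by move=> x _ /=; rewrite lee_fin (le_trans (fg x))// ler_norm.
Qed.

Lemma intgD f g : intg f -> intg g -> intg (fun x => f x + g x).
Proof. by move=> If Ig; have := integrableD measurableT If Ig. Qed.

Lemma intgB f g : intg f -> intg g -> intg (fun x => f x - g x).
Proof. by move=> If Ig; have := integrableB measurableT If Ig. Qed.

Lemma intgZ k f : intg f -> intg (fun x => k * f x).
Proof. by move=> If; have := integrableZl measurableT k If. Qed.

Lemma intg_abs f : intg f -> intg (fun x => `|f x|).
Proof. by move=> If; have := integrable_abse If. Qed.

Lemma intg_mul (f k : R -> R) m : intg f -> measurable_fun setT k -> (forall x, `|k x| <= m) ->
  intg (fun x => f x * k x).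
Proof.
move=> If mk km; apply: (@intg_le _ (fun x => m * `|f x|)).
- by apply: measurable_funM => //; exact: intg_meas.
- exact/intgZ/intg_abs.
- by move=> x; rewrite normrM mulrC ler_wpM2r.
Qed.

Lemma intg_0 : intg (fun=> 0).
Proof. exact: integrable0. Qed.

Lemma intg_itv (a b : R) : intg \1_(`[a, b[%classic).
Proof. by have := @integrable_indic_itv R a b true true. Qed.

Lemma rint_itv (a b : R) : a <= b -> rint (\1_(`[a, b[%classic)) = b - a.
Proof.
move=> ab; have m1 : measurable (`[a, b[%classic : set R) by [].
suff E : lebesgue_measure (`[a, b[%classic : set R) = (b - a)%:E.
  by rewrite /rint /Rintegral integral_indic// setIT; have := congr1 fine E.
rewrite lebesgue_measure_itv /= lte_fin -EFinB.
by case: ltgtP ab => // -> _; rewrite subrr.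
Qed.

Lemma rintD f g : intg f -> intg g -> rint (fun x => f x + g x) = rint f + rint g.
Proof. by move=> ? ?; exact: RintegralD. Qed.

Lemma rintB f g : intg f -> intg g -> rint (fun x => f x - g x) = rint f - rint g.
Proof. by move=> ? ?; exact: RintegralB. Qed.

Lemma rintZ k f : intg f -> rint (fun x => k * f x) = k * rint f.
Proof. by move=> ?; exact: RintegralZl. Qed.

Lemma rint0 : rint (fun=> 0) = 0.
Proof. by rewrite /rint /Rintegral integral0. Qed.

Lemma le_rint f g : intg f -> intg g -> (forall x, f x <= g x) -> rint f <= rint g.
Proof. by move=> ? ? fg; apply: le_Rintegral => // x _. Qed.

Lemma rint_ge0 f : (forall x, 0 <= f x) -> 0 <= rint f.
Proof. by move=> f0; apply: Rintegral_ge0. Qed.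

Lemma norm_rint f : intg f -> `|rint f| <= rint (fun x => `|f x|).
Proof. by move=> ?; exact: le_normr_Rintegral. Qed.

Lemma eq_rint f g : f =1 g -> rint f = rint g.
Proof. by move=> fg; congr rint; exact/funext. Qed.

Lemma intg_compact (f : R -> R) a b m : measurable_fun setT f -> (forall x, `|f x| <= m) ->
  (forall x, ~~ (a <= x < b) -> f x = 0) -> intg f.
Proof.
move=> mf fm f0; apply: (@intg_le _ (fun x => m * \1_(`[a, b[%classic) x)) => //.
  exact/intgZ/intg_itv.
move=> x; rewrite indicE; have [|xab] := boolP (x \in _).
  by rewrite mulr1.
rewrite f0 ?normr0 ?mulr0//; apply: contra xab => xab.
by rewrite inE /= in_itv.
Qed.

Lemma rint_compact (f : R -> R) a b m : a <= b -> measurable_fun setT f -> (forall x, `|f x| <= m) ->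
  (forall x, ~~ (a <= x < b) -> f x = 0) -> `|rint f| <= m * (b - a).
Proof.
move=> ab mf fm f0.
have If := intg_compact mf fm f0.
rewrite (le_trans (norm_rint If))// -rint_itv//.
have Iab := intg_itv a b.
rewrite -rintZ//; apply: le_rint; [exact: intg_abs|exact: intgZ|].
move=> x; rewrite indicE; have [|xab] := boolP (x \in _).
  by rewrite mulr1.
rewrite f0 ?normr0 ?mulr0//; apply: contra xab => xab.
by rewrite inE /= in_itv.
Qed.

(** The inner real integrals are [fine] of extended ones and fit into Fubini only when these are
    finite, hence the integrability of every section. *)
Lemma rint_swap (F : R * R -> R) : (mu \x mu)%E.-integrable setT (EFin \o F) ->
  (forall x, intg (fun y => F (x, y))) -> (forall y, intg (fun x => F (x, y))) ->
  rint (fun x => rint (fun y => F (x, y))) = rint (fun y => rint (fun x => F (x, y))).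
Proof.
move=> iF h1 h2; rewrite /rint /Rintegral; congr fine.
transitivity (\int[mu]_x \int[mu]_y (F (x, y))%:E)%E.
  by apply: eq_integral => x _; rewrite fineK//; have := integrable_fin_num measurableT (h1 x).
rewrite (Fubini iF).
by apply: eq_integral => x _; rewrite fineK//; have := integrable_fin_num measurableT (h2 x).
Qed.

Lemma meas_fst : measurable_fun setT (fun p : R * R => p.1).
Proof. exact: measurable_fst. Qed.
Lemma meas_snd : measurable_fun setT (fun p : R * R => p.2).
Proof. exact: measurable_snd. Qed.
Lemma meas_sub : measurable_fun setT (fun p : R * R => p.1 - p.2).
Proof. by apply: measurable_funB; [exact: meas_fst|exact: meas_snd]. Qed.

(** Tonelli with the integral in [p.1] taken first: by shift invariance it is the L1 norm of [v],
    whatever [p.2] is. *)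
Lemma conv_prod_int u v : intg u -> intg v ->
  (mu \x mu)%E.-integrable setT (fun p : R * R => (u p.2 * v (p.1 - p.2))%:E).
Proof.
move=> iu iv.
have mF : measurable_fun setT (fun p : R * R => (u p.2 * v (p.1 - p.2))%:E).
  apply/measurable_EFinP; apply: measurable_funM.
    exact: measurableT_comp (intg_meas iu) meas_snd.
  exact: measurableT_comp (intg_meas iv) meas_sub.
apply/integrable21ltyP => //=.
rewrite (_ : integral _ _ _ = \int[mu]_y (`|u y|%:E * \int[mu]_x `|v x|%:E))%E; last first.
  apply: eq_integral => y _.
  under eq_integral do rewrite normrM EFinM.
  rewrite ge0_integralZl//.
  - by rewrite (@ge0_int_shift (- y) (fun x => `|v x|%:E))//; apply/measurable_EFinP; apply: measurableT_comp => //; exact: intg_meas.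
  - apply/measurable_EFinP; apply: measurableT_comp => //.
    apply: measurableT_comp => //; first exact: intg_meas.
    exact: meas_addr.
have [_ lv] := (intg_P v).1 iv; have [mu' lu] := (intg_P u).1 iu.
have vf : (\int[mu]_x `|v x|%:E \is a fin_num)%E by rewrite ge0_fin_numE// integral_ge0.
rewrite -(fineK vf).
under eq_integral do rewrite muleC.
rewrite ge0_integralZl//.
- by rewrite lte_mul_pinfty// ?lee_fin ?fine_ge0// integral_ge0.
- by apply/measurable_EFinP; exact/measurableT_comp.
- by rewrite lee_fin fine_ge0// integral_ge0.
Qed.

End Lebesgue.

(** * Convolution *)

Section Convolution.
Variable R : realType.
Local Notation mu := (@lebesgue_measure R).
Implicit Types (u v w k : R -> R) (a b d e m n t A B : R).

(** Support in [[0, A)] makes convolution causal, and boundedness makes its integral converge at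
    every [t]; the convolution algebra below thus holds pointwise, not merely almost everywhere. *)
Definition cb u := measurable_fun setT u /\
  exists m A : R, [/\ 0 <= A, forall t, `|u t| <= m & forall t, ~~ (0 <= t < A) -> u t = 0].

Definition conv u v t := rint (fun x => u x * v (t - x)).

Lemma cb_meas u : cb u -> measurable_fun setT u. Proof. by case. Qed.

Lemma cb_intg u : cb u -> intg u.
Proof. by case=> mu' [m [A [_ um u0]]]; exact: intg_compact mu' um u0. Qed.

Lemma cb_bound u : cb u -> exists2 m : R, 0 <= m & forall t, `|u t| <= m.
Proof. by case=> _ [m [A [_ um u0]]]; exists m => //; exact: le_trans (um 0). Qed.

Lemma cb_neg u t : cb u -> t < 0 -> u t = 0.
Proof. by case=> _ [m [A [_ um u0]]] t0; rewrite u0// leNgt t0. Qed.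

Lemma meas_refl t : measurable_fun setT (fun x : R => t - x).
Proof. exact: measurable_funB. Qed.

Lemma meas_shift u a : measurable_fun setT u -> measurable_fun setT (fun x : R => u (x + a)).
Proof. by move=> mu'; apply: measurableT_comp => //; exact: meas_addr. Qed.

Lemma cbD u v : cb u -> cb v -> cb (fun t => u t + v t).
Proof.
move=> [mu1 [m [A [A0 um u0]]]] [mv [n [B [B0 vn v0]]]]; split; first exact: measurable_funD.
exists (m + n), (Num.max A B); split.
- by rewrite le_max A0.
- by move=> t; rewrite (le_trans (ler_normD _ _))// lerD.
- by move=> t; rewrite lt_max => h; rewrite u0 ?v0 ?addr0//; apply: contra h => /andP[-> ->]//; rewrite orbT.
Qed.

Lemma cbZ a u : cb u -> cb (fun t => a * u t).
Proof.
move=> [mu1 [m [A [A0 um u0]]]]; split; first exact: measurable_funM.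
exists (`|a| * m), A; split => //.
- by move=> t; rewrite normrM ler_wpM2l.
- by move=> t h; rewrite u0 ?mulr0.
Qed.

Lemma cbN u : cb u -> cb (fun t => - u t).
Proof. by move=> /(cbZ (-1)); congr cb; apply/funext => t; rewrite mulN1r. Qed.

Lemma cbB u v : cb u -> cb v -> cb (fun t => u t - v t).
Proof. by move=> cu cv; exact: (cbD cu (cbN cv)). Qed.

Lemma cb_shift u d : 0 <= d -> cb u -> cb (fun t => u (t - d)).
Proof.
move=> d0 [mu1 [m [A [A0 um u0]]]]; split; first exact: meas_shift.
exists m, (A + d); split => //.
- by rewrite addr_ge0.
- by move=> t h; rewrite u0//; apply: contra h; rewrite subr_ge0 ltrBlDr => /andP[dt ->]; rewrite (le_trans d0).
Qed.

(** The left factor is only integrable because square-integrable functions will stand there; the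
    right one is a bounded kernel. *)
Lemma conv_intg u v t : intg u -> cb v -> intg (fun x => u x * v (t - x)).
Proof.
move=> Iu cv; have [m m0 vm] := cb_bound cv.
apply: (intg_mul Iu _ (m := m)) => //.
apply: measurableT_comp; [exact: cb_meas|exact: meas_refl].
Qed.

Lemma conv_norm u v t m : intg u -> cb v -> (forall t, `|v t| <= m) ->
  `|conv u v t| <= rint (fun x => `|u x|) * m.
Proof.
move=> Iu cv vm; rewrite (le_trans (norm_rint (conv_intg t Iu cv)))//.
rewrite mulrC -rintZ; last exact: intg_abs.
apply: le_rint.
- exact/intg_abs/conv_intg.
- exact/intgZ/intg_abs.
- by move=> x; rewrite normrM mulrC ler_wpM2r.
Qed.

Lemma conv_meas u v : intg u -> cb v -> measurable_fun setT (conv u v).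
Proof.
move=> Iu cv.
have := @measurable_fubini_F _ _ _ _ R mu mu _ (conv_prod_int Iu (cb_intg cv)).
rewrite /fubini_F /= => mF.
have := measurableT_comp (_ : measurable_fun setT (@fine R)) mF.
by apply.
Qed.

Lemma convDl u1 u2 v t : intg u1 -> intg u2 -> cb v ->
  conv (fun x => u1 x + u2 x) v t = conv u1 v t + conv u2 v t.
Proof.
move=> I1u I2u cv; rewrite /conv -rintD; [|exact: conv_intg..].
by apply: eq_rint => x; rewrite mulrDl.
Qed.

Lemma convZl a u v t : intg u -> cb v -> conv (fun x => a * u x) v t = a * conv u v t.
Proof.
move=> Iu cv; rewrite /conv -rintZ; last exact: conv_intg.
by apply: eq_rint => x; rewrite mulrA.
Qed.

Lemma convBl u1 u2 v t : intg u1 -> intg u2 -> cb v ->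
  conv (fun x => u1 x - u2 x) v t = conv u1 v t - conv u2 v t.
Proof.
move=> I1u I2u cv; rewrite /conv -rintB; [|exact: conv_intg..].
by apply: eq_rint => x; rewrite mulrBl.
Qed.

Lemma conv_shiftl u v d t : measurable_fun setT u -> measurable_fun setT v ->
  conv (fun x => u (x - d)) v t = conv u v (t - d).
Proof.
move=> mu' mv; rewrite /conv -(@rint_shift _ (fun x => u x * v (t - d - x)) (- d)).
  by apply: eq_rint => x; congr (_ * v _); ring.
by apply: measurable_funM => //; apply: measurableT_comp => //; exact: meas_refl.
Qed.

Lemma convC u v : measurable_fun setT u -> measurable_fun setT v -> conv u v = conv v u.
Proof.
move=> mu' mv; apply/funext => t.
rewrite /conv -(@rint_opp _ (fun x => u x * v (t - x))); last first.
  by apply: measurable_funM => //; apply: measurableT_comp => //; exact: meas_refl.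
rewrite -(@rint_shift _ (fun x => u (- x) * v (t - - x)) (- t)).
  by apply: eq_rint => x; rewrite mulrC; congr (v _ * u _); ring.
apply: measurable_funM.
  by apply: measurableT_comp => //; exact: oppr_measurable.
apply: measurableT_comp => //.
by apply: (measurableT_comp (meas_refl t)); exact: oppr_measurable.
Qed.

Lemma conv_supp u v A B t : (forall t, ~~ (0 <= t < A) -> u t = 0) ->
  (forall t, ~~ (0 <= t < B) -> v t = 0) -> ~~ (0 <= t < A + B) -> conv u v t = 0.
Proof.
move=> u0 v0 h; rewrite /conv -[RHS](rint0 R); apply: eq_rint => x.
have [xA|/u0 ->] := boolP (0 <= x < A); last by rewrite mul0r.
have [xB|/v0 ->] := boolP (0 <= t - x < B); last by rewrite mulr0.
exfalso; move/negP: h; apply; lra.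
Qed.

(** A kernel vanishing on negative times sees only [x <= t]. This is what later replaces truncated
    functions by untruncated ones before the truncation time. *)
Lemma conv_causal u u' v A t : (forall s, s < A -> u s = u' s) ->
  (forall s, s < 0 -> v s = 0) -> t < A -> conv u v t = conv u' v t.
Proof.
move=> uu v0 tA; apply: eq_rint => x.
have [xA|Ax] := ltP x A; first by rewrite uu.
by rewrite v0 ?mulr0//; lra.
Qed.

Lemma cb_conv u v : cb u -> cb v -> cb (conv u v).
Proof.
move=> cu cv; split; first by apply: conv_meas => //; exact: cb_intg.
have [n n0 vn] := cb_bound cv.
have Iu := cb_intg cu.
have nb := fun t => conv_norm t Iu cv vn.
case: cu => [mu1 [m [A [A0 um u0]]]]; case: cv => [mv [n' [B [B0 vn' v0]]]].
exists (rint (fun x => `|u x|) * n), (A + B); split => //.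
- by rewrite addr_ge0.
- by move=> t; exact: conv_supp.
Qed.

Lemma convA u v w : cb u -> cb v -> cb w -> conv (conv u v) w = conv u (conv v w).
Proof.
move=> cu cv cw; apply/funext => t.
have [n n0 wn] := cb_bound cw; have Iu := cb_intg cu; have Iv := cb_intg cv.
have mw : measurable_fun setT (fun x : R => w (t - x)).
  by apply: measurableT_comp; [exact: cb_meas|exact: meas_refl].
transitivity (rint (fun x => rint (fun y => u y * v (x - y) * w (t - x)))).
  apply: eq_rint => x; rewrite mulrC -rintZ; last exact: conv_intg.
  by apply: eq_rint => y; rewrite mulrC.
transitivity (rint (fun y => rint (fun x => u y * v (x - y) * w (t - x)))); last first.
  apply: eq_rint => y; rewrite -rintZ; last exact: conv_intg.
  rewrite -(@rint_shift _ (fun x => u y * (v x * w (t - y - x))) (- y)).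
    by apply: eq_rint => x; rewrite mulrA; congr (_ * w _); ring.
  apply: measurable_funM => //; apply: measurable_funM; first exact: cb_meas.
  by apply: measurableT_comp; [exact: cb_meas|exact: meas_refl].
apply: (@rint_swap _ (fun p => u p.2 * v (p.1 - p.2) * w (t - p.1))).
- apply: (le_integrable measurableT _ _ (integrableZl measurableT n (conv_prod_int Iu Iv))).
    apply/measurable_EFinP; apply: measurable_funM.
      apply: measurable_funM; first exact: measurableT_comp (intg_meas Iu) (@meas_snd R).
      exact: measurableT_comp (intg_meas Iv) (@meas_sub R).
    exact: measurableT_comp mw (@meas_fst R).
  move=> p _ /=; rewrite lee_fin normrM mulrC [leRHS]normrM (ger0_norm n0).
  by rewrite ler_wpM2r.
- move=> x; have := intgZ (w (t - x)) (conv_intg x Iu cv).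
  by congr intg; apply/funext => y; rewrite mulrC.
- move=> y /=; apply: (intg_mul _ mw (m := n)) => //.
  exact/intgZ/intg_shift.
Qed.

Lemma unif_cont_itv (f : R -> R) a b e : 0 < e -> continuous f ->
  exists2 d : R, 0 < d & forall x y : R, a <= x <= b -> `|x - y| < d -> `|f x - f y| < e.
Proof.
move=> e0 cf.
have cK : compact `[a, b]%classic := @segment_compact R a b.
move: (cK) => /compact_near_coveringP /(_ R (0^'+) (fun d x => forall y, `|x - y| < d -> `|f x - f y| < e)).
move=> /(_ _) H.
have {H} : \forall d \near 0^'+, `[a, b]%classic `<=` (fun x => forall y, `|x - y| < d -> `|f x - f y| < e).
  apply: H => x _.
  have /(_ (e / 2)) : forall d : R, 0 < d -> \forall t \near x, `|f x - f t| < d.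
    by move: (cf x) => /cvgr_dist_lt.
  rewrite divr_gt0// => /(_ isT) /nbhs_ballP[r /= r0 rx].
  exists (ball x (r / 2), [set d | 0 < d < r / 2]) => /=.
    split; first by apply: nbhsx_ballx; rewrite divr_gt0.
    near=> d; apply/andP; split => //; near: d; apply: nbhs_right_lt; rewrite divr_gt0//.
  move=> [x' d] /= [bx' /andP[d0 dr]] y xy.
  have h1 := rx x'; have h2 := rx y; rewrite /ball /= in h1 h2 bx'.
  have {}h1 : `|f x - f x'| < e / 2 by apply: h1; lra.
  have {}h2 : `|f x - f y| < e / 2.
    apply: h2; rewrite -(subrK x' x) -addrA (le_lt_trans (ler_normD _ _))//; lra.
  have -> : f x' - f y = - (f x - f x') + (f x - f y) by ring.
  by rewrite (le_lt_trans (ler_normD _ _))// normrN; lra.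
move=> [d /= d0 dP].
exists (d / 2); first by rewrite divr_gt0.
move=> x y xab xy.
have h : `[a, b]%classic x by rewrite /= in_itv.
apply: (dP (d / 2) _ _ x h y xy) => //=; last by rewrite divr_gt0.
by rewrite sub0r normrN gtr0_norm ?divr_gt0//; lra.
Unshelve. all: by end_near. Qed.

(** Since [k] may jump, it is replaced by a continuous [kc] close to it in L1 on the range of
    [t - x], and uniform continuity of [kc] yields [d]. The modulus depends on [u] only through [A]
    and [m]. *)
Lemma conv_equicont k A B e : cb k -> 0 <= A -> 0 < e ->
  exists2 d : R, 0 < d & forall u m, measurable_fun setT u -> (forall t, `|u t| <= m) ->
    (forall t, ~~ (0 <= t < A) -> u t = 0) ->
    forall t t', 0 <= t <= B -> 0 <= t' <= B -> `|t - t'| < d ->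
    `|conv u k t - conv u k t'| <= e * m.
Proof.
move=> ck A0 e0.
(* The range of [t - x] for [0 <= t <= B] and [x] in the support of [u]. *)
pose E : set R := `[- A, B]%classic.
have mE : measurable (E : set (measurableTypeR R)) by exact: measurable_itv.
have fE : (mu E < +oo)%E.
  by rewrite lebesgue_measure_itv /=; case: ifP => // _; rewrite -EFinB ltry.
have IE : mu.-integrable E (EFin \o k).
  by apply: (integrableS measurableT) => //; exact: cb_intg.
have [g [cg ig /fine_cvgP[_ /cvgr0Pnorm_lt h]]] := approximation_continuous_integrable mE fE IE.
have e3 : 0 < e / 3 by rewrite divr_gt0.
have [n _ /(_ n (leqnn _)) /=] := h _ e3.
set kc := g n => hn.
have ckc : continuous kc := cg n.
pose ee x := if (- A <= x <= B) then `|k x - kc x| else 0.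
have eeE : ee = (fun x => `|k x - kc x|) \_ E.
  apply/funext => x; rewrite /ee patchE; congr (if _ then _ else _).
  by apply/idP/idP; rewrite inE /E /= in_itv.
have Iee : intg ee.
  rewrite eeE /intg -restrict_EFin.
  have := integrable_abse (integrableB mE IE (ig n)).
  by rewrite integrable_mkcond.
have ree : rint ee < e / 3.
  rewrite eeE /rint -Rintegral_mkcond; move: hn.
  by rewrite ger0_norm// fine_ge0// integral_ge0.
(* One third of [e] pays for the L1 error at [t], one for that at [t'], and one for the variation of
   [kc] over a support of length [A]; [A + 1] allows for [A = 0]. *)
have eA0 : 0 < e / 3 / (A + 1) by rewrite divr_gt0//; lra.
have [d d0 dP] := @unif_cont_itv kc (- A) B (e / 3 / (A + 1)) eA0 ckc.
exists d; first by apply: d0.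
move=> u m mu' um u0 t t' tB tB' tt.
have m0 : 0 <= m by exact: le_trans (um 0).
have Iu := intg_compact mu' um u0.
rewrite /conv -rintB; [|exact: conv_intg..].
have Ish s : intg (fun x => ee (s - x)).
  have := intg_opp (intg_shift s Iee).
  by congr intg; apply/funext => x; congr ee; ring.
have rsh s : rint (fun x => ee (s - x)) = rint ee.
  rewrite -(@rint_shift _ ee s); last exact: intg_meas.
  rewrite -(@rint_opp _ (fun x => ee (x + s))); last by apply: meas_shift; exact: intg_meas.
  by apply: eq_rint => x; congr ee; ring.
pose w x := e / 3 / (A + 1) * \1_(`[0, A[%classic) x : R.
have Iw : intg w by exact/intgZ/intg_itv.
have rw : rint w <= e / 3.
  rewrite rintZ; last exact: intg_itv.
  by rewrite rint_itv// subr0 -mulrA ler_piMr ?(ltW e3)// mulrC ler_pdivrMr ?mul1r; lra.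
apply: le_trans (norm_rint _) _.
  by apply: intgB; exact: conv_intg.
have Is : intg (fun x => m * (ee (t - x) + ee (t' - x) + w x)).
  by apply/intgZ/intgD => //; exact: intgD.
apply: (@le_trans _ _ (rint (fun x => m * (ee (t - x) + ee (t' - x) + w x)))); last first.
  rewrite rintZ; last by apply: intgD => //; exact: intgD.
  rewrite rintD//; last exact: intgD.
  rewrite rintD// !rsh mulrC ler_wpM2r//; lra.
apply: le_rint => //.
  by apply/intg_abs/intgB; exact: conv_intg.
move=> x.
have [xA|/u0 ->] := boolP (0 <= x < A); last first.
  rewrite !mul0r subrr normr0 mulr_ge0// !addr_ge0//.
  - by rewrite /ee; case: ifP.
  - by rewrite /ee; case: ifP.
  - by rewrite mulr_ge0// ?divr_ge0// ?ltW//; lra.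
rewrite -mulrBr normrM ler_pM//.
have -> : w x = e / 3 / (A + 1).
  by rewrite /w indicE mem_set ?mulr1//= in_itv.
have -> : ee (t - x) = `|k (t - x) - kc (t - x)| by rewrite /ee ifT//; lra.
have -> : ee (t' - x) = `|k (t' - x) - kc (t' - x)| by rewrite /ee ifT//; lra.
have h1 : `|kc (t - x) - kc (t' - x)| < e / 3 / (A + 1).
  by apply: dP; [lra|have -> : t - x - (t' - x) = t - t' by ring].
have -> : k (t - x) - k (t' - x) = (k (t - x) - kc (t - x)) -
  (k (t' - x) - kc (t' - x)) + (kc (t - x) - kc (t' - x)) by ring.
rewrite (le_trans (ler_normD _ _))// lerD ?(ltW h1)//.
by rewrite (le_trans (ler_normB _ _)).
Qed.

End Convolution.

(** * The Fredholm alternative in the sup norm *)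

Section Fredholm.
Variables (R : realType) (L : R).
Implicit Types (u v k : R -> R) (m a t : R).

(** Unlike in [cb], the support bound [L] is fixed, so that operators act on one space. *)
Definition bs u := [/\ measurable_fun setT u, exists m, forall t, `|u t| <= m &
  forall t, ~~ (0 <= t < L) -> u t = 0].

(** [T] is [R] for an operator and ['I_n] for a finite family of functionals. Linearity is asked on
    [bs] only, where the integrals concerned are additive. *)
Definition lin (T : Type) (F : (R -> R) -> T -> R) :=
  (forall u v (x : T), bs u -> bs v -> F (fun t => u t + v t) x = F u x + F v x) /\
  (forall a u (x : T), bs u -> F (fun t => a * u t) x = a * F u x).

Lemma bs_bound u : bs u -> exists2 m : R, 0 <= m & forall t, `|u t| <= m.
Proof. by case=> _ [m um] _; exists m => //; exact: le_trans (um 0). Qed.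

Lemma bs0 : bs (fun=> 0).
Proof. by split=> //; exists 0 => t; rewrite normr0. Qed.

Lemma bsD u v : bs u -> bs v -> bs (fun t => u t + v t).
Proof.
move=> [mu1 [m um] u0] [mv [n vn] v0]; split; first exact: measurable_funD.
- by exists (m + n) => t; rewrite (le_trans (ler_normD _ _))// lerD.
- by move=> t h; rewrite u0// v0// addr0.
Qed.

Lemma bsZ a u : bs u -> bs (fun t => a * u t).
Proof.
move=> [mu1 [m um] u0]; split; first exact: measurable_funM.
- by exists (`|a| * m) => t; rewrite normrM ler_wpM2l.
- by move=> t h; rewrite u0// mulr0.
Qed.

Lemma bsB u v : bs u -> bs v -> bs (fun t => u t - v t).
Proof.
move=> bu bv; have := bsD bu (bsZ (-1) bv).
by congr bs; apply/funext => t; rewrite mulN1r.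
Qed.

Lemma bs_sum (I : Type) (s : seq I) (F : I -> R -> R) :
  (forall i, bs (F i)) -> bs (fun t => \sum_(i <- s) F i t).
Proof.
move=> bF; elim: s => [|i s IH].
  by have := bs0; congr bs; apply/funext => t; rewrite big_nil.
have := bsD (bF i) IH.
by congr bs; apply/funext => t; rewrite big_cons.
Qed.

Section Lin.
Variables (T : Type) (F : (R -> R) -> T -> R).
Hypothesis linF : lin F.

Lemma lin0 (t : T) : F (fun=> 0) t = 0.
Proof.
transitivity (F (fun x => 0 * (fun=> 0) x) t).
  by congr (F _ t); apply/funext => x; rewrite mul0r.
by rewrite linF.2 ?mul0r//; exact: bs0.
Qed.

Lemma linB u v (t : T) : bs u -> bs v -> F (fun t => u t - v t) t = F u t - F v t.
Proof.
move=> bu bv; rewrite -mulN1r -linF.2// -linF.1//; last exact: bsZ.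
by congr F; apply/funext => x; rewrite mulN1r.
Qed.

Lemma lin_sum (I : Type) (s : seq I) (c : I -> R) (G : I -> R -> R) (t : T) :
  (forall i, bs (G i)) ->
  F (fun x => \sum_(i <- s) c i * G i x) t = \sum_(i <- s) c i * F (G i) t.
Proof.
move=> bG; elim: s => [|i s IH].
  rewrite big_nil -[RHS](lin0 t); congr F; apply/funext => x; exact: big_nil.
rewrite big_cons -IH -linF.2// -linF.1//; last 2 first.
- exact: bsZ.
- by apply: bs_sum => j; exact: bsZ.
by congr F; apply/funext => x; exact: big_cons.
Qed.

End Lin.

(** The radius [2 * m / 2 ^+ n] is the tail of the geometric series, so the intervals about [w n]
    with these radii are nested; the supremum of their left ends lies in all of them. *)
Lemma squeeze_seq (w : nat -> R) m : 0 <= m ->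
  (forall n, `|w n.+1 - w n| <= m / 2 ^+ n) ->
  exists v : R, forall n, `|v - w n| <= 2 * m / 2 ^+ n.
Proof.
move=> m0 wm.
pose lo n := w n - 2 * m / 2 ^+ n; pose hi n := w n + 2 * m / 2 ^+ n.
have e0 n : 0 <= m / 2 ^+ n by rewrite divr_ge0// exprn_ge0.
have half n : 2 * m / 2 ^+ n.+1 = m / 2 ^+ n.
  by rewrite exprS -mulf_div divff ?mul1r.
have step n : lo n <= lo n.+1 /\ hi n.+1 <= hi n.
  have := wm n; rewrite ler_norml /lo /hi half => /andP[h1 h2].
  have -> : 2 * m / 2 ^+ n = 2 * (m / 2 ^+ n) by rewrite mulrA.
  by split; lra.
have ndlo p n : (p <= n)%N -> lo p <= lo n.
  by move=> /subnKC <-; elim: (n - p)%N => [|j IH]; rewrite ?addn0// addnS (le_trans IH)// (step _).1.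
have nihi p n : (p <= n)%N -> hi n <= hi p.
  by move=> /subnKC <-; elim: (n - p)%N => [|j IH]; rewrite ?addn0// addnS (le_trans _ IH)// (step _).2.
have lohi p n : lo p <= hi n.
  apply: (@le_trans _ _ (lo (maxn p n))); first by rewrite ndlo// leq_maxl.
  apply: (@le_trans _ _ (hi (maxn p n))); last by rewrite nihi// leq_maxr.
  rewrite /lo /hi; have := e0 (maxn p n).
  have -> : 2 * m / 2 ^+ (maxn p n) = 2 * (m / 2 ^+ (maxn p n)) by rewrite mulrA.
  lra.
exists (sup (range lo)) => n.
have hs : has_sup (range lo).
  split; first by exists (lo 0%N), 0%N.
  by exists (hi 0%N) => _ [p _ <-].
have h1 : lo n <= sup (range lo) by apply: sup_upper_bound => //; exists n.
have h2 : sup (range lo) <= hi n.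
  by apply: ge_sup => [|_ [p _ <-]//]; case: hs.
rewrite ler_norml; move: h1 h2; rewrite /lo /hi.
by move=> h1 h2; apply/andP; split; lra.
Qed.

Section Neumann.
Variable E : (R -> R) -> R -> R.
Hypothesis linE : lin E.
Hypothesis bsE : forall u, bs u -> bs (E u).
Hypothesis half : forall u m, bs u -> (forall t, `|u t| <= m) -> forall t, `|E u t| <= m / 2.

Lemma geo_to0 m x : (forall n, x <= m / 2 ^+ n) -> x <= 0.
Proof.
move=> h; rewrite leNgt; apply/negP => x0.
have m0 : 0 < m by have := h 0%N; rewrite expr0 divr1; apply: lt_le_trans.
have [n hn] : exists n : nat, m / x < n%:R.
  by exists (Num.truncn (m / x)).+1; rewrite truncnS_gt.
have : n%:R <= 2 ^+ n :> R by rewrite -natrX ler_nat ltnW// ltn_expl.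
have := h n; rewrite ler_pdivlMr ?exprn_gt0//.
move: hn; rewrite ltr_pdivrMr// => h1 h2 h3.
have : x * n%:R <= x * 2 ^+ n by rewrite ler_wpM2l// ltW.
by rewrite mulrC; lra.
Qed.

Lemma neumann_uniq u : bs u -> (forall t, u t = E u t) -> forall t, u t = 0.
Proof.
move=> bu uE t; have [m m0 um] := bs_bound bu.
apply/eqP; rewrite -normr_le0; apply: (@geo_to0 m) => n.
elim: n t => [t|n IH t]; first by rewrite expr0 divr1.
rewrite uE exprSr invfM mulrA; exact: half.
Qed.

Lemma neumann k : bs k -> exists v, [/\ bs v, forall t, v t = k t + E v t &
  forall m, (forall t, `|k t| <= m) -> forall t, `|v t| <= 2 * m].
Proof.
move=> bk; have [m m0 km] := bs_bound bk.
pose w := fix w n := if n is n'.+1 then (fun t => k t + E (w n') t) else (fun=> 0 : R).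
have bw n : bs (w n).
  by elim: n => [|n IH]; [exact: bs0|exact/bsD/bsE].
have wd n : forall m t, (forall t, `|k t| <= m) -> `|w n.+1 t - w n t| <= m / 2 ^+ n.
  elim: n => [|n IH] p t kp.
    by rewrite /= subr0 lin0// addr0 expr0 divr1.
  have -> : w n.+2 t - w n.+1 t = E (fun s => w n.+1 s - w n s) t.
    by rewrite (linB linE t (bw n.+1) (bw n)) /=; ring.
  rewrite exprSr invfM mulrA; apply: half; first exact: (bsB (bw n.+1) (bw n)).
  by move=> s; exact: IH.
have /choice[v vP] t : exists vt : R, forall n, `|vt - w n t| <= 2 * m / 2 ^+ n.
  by apply: squeeze_seq => // n; exact: wd.
(* The squeeze is rerun with [p] in place of [m]; its limit [v'] equals [v t], since both are limits
   of [w n t]. *)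
have bnd p : (forall t, `|k t| <= p) -> forall t, `|v t| <= 2 * p.
  move=> kp t; have p0 : 0 <= p by exact: le_trans (kp 0).
  have [v' v'P] : exists vt : R, forall n, `|vt - w n t| <= 2 * p / 2 ^+ n.
    by apply: squeeze_seq => // n; exact: wd.
  have vv : v t = v'.
    apply/eqP; rewrite -subr_eq0 -normr_le0; apply: (@geo_to0 (2 * m + 2 * p)) => n.
    have -> : v t - v' = (v t - w n t) - (v' - w n t) by ring.
    rewrite (le_trans (ler_normB _ _))// mulrDl lerD//; exact: vP.
  by have := v'P 0%N; rewrite /= subr0 expr0 divr1 -vv.
have bv : bs v.
  split.
  - apply: (@measurable_fun_cvg _ _ R setT (fun n t => w n t) v).
      by move=> n; case: (bw n).
    move=> t _; apply/cvgrPdist_le => e e0.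
    near=> n; apply: le_trans (vP t n) _.
    rewrite ler_pdivrMr ?exprn_gt0// -ler_pdivrMl//.
    apply: (@le_trans _ _ n%:R); last by rewrite -natrX ler_nat ltnW// ltn_expl.
    by near: n; exact: nbhs_infty_ger.
  - by exists (2 * m); exact: bnd.
  - move=> t ht; apply/eqP; rewrite -normr_le0; apply: (@geo_to0 (2 * m)) => n.
    by have := vP t n; case: (bw n) => _ _ ->//; rewrite subr0.
exists v; split => // t.
apply/eqP; rewrite -subr_eq0 -normr_le0; apply: (@geo_to0 (2 * m)) => n.
have -> : v t - (k t + E v t) = (v t - w n.+1 t) + E (fun t => w n t - v t) t.
  by rewrite linB// /=; ring.
apply: (@le_trans _ _ (2 * m / 2 ^+ n.+1 + 2 * m / 2 ^+ n / 2)).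
  rewrite (le_trans (ler_normD _ _))// lerD//.
  apply: half; first exact: bsB.
  by move=> s; rewrite distrC.
by rewrite exprSr invfM mulrA -splitr.
Unshelve. all: by end_near. Qed.

(** * Finite-rank perturbations of a contraction *)

Section FiniteRank.
Variables (n : nat) (phi : 'I_n -> R -> R) (l : (R -> R) -> 'I_n -> R) (Lam : R).
Hypothesis bphi : forall j, bs (phi j).
Hypothesis linl : lin l.
Hypothesis l_bnd : forall u m j, bs u -> (forall t, `|u t| <= m) -> `|l u j| <= Lam * m.

Definition frk u t := E u t + \sum_j l u j * phi j t.

(** The operator [(1 - E)^-1], made total by an arbitrary value outside [bs]. *)
Let S k : {v : R -> R | bs k -> [/\ bs v, forall t, v t = k t + E v t &
  forall m, (forall t, `|k t| <= m) -> forall t, `|v t| <= 2 * m]}.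
Proof.
apply: cid; have [bk|nbk] := pselect (bs k); last by exists k.
by have [v vP] := neumann bk; exists v.
Qed.

Let psi j := sval (S (phi j)).
Let bpsi j : bs (psi j).
Proof. by have [] := svalP (S (phi j)) (bphi j). Qed.
Let psiE j t : psi j t = phi j t + E (psi j) t.
Proof. by have [_ h _] := svalP (S (phi j)) (bphi j); exact: h. Qed.

Let comb (v : 'rV[R]_n) t := \sum_j v 0 j * psi j t.
Let lv u : 'rV[R]_n := \row_j l u j.
(** A solution of [u = frk u] is [comb (lv u)], and [lv (comb v) = v *m G]: fixed points correspond
    to row vectors with [v *m G = v], and the problem becomes one about matrices. *)
Let G : 'M[R]_n := \matrix_(j, i) l (psi j) i.

Let bcomb (v : 'rV[R]_n) : bs (comb v).
Proof. by apply: bs_sum => j; exact: bsZ. Qed.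

Let lv_comb (v : 'rV[R]_n) : lv (comb v) = v *m G.
Proof.
apply/rowP => i; rewrite !mxE lin_sum//; apply: eq_bigr => j _.
by rewrite mxE.
Qed.

Let combE (v : 'rV[R]_n) t : comb v t = E (comb v) t + \sum_j v 0 j * phi j t.
Proof.
rewrite lin_sum// -big_split /=; apply: eq_bigr => j _.
by rewrite psiE; ring.
Qed.

(** The difference of the two sides is a fixed point of [E], hence zero. *)
Let sol_iff u k : bs u -> bs k -> (forall t, u t = k t + frk u t) ->
  forall t, u t = sval (S k) t + comb (lv u) t.
Proof.
move=> bu bk uE t; have [bS SE _] := svalP (S k) bk.
set s := sval (S k) in bS SE *.
apply/eqP; rewrite -subr_eq0; apply/eqP.
have bsc : bs (fun t => s t + comb (lv u) t) by exact: bsD.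
apply: (@neumann_uniq (fun t => u t - (s t + comb (lv u) t))); first exact: bsB.
move=> x; rewrite linB// linE.1// uE SE combE /frk.
have -> : \sum_j lv u 0 j * phi j x = \sum_j l u j * phi j x.
  by apply: eq_bigr => j _; rewrite mxE.
ring.
Qed.

Let ker_iff u : bs u -> (forall t, u t = frk u t) -> u = comb (lv u).
Proof.
move=> bu uE; apply/funext => t.
have S0 : forall t, sval (S (fun=> 0)) t = 0.
  have [b0 S0 _] := svalP (S (fun=> 0)) bs0.
  by apply: neumann_uniq => // x; rewrite S0 add0r.
have := @sol_iff u (fun=> 0) bu bs0 _ t; rewrite S0 add0r; apply.
by move=> x; rewrite add0r.
Qed.

Let ker_comb (v : 'rV[R]_n) : v *m G = v -> forall t, comb v t = frk (comb v) t.
Proof.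
move=> vG t; rewrite combE /frk; congr (_ + _); apply: eq_bigr => j _.
by congr (_ * _); have /rowP/(_ j) := lv_comb v; rewrite vG !mxE.
Qed.

Let ker_lv u : bs u -> (forall t, u t = frk u t) -> lv u *m G = lv u.
Proof. by move=> bu uE; rewrite -lv_comb -ker_iff. Qed.

(** If [v *m G = v] then [comb v] is a fixed point, hence zero, and so is [v = lv (comb v)]; thus
    [1%:M - G] is invertible. The constant [C] does not depend on [k], because the inverse on L2
    will have to be bounded. *)
Lemma fredholm_surj :
  (forall u, bs u -> (forall t, u t = frk u t) -> forall t, u t = 0) ->
  exists2 C : R, 0 <= C & forall k, bs k -> exists u, [/\ bs u, forall t, u t = k t + frk u t &
    forall m, (forall t, `|k t| <= m) -> forall t, `|u t| <= C * m].
Proof.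
move=> inj.
have uG : 1%:M - G \in unitmx.
  rewrite -row_free_unit -kermx_eq0; apply/eqP/row_matrixP => i; rewrite row0.
  set v := row i _.
  have vG : v *m G = v.
    apply/eqP; rewrite eq_sym -subr_eq0 -[X in X - _]mulmx1 -mulmxBr.
    by rewrite /v -row_mul mulmx_ker row0.
  have c0 := inj _ (bcomb v) (ker_comb vG).
  rewrite -vG -lv_comb; apply/rowP => j; rewrite !mxE.
  have -> : comb v = (fun=> 0) by apply/funext.
  exact: lin0.
set Q := invmx (1%:M - G).
have /choice[p pP] j : exists p : R, 0 <= p /\ forall t, `|psi j t| <= p.
  by have [p p0 pp] := bs_bound (bpsi j); exists p.
have Lam_ge0 (j : 'I_n) : 0 <= Lam.
  have z : forall t, `|(fun=> 0 : R) t| <= 1 by move=> t; rewrite normr0.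
  by have := l_bnd j bs0 z; rewrite lin0// normr0 mulr1.
pose C := 2 + \sum_j (\sum_i (Lam * 2) * `|Q i j|) * p j.
exists C.
  rewrite addr_ge0//; apply: sumr_ge0 => j _; rewrite mulr_ge0//; last exact: (pP j).1.
  by apply: sumr_ge0 => i _; rewrite !mulr_ge0// (Lam_ge0 j).
move=> k bk; have [bS SE Sb] := svalP (S k) bk.
set s := sval (S k) in bS SE Sb *.
(* For [u = s + comb v] the requirement [lv u = v] reads [lv s + v *m G = v]. *)
pose v := lv s *m Q.
exists (fun t => s t + comb v t).
have bu : bs (fun t => s t + comb v t) by exact: bsD.
have vE : lv (fun t => s t + comb v t) = v.
  have -> : lv (fun t => s t + comb v t) = lv s + v *m G.
    by rewrite -lv_comb; apply/rowP => j; rewrite !mxE linl.1.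
  have : v *m (1%:M - G) = lv s by rewrite /v mulmxKV.
  by rewrite mulmxBr mulmx1 => <-; rewrite subrK.
split => //.
- move=> t; rewrite /frk linE.1// {1}SE {1}combE.
  have -> : \sum_j l (fun t0 => s t0 + comb v t0) j * phi j t = \sum_j v 0 j * phi j t.
    by apply: eq_bigr => j _; rewrite -{2}vE mxE.
  ring.
- move=> m km t; rewrite (le_trans (ler_normD _ _))// /C mulrDl lerD//; first exact: Sb.
  have m0 : 0 <= m by exact: le_trans (km 0).
  rewrite mulr_suml (le_trans (ler_norm_sum _ _ _))//; apply: ler_sum => j _.
  rewrite normrM mulrAC ler_pM//; last exact: (pP j).2.
  rewrite mxE (le_trans (ler_norm_sum _ _ _))// mulr_suml; apply: ler_sum => i _.
  rewrite normrM mxE mulrAC ler_wpM2r// -mulrA; apply: l_bnd => //; exact: Sb.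
Qed.

(** * Eigenvectors of an operator acting on the fixed points *)

Section Eigen.
Variable B : (R -> R) -> R -> R.
Hypothesis linB' : lin B.
Hypothesis bsB' : forall u, bs u -> bs (B u).
Hypothesis Bker : forall u, bs u -> (forall t, u t = frk u t) -> forall t, B u t = frk (B u) t.

Let Bm : 'M[R]_n := \matrix_(j, i) l (B (psi j)) i.

Let lv_B (v : 'rV[R]_n) : lv (B (comb v)) = v *m Bm.
Proof.
have -> : B (comb v) = (fun t => \sum_j v 0 j * B (psi j) t).
  by apply/funext => t; rewrite lin_sum.
apply/rowP => i; rewrite !mxE lin_sum//.
  by apply: eq_bigr => j _; rewrite mxE.
by move=> j; exact: bsB'.
Qed.

(** The eigenvalue [al + i be] comes from a complex matrix, whereas the functions are real; [u1] and
    [u2] are the real and imaginary parts of an eigenvector. *)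
Lemma fredholm_eigen u0 : bs u0 -> (forall t, u0 t = frk u0 t) -> (exists t, u0 t != 0) ->
  exists (al be : R) (u1 u2 : R -> R), [/\ bs u1 /\ bs u2,
    (forall t, u1 t = frk u1 t) /\ (forall t, u2 t = frk u2 t),
    exists t, (u1 t != 0) || (u2 t != 0) &
    (forall t, B u1 t = al * u1 t - be * u2 t) /\ (forall t, B u2 t = al * u2 t + be * u1 t)].
Proof.
move=> bu0 u0E [t0 u0t].
pose K := kermx (1%:M - G).
have KP (m : nat) (v : 'M[R]_(m, n)) : (v <= K)%MS -> v *m G = v.
  by move=> /sub_kermxP; rewrite mulmxBr mulmx1 => /eqP; rewrite subr_eq0 eq_sym => /eqP.
(* That [comb (v *m Bm)] is [B (comb v)] is known only when [comb v] is a fixed point, so the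
   eigenvector has to be found inside the row space of [K]. *)
have stK : stablemx K Bm.
  apply/row_subP => i; rewrite row_mul; set v := row i K.
  have vG : v *m G = v by apply: (KP 1%N); exact: row_sub.
  have := ker_lv (bsB' (bcomb v)) (Bker (bcomb v) (ker_comb vG)).
  rewrite lv_B => h; apply/sub_kermxP.
  by rewrite mulmxBr mulmx1 h subrr.
have K0 : K != 0.
  apply/eqP => K0.
  have : (lv u0 <= K)%MS.
    by apply/sub_kermxP; rewrite mulmxBr mulmx1 ker_lv// subrr.
  rewrite K0 submx0 => /eqP l0; move/eqP: u0t; apply.
  rewrite (ker_iff bu0 u0E) l0 /comb big1// => j _.
  by rewrite mxE mul0r.
pose f := real_complex R.
pose Kc := map_mx f K; pose Bc := map_mx f Bm.
have stc : stablemx Kc Bc by rewrite -map_mxM map_submx.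
have rk : (0 < \rank Kc)%N by rewrite lt0n mxrank_eq0 map_mx_eq0.
have [lam /eigenvalueP[w wE w0]] := eigenvalue_closed (restrictmx Kc Bc) rk.
have [z [z0 zK zB]] : exists z : 'rV[R[i]]_n, [/\ z != 0, (z <= Kc)%MS & z *m Bc = lam *: z].
  exists (w *m row_base Kc); split.
  - by rewrite mulmx_free_eq0 ?row_base_free.
  - by rewrite (submx_trans (submxMl _ _))// eq_row_base.
  - have : (w <= eigenspace (restrictmx Kc Bc) lam)%MS by apply/eigenspaceP.
    rewrite sub_eigenspace_conjmx ?row_base_free ?stablemx_row_base//.
    by move=> /eigenspaceP.
pose z1 : 'rV[R]_n := map_mx (@complex.Re R) z; pose z2 : 'rV[R]_n := map_mx (@complex.Im R) z.
have Re_mul (x : R[i]) (y : R) : complex.Re (x * f y) = complex.Re x * y.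
  by case: x => a b; rewrite /= mulr0 subr0.
have Im_mul (x : R[i]) (y : R) : complex.Im (x * f y) = complex.Im x * y.
  by case: x => a b; rewrite /= mulr0 add0r.
have Re_sum (F : 'I_n -> R[i]) : complex.Re (\sum_j F j) = \sum_j complex.Re (F j).
  by apply: (big_morph _ _ (erefl _)) => -[a b] [c d].
have Im_sum (F : 'I_n -> R[i]) : complex.Im (\sum_j F j) = \sum_j complex.Im (F j).
  by apply: (big_morph _ _ (erefl _)) => -[a b] [c d].
have Remx (A : 'M[R]_n) : map_mx (@complex.Re R) (z *m map_mx f A) = z1 *m A.
  by apply/matrixP => i j; rewrite !mxE Re_sum; apply: eq_bigr => s _; rewrite !mxE Re_mul.
have Immx (A : 'M[R]_n) : map_mx (@complex.Im R) (z *m map_mx f A) = z2 *m A.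
  by apply/matrixP => i j; rewrite !mxE Im_sum; apply: eq_bigr => s _; rewrite !mxE Im_mul.
have zG : z *m map_mx f (1%:M - G) = 0 by apply/sub_kermxP; rewrite -map_kermx.
have z1G : z1 *m G = z1.
  apply: KP; apply/sub_kermxP; rewrite -Remx zG.
  by apply/matrixP => i j; rewrite !mxE.
have z2G : z2 *m G = z2.
  apply: KP; apply/sub_kermxP; rewrite -Immx zG.
  by apply/matrixP => i j; rewrite !mxE.
pose al := complex.Re lam; pose be := complex.Im lam.
have z1B : z1 *m Bm = al *: z1 - be *: z2.
  rewrite -Remx zB ; apply/matrixP => i j; rewrite !mxE /al /be.
  by clear; case: lam => a b; case: (z i j) => c d /=; ring.
have z2B : z2 *m Bm = al *: z2 + be *: z1.
  rewrite -Immx zB ; apply/matrixP => i j; rewrite !mxE /al /be.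
  by clear; case: lam => a b; case: (z i j) => c d /=; ring.
have combL (x y : R) (v v' : 'rV[R]_n) t : comb (x *: v + y *: v') t = x * comb v t + y * comb v' t.
  rewrite /comb !mulr_sumr -big_split /=; apply: eq_bigr => j _; rewrite !mxE; ring.
have BE (v : 'rV[R]_n) : v *m G = v -> B (comb v) = comb (v *m Bm).
  move=> vG; rewrite -lv_B; apply: ker_iff; first exact: bsB'.
  by apply: Bker => //; exact: ker_comb.
exists al, be, (comb z1), (comb z2); split => //.
- by split; exact: ker_comb.
- apply: contrapT => /forallNP h.
  have c1 : comb z1 = (fun=> 0).
    by apply/funext => t; apply/eqP; have /negP := h t; rewrite negb_or !negbK => /andP[].
  have c2 : comb z2 = (fun=> 0).
    by apply/funext => t; apply/eqP; have /negP := h t; rewrite negb_or !negbK => /andP[].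
  have lv0 : lv (fun=> 0) = 0 by apply/rowP => j; rewrite !mxE lin0.
  have z10 : z1 = 0 by rewrite -z1G -lv_comb c1.
  have z20 : z2 = 0 by rewrite -z2G -lv_comb c2.
  move/eqP: z0; apply; apply/matrixP => i j.
  move/matrixP/(_ i j): z10; move/matrixP/(_ i j): z20; rewrite !mxE.
  by case: (z i j) => a b /= -> ->.
- split => t; rewrite BE// ?z1B ?z2B; last by rewrite combL.
  by rewrite -scaleNr combL mulNr.
Qed.

End Eigen.
End FiniteRank.
End Neumann.
End Fredholm.

(** * Primitives and exponential test functions *)

Section Primitive.
Variable R : realType.
Local Notation mu := (@lebesgue_measure R).
Variable L : R.
Hypothesis L0 : 0 < L.
Implicit Types (u v w k : R -> R) (a m t d A : R).

(** The Heaviside function cut at [L] in order to lie in [cb]; for causal functions, convolution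
    with it is the primitive at times below [L]. *)
Definition Hv t : R := if 0 <= t < L then 1 else 0.

Lemma Hv_meas : measurable_fun setT Hv.
Proof.
apply: measurable_fun_ifT => //; apply: measurable_and.
  exact: measurable_fun_ler.
exact: measurable_fun_ltr.
Qed.

Lemma cbH : cb Hv.
Proof.
split; first exact: Hv_meas.
exists 1, L; split; first exact: ltW.
  by move=> t; rewrite /Hv; case: ifP; rewrite ?normr1 ?normr0.
by move=> t h; rewrite /Hv (negbTE h).
Qed.

Lemma Hv_neg t : t < 0 -> Hv t = 0.
Proof. by move=> t0; rewrite /Hv leNgt t0. Qed.

Lemma Hv1 t : 0 <= t < L -> Hv t = 1.
Proof. by rewrite /Hv => ->. Qed.

Lemma conv_H_neg u t : cb u -> t < 0 -> conv u Hv t = 0.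
Proof. by move=> cu t0; apply: (cb_neg _ t0); exact: cb_conv cu cbH. Qed.

Lemma conv_H_total u A t : (forall t, ~~ (0 <= t < A) -> u t = 0) -> A <= t -> t < L ->
  conv u Hv t = rint u.
Proof.
move=> u0 At tL; apply: eq_rint => x.
have [xA|/u0 ->] := boolP (0 <= x < A); last by rewrite mul0r.
by rewrite Hv1 ?mulr1//; lra.
Qed.

Lemma conv_H_small u m a c t : cb u -> 0 <= m -> a <= t < c -> (forall s, s < a -> u s = 0) ->
  (forall s, s < c -> `|u s| <= m) -> `|conv u Hv t| <= m * (c - a).
Proof.
move=> cu m0 atc u0 um; apply: rint_compact; first by lra.
- apply: measurable_funM; first exact: cb_meas.
  by apply: measurableT_comp; [exact: Hv_meas|exact: meas_refl].
- move=> x; have [xc|xc] := ltP x c; last by rewrite Hv_neg ?mulr0 ?normr0//; lra.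
  rewrite normrM -[m]mulr1 ler_pM// ?um//.
  by rewrite /Hv; case: ifP; rewrite ?normr1 ?normr0.
- move=> x h; have [xa|xa] := ltP x a; first by rewrite u0// mul0r.
  by rewrite Hv_neg ?mulr0//; lra.
Qed.

(** Time is swept in windows of length [h]. On earlier windows [u] and [v] vanish, so their
    primitives see only the current one, and every use of the hypotheses halves the bound there. *)
Lemma gronwall u v K : cb u -> cb v -> 0 <= K ->
  (forall t, t < L -> `|u t| <= K * (`|conv u Hv t| + `|conv v Hv t|)) ->
  (forall t, t < L -> `|v t| <= K * (`|conv u Hv t| + `|conv v Hv t|)) ->
  forall t, t < L -> u t = 0 /\ v t = 0.
Proof.
move=> cu cv K0 hu hv.
have [m1 m10 um] := cb_bound cu; have [m2 m20 vm] := cb_bound cv.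
(* Each of the two primitives is at most [h] times the current bound; this [h] makes [K * (2 * h)]
   at most one half. *)
pose m := m1 + m2; pose h := (4 * (K + 1))^-1.
have h0 : 0 < h by rewrite invr_gt0 mulr_gt0//; lra.
have Kh : K * (2 * h) <= 2^-1.
  have : (4 * (K + 1)) * h = 1 by rewrite mulfV// gt_eqF//; lra.
  rewrite mulrCA (_ : 4 * (K + 1) * h = 4 * (K * h) + 4 * h); last by ring.
  lra.
have step (n : nat) : forall t, t < n%:R * h -> t < L -> u t = 0 /\ v t = 0.
  elim: n => [|n IH] t tn tL.
    by rewrite mul0r in tn; rewrite (cb_neg cu tn) (cb_neg cv tn).
  have [tn'|tn'] := ltP t (n%:R * h); first exact: IH.
  have geo (i : nat) : forall s, s < n.+1%:R * h -> s < L ->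
      `|u s| <= m / 2 ^+ i /\ `|v s| <= m / 2 ^+ i.
    elim: i => [|i IHi] s sn sL.
      rewrite expr0 divr1; split; first by rewrite (le_trans (um s))// lerDl.
      by rewrite (le_trans (vm s))// lerDr.
    have [sn'|sn'] := ltP s (n%:R * h).
      have [-> ->] := IH _ sn' sL.
      by rewrite normr0 divr_ge0// ?addr_ge0 ?exprn_ge0.
    pose c := Num.min (n.+1%:R * h) L.
    have sc : n%:R * h <= s < c by rewrite sn' lt_min sn.
    have mi : 0 <= m / 2 ^+ i by rewrite divr_ge0 ?addr_ge0 ?exprn_ge0.
    have cE : c - n%:R * h <= h.
      by rewrite lerBlDr ge_min -natr1 mulrDl mul1r [h + _]addrC lexx.
    have bu : `|conv u Hv s| <= m / 2 ^+ i * h.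
      apply: le_trans (@conv_H_small u (m / 2 ^+ i) _ _ _ cu mi sc _ _) _.
      - by move=> x xn; apply: (IH _ xn _).1; lra.
      - by move=> x; rewrite lt_min => /andP[x1 x2]; apply: (IHi _ x1 x2).1.
      - by rewrite ler_wpM2l.
    have bv : `|conv v Hv s| <= m / 2 ^+ i * h.
      apply: le_trans (@conv_H_small v (m / 2 ^+ i) _ _ _ cv mi sc _ _) _.
      - by move=> x xn; apply: (IH _ xn _).2; lra.
      - by move=> x; rewrite lt_min => /andP[x1 x2]; apply: (IHi _ x1 x2).2.
      - by rewrite ler_wpM2l.
    have tot : K * (`|conv u Hv s| + `|conv v Hv s|) <= m / 2 ^+ i.+1.
      apply: (@le_trans _ _ (m / 2 ^+ i * (K * (2 * h)))).
        rewrite mulrCA ler_wpM2l//; lra.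
      have -> : m / 2 ^+ i.+1 = m / 2 ^+ i / 2 by rewrite exprSr invfM mulrA.
      exact: ler_wpM2l.
    by split; [apply: le_trans (hu s sL) _|apply: le_trans (hv s sL) _].
  split; apply/eqP; rewrite -normr_le0; apply: (@geo_to0 _ m) => i.
    exact: (geo i t tn tL).1.
  exact: (geo i t tn tL).2.
move=> t tL; apply: (step (Num.truncn (L / h)).+1 t) => //.
by rewrite (lt_trans tL)// -ltr_pdivrMr// truncnS_gt.
Qed.

(** Lebesgue differentiation: [u] is almost everywhere the derivative of its primitive. As [u] is
    only measurable, the conclusion is in L1 and not pointwise. *)
Lemma prim_zero u A : cb u -> A < L -> (forall t, ~~ (0 <= t < A) -> u t = 0) ->
  (forall t, t < L -> conv u Hv t = 0) -> rint (fun t => `|u t|) = 0.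
Proof.
move=> cu AL u0 c0; have Iu := cb_intg cu.
have iu y : mu.-integrable `]-oo, y] (EFin \o u).
  by apply: (integrableS measurableT) => //; exact: measurable_itv.
have lu : locally_integrable [set: R] u.
  exact: (open_integrable_locally openT Iu).
have := FTC1Ny iu lu; set F := fun x => _ => hF.
have F0 x : x < L -> F x = 0.
  move=> xL; rewrite /F Rintegral_mkcond -(c0 x xL); apply: eq_rint => y.
  rewrite patchE; case: ifPn => h.
    have yx : y <= x by move: h; rewrite inE /= in_itv.
    have [yA|/u0 ->] := boolP (0 <= y < A); last by rewrite mul0r.
    by rewrite Hv1 ?mulr1//; lra.
  rewrite Hv_neg ?mulr0//; rewrite subr_lt0 ltNge; apply: contra h => h.
  by rewrite inE /= in_itv.
have ae0 : {ae mu, forall x, u x = 0}.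
  move: hF; apply: (@filterS _ _ (ae_filter_ringOfSetsType mu)) => x [dF F'].
  have [xL|xL] := ltP x L; last by apply: u0; lra.
  rewrite -F' derive1E (@near_eq_derive _ _ _ _ (cst 0)) ?derive_cst//.
  near=> y; apply: F0; near: y; exact: lt_nbhsl.
have h := ae_eq_integral_abs mu measurableT (measurable_int mu Iu).
rewrite /rint /Rintegral.
have -> : (\int[mu]_x (`|u x|)%:E = 0)%E.
  by apply/h; move: ae0; apply: (@filterS _ _ (ae_filter_ringOfSetsType mu)) => x /= ->.
by [].
Unshelve. all: by end_near. Qed.

(** * Integration by parts against a test function *)

Section Test.
Variables (phi psi : R -> R).
Hypothesis dphi : forall x : R, is_derive x 1 phi (- psi x).
Hypothesis cpsi : continuous psi.
Definition cut (f : R -> R) t : R := if 0 <= t < L then f t else 0.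
Hypothesis cphi_cb : cb (cut phi).
Hypothesis cpsi_cb : cb (cut psi).

Lemma test_tail x : 0 <= x <= L ->
  rint (fun t => cut psi t * Hv (t - x)) = phi x - phi L.
Proof.
move=> /andP[x0 xL].
have -> : rint (fun t => cut psi t * Hv (t - x)) = \int[mu]_(t in `[x, L[) psi t.
  rewrite Rintegral_mkcond; apply: eq_rint => t; rewrite patchE.
  rewrite /cut; case: ifPn => [h|h]; case: ifPn => [h'|h'].
  - rewrite inE /= in_itv /= in h'; rewrite Hv1 ?mulr1//; lra.
  - rewrite Hv_neg ?mulr0//; rewrite subr_lt0 ltNge; apply: contra h' => h'.
    by rewrite inE /= in_itv /= h'; case/andP: h.
  - by rewrite inE /= in_itv /= in h'; case/negP: h; lra.
  - by rewrite mul0r.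
have cw : {within `[x, L], continuous psi} by apply: continuous_subspaceT.
have ipsi : mu.-integrable `[x, L] (EFin \o psi).
  by apply: continuous_compact_integrable => //; exact: segment_compact.
rewrite Rintegral_itv_bndo_bndc; last first.
  apply: integrableS ipsi => //.
  by apply: subset_itvl; rewrite bnd_simp.
move: xL; rewrite le_eqVlt => /predU1P[->|xL].
  by rewrite set_itv1 Rintegral_set1 subrr.
have dN : forall y : R, is_derive y 1 (fun z => - phi z) (psi y).
  by move=> y; rewrite -[psi y]opprK; apply: is_deriveN.
have cN : continuous (fun z => - phi z).
  move=> y; apply: differentiable_continuous; apply/derivable1_diffP.
  by have := dN y => -[].
rewrite /Rintegral (@continuous_FTC2 _ psi (fun z => - phi z) x L)//.
- by rewrite -EFinB /=; ring.
- split.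
  + by move=> y _; have := dN y => -[].
  + by apply: cvg_at_right_filter; exact: cN.
  + by apply: cvg_at_left_filter; exact: cN.
- by move=> y _; rewrite derive1E; have := dN y => -[].
Qed.

(** Fubini, then [test_tail] for each [x]. With [phi = e^{-s t}] and [psi = s phi] this is the
    division by [s] of the transform of a primitive; [phi L * rint u] is the boundary term left by
    the cut at [L]. *)
Lemma test_prim u A : cb u -> A <= L -> (forall t, ~~ (0 <= t < A) -> u t = 0) ->
  rint (fun t => cut psi t * conv u Hv t) = rint (fun t => u t * phi t) - phi L * rint u.
Proof.
move=> cu AL u0; have Iu := cb_intg cu.
have [p p0 pp] := cb_bound cpsi_cb.
have IH x : intg (fun t => cut psi t * Hv (t - x)).
  apply: (@intg_mul _ _ _ 1 (cb_intg cpsi_cb)).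
    apply: measurableT_comp; first exact: Hv_meas.
    exact: (meas_addr (- x)).
  by move=> t; rewrite /Hv; case: ifP; rewrite ?normr1 ?normr0.
have Iphi : intg (fun t => u t * phi t).
  have [q q0 qq] := cb_bound cphi_cb.
  have := intg_mul Iu (cb_meas cphi_cb) qq.
  congr intg; apply/funext => t; rewrite /cut; case: ifPn => // h.
  by rewrite u0 ?mul0r//; apply: contra h; lra.
transitivity (rint (fun t => rint (fun x => u x * Hv (t - x) * cut psi t))).
  apply: eq_rint => t; rewrite -rintZ; last exact: conv_intg cbH.
  by apply: eq_rint => x; ring.
rewrite (@rint_swap _ (fun p => u p.2 * Hv (p.1 - p.2) * cut psi p.1)).
- rewrite -rintZ// -rintB//; last exact: intgZ.
  apply: eq_rint => x /=.
  rewrite (_ : rint _ = u x * rint (fun t => cut psi t * Hv (t - x))); last first.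
    by rewrite -rintZ//; apply: eq_rint => t; ring.
  have [xA|/u0 ->] := boolP (0 <= x < A); last by rewrite !mul0r mulr0 subrr.
  by rewrite test_tail; [ring|lra].
- have cvi := conv_prod_int Iu (cb_intg cbH).
  apply: (le_integrable measurableT _ _ (integrableZl measurableT p cvi)).
    apply/measurable_EFinP; apply: measurable_funM.
      apply: measurable_funM; first exact: measurableT_comp (intg_meas Iu) (@meas_snd R).
      exact: measurableT_comp Hv_meas (@meas_sub R).
    exact: measurableT_comp (cb_meas cpsi_cb) (@meas_fst R).
  move=> z _ /=; rewrite lee_fin normrM mulrC [leRHS]normrM (ger0_norm p0).
  by rewrite ler_wpM2r.
- move=> t /=; have := intgZ (cut psi t) (conv_intg t Iu cbH).
  by congr intg; apply/funext => x; ring.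
- move=> x /=; have := intgZ (u x) (IH x).
  by congr intg; apply/funext => t; ring.
Qed.

End Test.

(** Real and imaginary parts of [e^{-t s}] for [s = x + i y]. As real test functions they keep the
    transforms below within real integrals. *)
Definition cexp_re (x y t : R) := expR (- (t * x)) * cos (t * y).
Definition cexp_im (x y t : R) := - (expR (- (t * x)) * sin (t * y)).

Lemma is_derive_cexp_re x y t : is_derive t 1 (cexp_re x y) (- (x * cexp_re x y t - y * cexp_im x y t)).
Proof.
rewrite /cexp_re; apply: is_derive_eq; rewrite /cexp_im /= /GRing.scale /=; ring.
Qed.

Lemma is_derive_cexp_im x y t : is_derive t 1 (cexp_im x y) (- (x * cexp_im x y t + y * cexp_re x y t)).
Proof.
rewrite /cexp_im; apply: is_derive_eq; rewrite /cexp_re /= /GRing.scale /=; ring.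
Qed.

Lemma cexp_re_cont x y : continuous (cexp_re x y).
Proof.
move=> t; apply: differentiable_continuous; apply/derivable1_diffP.
by have := is_derive_cexp_re x y t => -[].
Qed.

Lemma cexp_im_cont x y : continuous (cexp_im x y).
Proof.
move=> t; apply: differentiable_continuous; apply/derivable1_diffP.
by have := is_derive_cexp_im x y t => -[].
Qed.

Lemma cb_cut (f : R -> R) : continuous f -> cb (cut f).
Proof.
move=> cf; have mf : measurable_fun setT f by exact: continuous_measurable_fun.
have [m hm] : exists m, forall t, 0 <= t <= L -> `|f t| <= m.
  have cL := @segment_compact R 0 L.
  have /compact_bounded[m [_ hm]] : compact (f @` `[0, L]%classic).
    by apply: continuous_compact cL; exact: continuous_subspaceT.
  exists (m + 1) => t tL; apply: (hm (m + 1)); first by rewrite ltrDl.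
  by exists t => //=; rewrite in_itv.
split.
  apply: measurable_fun_ifT => //; apply: measurable_and.
    exact: measurable_fun_ler.
  exact: measurable_fun_ltr.
exists (Num.max m 0), L; split; first exact: ltW.
- move=> t; rewrite /cut; case: ifP => h; last by rewrite normr0 le_max lexx orbT.
  by rewrite le_max hm//; lra.
- by move=> t h; rewrite /cut (negbTE h).
Qed.

Lemma rint_conv u v : cb u -> cb v -> rint (conv u v) = rint u * rint v.
Proof.
move=> cu cv; have Iu := cb_intg cu; have Iv := cb_intg cv.
rewrite (@rint_swap _ (fun p => u p.2 * v (p.1 - p.2))).
- rewrite mulrC -rintZ//; apply: eq_rint => x /=.
  rewrite rintZ; last exact: (intg_shift (- x) Iv).
  by rewrite (@rint_shift _ v (- x)); [exact: mulrC|exact: cb_meas].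
- exact: conv_prod_int.
- by move=> t; exact: conv_intg.
- by move=> x /=; apply: intgZ; exact: (intg_shift (- x) Iv).
Qed.

End Primitive.

(** * Square-integrable functions supported in [[0, L)] *)

Section SquareIntegrable.
Variable R : realType.
Implicit Types (u v k : R -> R) (a m t d L : R).

Definition supp L u := forall t, ~~ (0 <= t < L) -> u t = 0.

Definition sqnorm u := rint (fun t => u t ^+ 2).

Definition L2supp L u := [/\ measurable_fun setT u, intg (fun t => u t ^+ 2) & supp L u].

Lemma sqnorm_ge0 u : 0 <= sqnorm u.
Proof. by apply: rint_ge0 => t; exact: sqr_ge0. Qed.

Lemma bs_cb L u : 0 <= L -> bs L u -> cb u.
Proof. by move=> L0 [mu1 [m um] u0]; split=> //; exists m, L. Qed.

Lemma bs_L2supp L u : bs L u -> L2supp L u.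
Proof.
move=> [mu1 [m um] u0]; split => //.
apply: (@intg_compact _ _ 0 L (m ^+ 2)).
- exact: measurable_funX.
- by move=> t; rewrite normrX lerXn2r ?nnegrE// (le_trans _ (um t)).
- by move=> t /u0 ->; rewrite expr0n.
Qed.

Lemma sqnorm_bs L u m : 0 <= L -> bs L u -> (forall t, `|u t| <= m) -> sqnorm u <= m ^+ 2 * L.
Proof.
move=> L0 [mu1 _ u0] um.
have : `|sqnorm u| <= m ^+ 2 * (L - 0).
  apply: rint_compact => //.
  - exact: measurable_funX.
  - by move=> t; rewrite normrX lerXn2r ?nnegrE// (le_trans _ (um t)).
  - by move=> t /u0 ->; rewrite expr0n.
by rewrite subr0; apply: le_trans; exact: ler_norm.
Qed.

Lemma L2supp_intg L u : L2supp L u -> intg u.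
Proof.
move=> [mu1 Iu u0].
apply: (@intg_le _ _ (fun t => \1_(`[0, L[%classic) t + u t ^+ 2)) => //.
  by apply: intgD => //; exact: intg_itv.
move=> t; rewrite indicE; have [_|] := boolP (t \in _).
  have : 0 <= (`|u t| - 1) ^+ 2 by exact: sqr_ge0.
  by rewrite sqrrB1 real_normK ?num_real// => h; rewrite mulr1n; have := normr_ge0 (u t); lra.
move=> tL; rewrite u0 ?normr0 ?expr0n ?addr0//.
by apply: contra tL => tL; rewrite inE /= in_itv.
Qed.

(* Integrating [(|u| - mean)^2 >= 0] over [[0, L)] gives Cauchy-Schwarz against a constant. *)
Lemma norm1_L2supp L u : 0 < L -> L2supp L u -> rint (fun t => `|u t|) ^+ 2 <= L * sqnorm u.
Proof.
move=> L0 su; have Iu := L2supp_intg su; case: su => mu1 Iu2 u0.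
set r := rint _; pose c := r / L.
have Iabs : intg (fun t => `|u t|) by exact: intg_abs.
have h : 0 <= rint (fun t => u t ^+ 2 - 2 * c * `|u t| + c ^+ 2 * \1_(`[0, L[%classic) t).
  apply: rint_ge0 => t; rewrite indicE; have [_|] := boolP (t \in _).
    have : 0 <= (`|u t| - c) ^+ 2 by exact: sqr_ge0.
    by rewrite sqrrB real_normK ?num_real// mulr1 -mulr_natl => h; lra.
  move=> tL; rewrite u0 ?normr0 ?expr0n ?mulr0 ?subr0 ?addr0//.
  by apply: contra tL => tL; rewrite inE /= in_itv.
rewrite rintD in h; last 2 first.
- by apply: intgB => //; exact: intgZ.
- exact/intgZ/intg_itv.
rewrite rintB// in h; last exact: intgZ.
rewrite !rintZ// in h; last exact: intg_itv.
rewrite (rint_itv (ltW L0)) subr0 -/r -/(sqnorm u) in h.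
have cL : c * L = r by rewrite /c divfK// gt_eqF.
have : L * (sqnorm u - 2 * c * r + c ^+ 2 * L) = L * sqnorm u - r ^+ 2.
  by rewrite -cL; ring.
by rewrite -subr_ge0 => <-; rewrite mulr_ge0// ltW.
Qed.

(** The inequality [(u + v)^2 <= 2 u^2 + 2 v^2] stands in for Minkowski: only the existence of
    constants matters. *)
Lemma L2suppD L u v : L2supp L u -> L2supp L v ->
  L2supp L (fun t => u t + v t) /\ sqnorm (fun t => u t + v t) <= 2 * sqnorm u + 2 * sqnorm v.
Proof.
move=> [mu1 Iu u0] [mv Iv v0].
have le t : (u t + v t) ^+ 2 <= 2 * u t ^+ 2 + 2 * v t ^+ 2.
  have : 0 <= (u t - v t) ^+ 2 by exact: sqr_ge0.
  by rewrite sqrrB sqrrD; lra.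
have I2 : intg (fun t => 2 * u t ^+ 2 + 2 * v t ^+ 2) by apply: intgD; exact: intgZ.
have Is : intg (fun t => (u t + v t) ^+ 2).
  apply: intg_le I2 _; first by apply: measurable_funX; exact: measurable_funD.
  by move=> t; rewrite ger0_norm// sqr_ge0.
split.
  split => //; first exact: measurable_funD.
  by move=> t h; rewrite u0// v0// addr0.
rewrite /sqnorm -!rintZ// -rintD//; [|exact: intgZ..].
exact: le_rint.
Qed.

Lemma L2suppM L k u m : measurable_fun setT k -> (forall t, `|k t| <= m) -> L2supp L u ->
  L2supp L (fun t => k t * u t) /\ sqnorm (fun t => k t * u t) <= m ^+ 2 * sqnorm u.
Proof.
move=> mk km [mu1 Iu u0].
have m0 : 0 <= m by exact: le_trans (km 0).
have le t : (k t * u t) ^+ 2 <= m ^+ 2 * u t ^+ 2.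
  by rewrite exprMn ler_wpM2r ?sqr_ge0// -(real_normK (num_real (k t))) lerXn2r ?nnegrE.
have I2 : intg (fun t => m ^+ 2 * u t ^+ 2) by exact: intgZ.
have Is : intg (fun t => (k t * u t) ^+ 2).
  apply: intg_le I2 _; first by apply: measurable_funX; exact: measurable_funM.
  by move=> t; rewrite ger0_norm// sqr_ge0.
split.
  split => //; first exact: measurable_funM.
  by move=> t h; rewrite u0// mulr0.
rewrite /sqnorm -rintZ//; exact: le_rint.
Qed.

Lemma L2suppB L u v : L2supp L u -> L2supp L v ->
  L2supp L (fun t => u t - v t) /\ sqnorm (fun t => u t - v t) <= 2 * sqnorm u + 2 * sqnorm v.
Proof.
move=> su sv.
have [sN nN] : L2supp L (fun t => -1 * v t) /\ sqnorm (fun t => -1 * v t) <= 1 ^+ 2 * sqnorm v.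
  by apply: (@L2suppM L (fun=> -1)) => // t; rewrite normrN1.
have := L2suppD su sN.
have -> : (fun t => u t + -1 * v t) = (fun t => u t - v t).
  by apply/funext => t; rewrite mulN1r.
move=> [s1 n1]; split => //; apply: le_trans n1 _.
by move: nN; rewrite expr1n mul1r; lra.
Qed.

(** The bound compares squared norms, so [C] is the square of an operator bound. *)
Definition sqb L (F : (R -> R) -> R -> R) := exists2 C, 0 <= C &
  forall u, L2supp L u -> L2supp L (F u) /\ sqnorm (F u) <= C * sqnorm u.

Lemma sqb_id L : sqb L (fun u => u).
Proof. by exists 1 => // u su; rewrite mul1r. Qed.

Lemma sqbD L F G : sqb L F -> sqb L G -> sqb L (fun u t => F u t + G u t).
Proof.
move=> [C C0 hF] [C' C0' hG]; exists (2 * C + 2 * C') => [|u su].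
  by rewrite addr_ge0// mulr_ge0.
have [sF nF] := hF u su; have [sG nG] := hG u su.
have [s n] := L2suppD sF sG; split => //; apply: le_trans n _; lra.
Qed.

Lemma sqbM L k m F : measurable_fun setT k -> (forall t, `|k t| <= m) -> sqb L F ->
  sqb L (fun u t => k t * F u t).
Proof.
move=> mk km [C C0 hF]; exists (m ^+ 2 * C) => [|u su].
  by rewrite mulr_ge0// sqr_ge0.
have [sF nF] := hF u su; have [s n] := L2suppM mk km sF.
split => //; apply: le_trans n _; rewrite -[leRHS]mulrA; apply: ler_wpM2l => //; exact: sqr_ge0.
Qed.

Lemma sqb_comp L F G : sqb L F -> sqb L G -> sqb L (fun u => F (G u)).
Proof.
move=> [C C0 hF] [C' C0' hG]; exists (C * C') => [|u su]; first exact: mulr_ge0.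
have [sG nG] := hG u su; have [s n] := hF _ sG.
by split => //; apply: le_trans n _; rewrite -mulrA ler_wpM2l.
Qed.

Lemma sqb_sum L (I : Type) (s : seq I) (F : I -> (R -> R) -> R -> R) :
  0 <= L -> (forall i, sqb L (F i)) -> sqb L (fun u t => \sum_(i <- s) F i u t).
Proof.
move=> L0 hF; elim: s => [|i s IH].
  exists 0 => // u su; have b0 := bs0 L.
  have -> : (fun t => \sum_(i <- [::]) F i u t) = (fun=> 0).
    by apply/funext => t; rewrite big_nil.
  split; first exact: bs_L2supp.
  by have := @sqnorm_bs L (fun=> 0) 0 L0 b0; rewrite expr0n mul0r mul0r; apply => t; rewrite normr0.
have := sqbD (hF i) IH; congr (sqb L _).
by apply/funext => u; apply/funext => t; rewrite big_cons.
Qed.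

End SquareIntegrable.

(** * The glued operator *)

Section Operator.
Variables (R : realType) (a2 a3 a23 b tau2 tau3 D : R) (N M : R -> R).
Implicit Types (u v k g f h : R -> R) (a m t d : R).
Hypothesis b0 : b != 0.
Hypothesis t2_gt0 : 0 < tau2.
Hypothesis t23_le : tau2 <= tau3.
Hypothesis tD : tau2 + tau3 < D.
Local Notation t23 := (tau2 + tau3).
Local Notation L := (D + (tau2 + tau3)).
Hypothesis bsN : bs t23 N.
Hypothesis bsM : bs D M.

Local Ltac slra := move: t2_gt0 t23_le tD => ? ? ?; lra.

Let D0 : 0 < D. Proof. slra. Qed.
Let L0 : 0 < L. Proof. slra. Qed.
Let L0' : 0 <= L. Proof. slra. Qed.
Let cbN : cb N. Proof. by apply: bs_cb bsN; slra. Qed.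
Let cbM : cb M. Proof. by apply: bs_cb bsM; slra. Qed.

Definition gpart u t := if t < D then u t else 0.
Definition fpart u t := if 0 <= t then u (t + D) else 0.
Definition At u t := a2 * u (t - tau2) + a3 * u (t - tau3) + a23 * u (t - t23).
(** Takes [g] and [f] separately, because it is also applied to the primitives [gt] and [ft], which
    agree with the two parts of a glued function only below [L]. *)
Definition TT g f t := g t - At g t + b * f (t - D) + conv f M t - conv g N t.
Definition That u := TT (gpart u) (fpart u).
(** [cc * u] gathers the two undelayed terms [g] and [b f(. - D)]; inverting this multiplier is
    where [b != 0] enters. *)
Definition cc t := if t < D then 1 else b.
Definition ic t := (cc t)^-1.
Definition P u t := ic t * At (gpart u) t.
Definition Z u t := conv (gpart u) N t - conv (fpart u) M t.

Lemma cc_neq0 t : cc t != 0.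
Proof. by rewrite /cc; case: ifP. Qed.

Lemma ThatE u t : That u t = cc t * (u t - P u t) - Z u t.
Proof.
rewrite /P mulrBr /ic mulrA divff ?cc_neq0// mul1r /That /TT /Z.
have -> : cc t * u t = gpart u t + b * fpart u (t - D).
  rewrite /cc /gpart /fpart subr_ge0 subrK; case: ltP => // _; first by rewrite mul1r mulr0 addr0.
  by rewrite add0r.
ring.
Qed.

Lemma That0E u t : That u t = 0 <-> u t = P u t + ic t * Z u t.
Proof.
rewrite ThatE; split.
  move/eqP; rewrite subr_eq0 => /eqP <-; rewrite /ic mulKf ?cc_neq0//; ring.
by move=> {1}->; rewrite addrAC subrr add0r /ic mulVKf ?cc_neq0// subrr.
Qed.

Lemma ThatE_sol u h t : u t = P u t + ic t * (h t + Z u t) -> That u t = h t.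
Proof.
by move=> e; rewrite ThatE {1}e addrAC subrr add0r /ic mulVKf ?cc_neq0//; ring.
Qed.

Lemma meas_lt d : measurable_fun setT (fun t => t < d).
Proof. exact: measurable_fun_ltr. Qed.

Lemma meas_le d : measurable_fun setT (fun t => d <= t).
Proof. exact: measurable_fun_ler. Qed.

Lemma ic_meas : measurable_fun setT ic.
Proof.
rewrite (_ : ic = fun t => if t < D then 1 else b^-1); last first.
  by apply/funext => t; rewrite /ic /cc; case: ifP; rewrite ?invr1.
by apply: measurable_fun_ifT => //; exact: meas_lt.
Qed.

Lemma ic_bound t : `|ic t| <= 1 + `|b^-1|.
Proof.
by rewrite /ic /cc; case: ifP => _; rewrite ?invr1 ?normr1 ?lerDl ?lerDr.
Qed.

Lemma cc_meas : measurable_fun setT cc.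
Proof. by apply: measurable_fun_ifT => //; exact: meas_lt. Qed.

Lemma cc_bound t : `|cc t| <= 1 + `|b|.
Proof. by rewrite /cc; case: ifP => _; rewrite ?normr1 ?lerDl ?lerDr. Qed.

Lemma gpart_meas u : measurable_fun setT u -> measurable_fun setT (gpart u).
Proof. by move=> mu1; apply: measurable_fun_ifT => //; exact: meas_lt. Qed.

Lemma fpart_meas u : measurable_fun setT u -> measurable_fun setT (fpart u).
Proof.
by move=> mu1; apply: measurable_fun_ifT => //; [exact: meas_le|exact: meas_shift].
Qed.

Lemma gpart_supp u : supp L u -> supp D (gpart u).
Proof.
move=> u0 t; rewrite /gpart; case: ifP => // tD' h; apply: u0; slra.
Qed.

Lemma fpart_supp u : supp L u -> supp t23 (fpart u).
Proof.
move=> u0 t; rewrite /fpart; case: ifP => // tD' h; apply: u0; slra.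
Qed.

Lemma gpart_bs u : bs L u -> bs D (gpart u).
Proof.
move=> [mu1 [m um] u0]; split; [exact: gpart_meas| |exact: gpart_supp].
by exists m => t; rewrite /gpart; case: ifP => // _; rewrite normr0 (le_trans _ (um 0)).
Qed.

Lemma fpart_bs u : bs L u -> bs t23 (fpart u).
Proof.
move=> [mu1 [m um] u0]; split; [exact: fpart_meas| |exact: fpart_supp].
by exists m => t; rewrite /fpart; case: ifP => // _; rewrite normr0 (le_trans _ (um 0)).
Qed.

Lemma gpart_bound u m : (forall t, `|u t| <= m) -> forall t, `|gpart u t| <= m.
Proof. by move=> um t; rewrite /gpart; case: ifP => // _; rewrite normr0 (le_trans _ (um 0)). Qed.

Lemma fpart_bound u m : (forall t, `|u t| <= m) -> forall t, `|fpart u t| <= m.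
Proof. by move=> um t; rewrite /fpart; case: ifP => // _; rewrite normr0 (le_trans _ (um 0)). Qed.

Lemma norm_gpart u t : `|gpart u t| <= `|u t|.
Proof. by rewrite /gpart; case: ifP => // _; rewrite normr0. Qed.

Lemma norm_fpart u t : `|fpart u t| <= `|u (t + D)|.
Proof. by rewrite /fpart; case: ifP => // _; rewrite normr0. Qed.

Lemma gpart_intg u : intg u -> intg (gpart u).
Proof.
move=> Iu; apply: intg_le (intg_abs Iu) (norm_gpart u).
exact: gpart_meas (intg_meas Iu).
Qed.

Lemma fpart_intg u : intg u -> intg (fpart u).
Proof.
move=> Iu; apply: intg_le (intg_abs (intg_shift D Iu)) (norm_fpart u).
exact: fpart_meas (intg_meas Iu).
Qed.

Lemma gpartD u v : gpart (fun t => u t + v t) = (fun t => gpart u t + gpart v t).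
Proof. by apply/funext => t; rewrite /gpart; case: ifP => // _; rewrite addr0. Qed.
Lemma fpartD u v : fpart (fun t => u t + v t) = (fun t => fpart u t + fpart v t).
Proof. by apply/funext => t; rewrite /fpart; case: ifP => // _; rewrite addr0. Qed.
Lemma gpartZ a u : gpart (fun t => a * u t) = (fun t => a * gpart u t).
Proof. by apply/funext => t; rewrite /gpart; case: ifP => // _; rewrite mulr0. Qed.
Lemma fpartZ a u : fpart (fun t => a * u t) = (fun t => a * fpart u t).
Proof. by apply/funext => t; rewrite /fpart; case: ifP => // _; rewrite mulr0. Qed.

Lemma PD u v : P (fun t => u t + v t) = (fun t => P u t + P v t).
Proof. by apply/funext => t; rewrite /P gpartD /At; ring. Qed.
Lemma PZ a u : P (fun t => a * u t) = (fun t => a * P u t).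
Proof. by apply/funext => t; rewrite /P gpartZ /At; ring. Qed.

Lemma P_zero : P (fun=> 0) = fun=> 0.
Proof. by apply/funext => t; rewrite /P /At /gpart !if_same; ring. Qed.

Lemma ZD u v t : intg u -> intg v -> Z (fun t => u t + v t) t = Z u t + Z v t.
Proof.
move=> Iu Iv; rewrite /Z gpartD fpartD !convDl//; [ring|exact: fpart_intg..|exact: gpart_intg|].
exact: gpart_intg.
Qed.

Lemma ZZ a u t : intg u -> Z (fun t => a * u t) t = a * Z u t.
Proof.
move=> Iu; rewrite /Z gpartZ fpartZ !convZl//; [ring|exact: fpart_intg|exact: gpart_intg].
Qed.

Lemma Z_supp u : supp L u -> supp L (Z u).
Proof.
move=> u0 t h; rewrite /Z.
have N0 : supp t23 N by case: bsN. have M0 : supp D M by case: bsM.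
rewrite (conv_supp (gpart_supp u0) N0 h) (conv_supp (fpart_supp u0) M0) ?subr0//.
by rewrite [X in _ < X]addrC.
Qed.

(** Controlling the supremum by an L1 norm is what turns square-integrable input into bounded
    output. *)
Lemma Z_bound : exists2 z, 0 <= z & forall u t, intg u -> `|Z u t| <= z * rint (fun t => `|u t|).
Proof.
have [n n0 Nn] := bs_bound bsN; have [m m0 Mm] := bs_bound bsM.
exists (n + m) => [|u t Iu]; first exact: addr_ge0.
rewrite /Z (le_trans (ler_normB _ _))// mulrC mulrDr lerD//.
  apply: le_trans (conv_norm t (gpart_intg Iu) cbN Nn) _; rewrite ler_wpM2r//.
  by apply: le_rint; [exact/intg_abs/gpart_intg|exact: intg_abs|exact: norm_gpart].
apply: le_trans (conv_norm t (fpart_intg Iu) cbM Mm) _; rewrite ler_wpM2r//.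
rewrite -(@rint_shift _ (fun t => `|u t|) D); last by apply: measurableT_comp => //; exact: intg_meas.
by apply: le_rint; [exact/intg_abs/fpart_intg|exact/intg_abs/intg_shift|exact: norm_fpart].
Qed.

Lemma Z_bs u : intg u -> supp L u -> bs L (Z u).
Proof.
move=> Iu u0; have [z z0 Zz] := Z_bound; split.
- by apply: measurable_funB; apply: conv_meas => //; [exact: gpart_intg|exact: fpart_intg].
- by exists (z * rint (fun t => `|u t|)) => t; exact: Zz.
- exact: Z_supp.
Qed.

Lemma bs_intg u : bs L u -> intg u. Proof. by move=> bu; exact/cb_intg/bs_cb/bu. Qed.

Lemma bs_mul k u m : measurable_fun setT k -> (forall t, `|k t| <= m) -> bs L u ->
  bs L (fun t => k t * u t).
Proof.
move=> mk km [mu1 [n un] u0]; split; first exact: measurable_funM.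
- by exists (m * n) => t; rewrite normrM ler_pM.
- by move=> t h; rewrite u0// mulr0.
Qed.

Lemma bs_ic u : bs L u -> bs L (fun t => ic t * u t).
Proof. by apply: bs_mul; [exact: ic_meas|exact: ic_bound]. Qed.

Lemma gpart_shift_supp u d : 0 <= d <= t23 -> supp L u -> supp L (fun t => gpart u (t - d)).
Proof. by move=> d0 u0 t h; apply: gpart_supp => //; slra. Qed.

Lemma P_supp u : supp L u -> supp L (P u).
Proof.
move=> u0 t h; rewrite /P /At.
have z d : 0 <= d <= t23 -> gpart u (t - d) = 0 by move=> hd; exact: (gpart_shift_supp hd u0 h).
by rewrite !z ?mulr0 ?addr0 ?mulr0//; slra.
Qed.

Definition pbd := (1 + `|b^-1|) * (`|a2| + `|a3| + `|a23|).

Lemma pbd_ge0 : 0 <= pbd.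
Proof. by rewrite mulr_ge0// !addr_ge0. Qed.

Lemma P_bound u m : (forall t, `|u t| <= m) -> forall t, `|P u t| <= pbd * m.
Proof.
move=> um t; have gm := gpart_bound um.
rewrite /P normrM /pbd -mulrA ler_pM//; first exact: ic_bound.
rewrite /At !mulrDl (le_trans (ler_normD _ _))// lerD//; last by rewrite normrM ler_wpM2l.
by rewrite (le_trans (ler_normD _ _))// lerD// normrM ler_wpM2l.
Qed.

Lemma At_meas u : measurable_fun setT u -> measurable_fun setT (At u).
Proof.
move=> mu1; rewrite /At; apply: measurable_funD; first apply: measurable_funD.
all: by apply: measurable_funM => //; exact: meas_shift.
Qed.

Lemma P_meas u : measurable_fun setT u -> measurable_fun setT (P u).
Proof.
move=> mu1; apply: measurable_funM; first exact: ic_meas.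
exact: At_meas (gpart_meas mu1).
Qed.

Lemma P_bs u : bs L u -> bs L (P u).
Proof.
move=> [mu1 [m um] u0]; split; [exact: P_meas| |exact: P_supp].
by exists (pbd * m); exact: P_bound.
Qed.

(** [gpart u] vanishes from [D] on, so a delay of at most [tau2 + tau3] keeps the support inside
    [[0, L)]. *)
Lemma sqb_shift d : 0 <= d <= t23 -> sqb L (fun u t => gpart u (t - d)).
Proof.
move=> hd; exists 1 => // u [mu1 Iu u0].
have mg : measurable_fun setT (gpart u) by exact: gpart_meas.
have Ig : intg (fun t => gpart u t ^+ 2).
  apply: intg_le Iu _; first exact: measurable_funX.
  by move=> t; rewrite normrX -(real_normK (num_real (u t))) lerXn2r ?nnegrE// norm_gpart.
split; first split.
- exact: meas_shift.
- exact: (intg_shift (- d) Ig).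
- exact: gpart_shift_supp.
- rewrite mul1r /sqnorm (@rint_shift _ (fun t => gpart u t ^+ 2) (- d)); last exact: intg_meas.
  apply: le_rint => // t.
  by rewrite -(real_normK (num_real (u t))) -(real_normK (num_real (gpart u t))) lerXn2r ?nnegrE// norm_gpart.
Qed.

Lemma sqb_P : sqb L P.
Proof.
apply: (sqbM ic_meas ic_bound); rewrite /At.
apply: sqbD; first apply: sqbD.
- by apply: (@sqbM _ _ (fun=> a2) `|a2|) => //; apply: sqb_shift; slra.
- by apply: (@sqbM _ _ (fun=> a3) `|a3|) => //; apply: sqb_shift; slra.
- by apply: (@sqbM _ _ (fun=> a23) `|a23|) => //; apply: sqb_shift; slra.
Qed.

(** Chosen so that [np * tau2 > L]: after [np] applications of [P] the delays have pushed the whole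
    support past [L]. *)
Definition np := (Num.truncn (L / tau2)).+1.

(** The Neumann series of [(1 - P)^-1], stopped at [np] because all later terms vanish on functions
    supported in [[0, L)]. *)
Definition RP h t := \sum_(0 <= k < np) iter k P h t.

Lemma iter_bs (i : nat) h : bs L h -> bs L (iter i P h).
Proof. by move=> bh; elim: i => //= i IH; exact: P_bs. Qed.

Lemma iter_supp (i : nat) h : supp L h -> supp L (iter i P h).
Proof. by move=> bh; elim: i => //= i IH; exact: P_supp. Qed.

Lemma iter_van (i : nat) h t : supp L h -> t < i%:R * tau2 -> iter i P h t = 0.
Proof.
move=> h0; elim: i t => [|k IH] t.
  by rewrite mul0r => t0 /=; apply: h0; slra.
rewrite -natr1 mulrDl mul1r => tk /=; rewrite /P /At.
have z d : tau2 <= d -> gpart (iter k P h) (t - d) = 0.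
  by move=> hd; rewrite /gpart; case: ifP => // _; apply: IH; slra.
by rewrite !z ?mulr0 ?addr0 ?mulr0//; slra.
Qed.

Lemma iter_np h : supp L h -> iter np P h = fun=> 0.
Proof.
move=> h0; apply/funext => t.
have [tL|tL] := boolP (0 <= t < L); last exact: iter_supp.
apply: iter_van => //; apply: (@lt_trans _ _ L); first by case/andP: tL.
by rewrite -ltr_pdivrMr// truncnS_gt.
Qed.

Lemma P_sum (n : nat) h : P (fun t => \sum_(0 <= k < n) iter k P h t) =
  fun t => \sum_(0 <= k < n) iter k.+1 P h t.
Proof.
elim: n => [|n IH].
  have -> : (fun t => \sum_(0 <= k < 0) iter k P h t) = fun=> 0.
    by apply/funext => t; rewrite big_nil.
  by rewrite P_zero; apply/funext => t; rewrite big_nil.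
have -> : (fun t => \sum_(0 <= k < n.+1) iter k P h t) =
    fun t => \sum_(0 <= k < n) iter k P h t + iter n P h t.
  by apply/funext => t; rewrite big_nat_recr.
by rewrite PD IH; apply/funext => t; rewrite [RHS]big_nat_recr.
Qed.

Lemma RP_sol h t : supp L h -> RP h t = P (RP h) t + h t.
Proof.
move=> h0; rewrite P_sum /RP; have := iter_np h0; rewrite /np.
set n := Num.truncn _ => e; rewrite big_nat_recl//= [in RHS]big_nat_recr//=.
by have /(congr1 (fun F => F t)) /= -> := e; rewrite addr0 addrC.
Qed.

Lemma RPD h v t : RP (fun t => h t + v t) t = RP h t + RP v t.
Proof.
rewrite /RP -big_split /=; apply: eq_bigr => k _.
by elim: k t => //= k IH t; rewrite (_ : iter k P _ = fun t => iter k P h t + iter k P v t) ?PD//; exact/funext.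
Qed.

Lemma RPZ a h t : RP (fun t => a * h t) t = a * RP h t.
Proof.
rewrite /RP mulr_sumr; apply: eq_bigr => k _.
by elim: k t => //= k IH t; rewrite (_ : iter k P _ = fun t => a * iter k P h t) ?PZ//; exact/funext.
Qed.

Lemma RP_uniq u h : supp L u -> (forall t, u t = P u t + h t) -> u = RP h.
Proof.
move=> u0 uE.
have E (n : nat) t : u t = iter n P u t + \sum_(0 <= k < n) iter k P h t.
  elim: n t => [|n IH] t; first by rewrite big_nil addr0.
  rewrite uE {1}(_ : u = (fun t => iter n P u t + \sum_(0 <= k < n) iter k P h t)); last exact/funext.
  by rewrite PD P_sum -addrA big_nat_recl//= [h t + _]addrC.
apply/funext => t; rewrite (E np t) iter_np// add0r//.
Qed.

Lemma RP_bs h : bs L h -> bs L (RP h).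
Proof. by move=> bh; apply: bs_sum => k; exact: iter_bs. Qed.

Definition rbd := \sum_(0 <= k < np) pbd ^+ k.

Lemma rbd_ge0 : 0 <= rbd.
Proof. by apply: sumr_ge0 => k _; rewrite exprn_ge0// pbd_ge0. Qed.

Lemma RP_bound h m : (forall t, `|h t| <= m) -> forall t, `|RP h t| <= rbd * m.
Proof.
move=> hm t; rewrite mulr_suml (le_trans (ler_norm_sum _ _ _))//; apply: ler_sum => k _.
elim: k t => [|k IH] t; first by rewrite mul1r.
by rewrite exprS -mulrA; exact: P_bound.
Qed.

Lemma sqb_RP : sqb L RP.
Proof.
apply: sqb_sum => // k; elim: k => [|k IH]; first exact: sqb_id.
exact: sqb_comp sqb_P IH.
Qed.

Lemma Z_equicont e : 0 < e -> exists2 d : R, 0 < d &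
  forall u m, bs L u -> (forall t, `|u t| <= m) ->
    forall t t', 0 <= t <= L -> 0 <= t' <= L -> `|t - t'| < d ->
    `|Z u t - Z u t'| <= e * m.
Proof.
move=> e0; have e2 : 0 < e / 2 by rewrite divr_gt0.
have [d1 d10 h1] := @conv_equicont _ N D L (e / 2) cbN (ltW D0) e2.
have t23_ge0 : 0 <= t23 by slra.
have [d2 d20 h2] := @conv_equicont _ M t23 L (e / 2) cbM t23_ge0 e2.
exists (Num.min d1 d2); first by rewrite lt_min d10.
move=> u m bu um t t' tL tL'; rewrite lt_min => /andP[td1 td2].
have [mg _ g0] := gpart_bs bu; have [mf _ f0] := fpart_bs bu.
have k1 := h1 _ m mg (gpart_bound um) g0 t t' tL tL' td1.
have k2 := h2 _ m mf (fpart_bound um) f0 t t' tL tL' td2.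
rewrite /Z (_ : conv _ N t - _ - _ = (conv (gpart u) N t - conv (gpart u) N t') -
  (conv (fpart u) M t - conv (fpart u) M t')); last by ring.
rewrite (le_trans (ler_normB _ _))// (splitr e) mulrDl lerD//.
Qed.

Lemma lin_Z : lin L Z.
Proof. by split=> [u v t bu bv|a u t bu]; rewrite ?ZD ?ZZ//; exact: bs_intg. Qed.

(* [RP (ic * Z u)] is sampled in time: [Z u] is replaced by its value at the left end of each of
   finitely many short intervals, which leaves a contraction plus a finite-rank operator. *)
Lemma RPZ_finite_rank : exists (E : (R -> R) -> R -> R) (n : nat) (phi : 'I_n -> R -> R)
    (l : (R -> R) -> 'I_n -> R) (Lam : R),
  [/\ lin L E, forall u, bs L u -> bs L (E u),
     forall u m, bs L u -> (forall t, `|u t| <= m) -> forall t, `|E u t| <= m / 2,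
     (forall j, bs L (phi j)) &
     [/\ lin L l, forall u m j, bs L u -> (forall t, `|u t| <= m) -> `|l u j| <= Lam * m &
     forall u t, frk E phi l u t = RP (fun t => ic t * Z u t) t]].
Proof.
have kb : 0 <= 1 + `|b^-1| by rewrite addr_ge0.
(* Makes [rbd * (1 + |b^-1|) * e] at most one half, the contraction factor of [E]; the added [1]
   keeps the denominator positive. *)
pose e := (2 * (rbd * (1 + `|b^-1|) + 1))^-1.
have e0 : 0 < e by rewrite invr_gt0 mulr_gt0// ltr_wpDl// mulr_ge0// rbd_ge0.
have [d d0 dP] := Z_equicont e0.
(* Enough subintervals of [[0, L)] for their length [w] to be smaller than the modulus [d]. *)
pose n := (Num.truncn (L / d)).+1.
pose w := L / n%:R.
have n0 : 0 < n%:R :> R by rewrite ltr0n.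
have w0 : 0 < w by rewrite divr_gt0.
have wd : w < d by rewrite /w ltr_pdivrMr// mulrC -ltr_pdivrMr// truncnS_gt.
pose chi (j : 'I_n) t : R := if (j%:R * w <= t) && (t < j.+1%:R * w) then 1 else 0.
have wn : n%:R * w = L by rewrite /w mulrC divfK// gt_eqF.
have bchi j : bs L (chi j).
  split.
  - apply: measurable_fun_ifT => //; apply: measurable_and; [exact: meas_le|exact: meas_lt].
  - by exists 1 => t; rewrite /chi; case: ifP; rewrite ?normr1 ?normr0.
  - move=> t; rewrite /chi; case: ifP => // /andP[h1 h2] /negP[].
    rewrite (le_trans _ h1) ?mulr_ge0 ?(ltW w0)//= (lt_le_trans h2)// -wn ler_wpM2r ?(ltW w0)//.
    by rewrite ler_nat.
pose l u (j : 'I_n) := Z u (j%:R * w).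
have ll : lin L l.
  by split=> [u v j bu bv|a u j bu]; rewrite /l ?lin_Z.1 ?lin_Z.2.
pose S u t := \sum_j l u j * chi j t.
have bS u : bs L (S u) by apply: bs_sum => j; exact: bsZ.
pose E u := RP (fun t => ic t * (Z u t - S u t)).
pose phi j := RP (fun t => ic t * chi j t).
have SD u v t : bs L u -> bs L v -> S (fun t => u t + v t) t = S u t + S v t.
  move=> bu bv; rewrite /S -big_split /=; apply: eq_bigr => j _.
  by rewrite ll.1// mulrDl.
have SZ a u t : bs L u -> S (fun t => a * u t) t = a * S u t.
  move=> bu; rewrite /S mulr_sumr; apply: eq_bigr => j _.
  by rewrite ll.2// mulrA.
have bZ u : bs L u -> bs L (Z u) by move=> bu; apply: Z_bs; [exact: bs_intg|case: bu].
have [z z0 Zz] := Z_bound.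
exists E, n, phi, l, (z * L); split.
- split=> [u v t bu bv|a u t bu].
    rewrite /E -RPD; congr (RP _ t); apply/funext => s.
    by rewrite lin_Z.1// SD//; ring.
  rewrite /E -RPZ; congr (RP _ t); apply/funext => s.
  by rewrite lin_Z.2// SZ//; ring.
- by move=> u bu; apply/RP_bs/bs_ic/bsB => //; exact: bZ.
- move=> u m bu um t.
  have m0 : 0 <= m by exact: le_trans (um 0).
  have ZS s : `|Z u s - S u s| <= e * m.
    have [sL|sL] := boolP (0 <= s < L); last first.
      case: (bZ _ bu) => _ _ ->//; case: (bS u) => _ _ ->//.
      by rewrite subrr normr0 mulr_ge0// ltW.
    have sw0 : 0 <= s / w by rewrite divr_ge0 ?(ltW w0)//; case/andP: sL.
    (* [truncn (s / w)] is the index of the subinterval containing [s], hence of the only nonzero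
       term of [S u s]. *)
    have /andP[j1 j2] := truncn_itv sw0.
    have jn : (Num.truncn (s / w) < n)%N.
      rewrite -(ltr_nat R) (le_lt_trans j1)// ltr_pdivrMr// wn.
      by case/andP: sL.
    pose j0 := Ordinal jn.
    rewrite ler_pdivlMr// in j1; rewrite ltr_pdivrMr// in j2.
    have -> : S u s = Z u (j0%:R * w).
      rewrite /S (bigD1 j0)//= big1 ?addr0; first by rewrite /chi j1 j2 mulr1.
      move=> j jj; rewrite /chi; case: ifP; rewrite ?mulr0// => /andP[h1 h2].
      exfalso; move/eqP: jj; apply; apply/val_inj => /=.
      have k1 : j%:R < (Num.truncn (s / w)).+1%:R :> R by rewrite -(ltr_pM2r w0) (le_lt_trans h1).
      have k2 : (Num.truncn (s / w))%:R < j.+1%:R :> R by rewrite -(ltr_pM2r w0) (le_lt_trans j1).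
      rewrite ltr_nat ltnS in k1; rewrite ltr_nat ltnS in k2.
      by apply/eqP; rewrite eqn_leq k1 k2.
    have j1' : 0 <= j0%:R * w by rewrite mulr_ge0 ?(ltW w0).
    apply: dP => //; first by case/andP: sL => -> /ltW.
      by rewrite j1' /= (le_trans j1)//; case/andP: sL => _ /ltW.
    rewrite ger0_norm ?subr_ge0// ltrBlDr (lt_le_trans j2)//.
    by rewrite -natr1 mulrDl mul1r addrC lerD2r ltW.
  have h s : `|ic s * (Z u s - S u s)| <= (1 + `|b^-1|) * (e * m).
    by rewrite normrM ler_pM// ic_bound.
  apply: le_trans (RP_bound h t) _.
  rewrite !mulrA -[m / 2]mulrC ler_wpM2r//.
  rewrite /e invfM mulrCA ler_piMr ?invr_ge0//.
  rewrite ler_pdivrMr; last by rewrite ltr_wpDl// mulr_ge0// rbd_ge0.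
  by rewrite mul1r lerDl.
- by move=> j; exact/RP_bs/bs_ic.
- split=> // [u m j bu um|u t].
    have m0 : 0 <= m by exact: le_trans (um 0).
    rewrite /l (le_trans (Zz u _ (bs_intg bu)))// -mulrA ler_wpM2l//.
    have [mu1 _ u0] := bu.
    have : `|rint (fun t => `|u t|)| <= m * (L - 0).
      apply: rint_compact => //.
      - exact: measurableT_comp.
      - by move=> t; rewrite normr_id.
      - by move=> t /u0 ->; rewrite normr0.
    by rewrite subr0 mulrC; apply: le_trans; exact: ler_norm.
  rewrite /frk /E /phi.
  have -> : \sum_j l u j * RP (fun t0 => ic t0 * chi j t0) t = RP (fun t => ic t * S u t) t.
    have -> : (fun t => ic t * S u t) = fun t => \sum_j l u j * (ic t * chi j t).
      by apply/funext => s; rewrite mulr_sumr; apply: eq_bigr => j _; ring.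
    have linRP : lin L RP by split=> *; [exact: RPD|exact: RPZ].
    by rewrite (lin_sum linRP)// => j; exact: bs_ic.
  rewrite -RPD; congr (RP _ t); apply/funext => s; ring.
Qed.

Lemma That0_RP u : supp L u -> (forall t, That u t = 0) <->
  (forall t, u t = RP (fun t => ic t * Z u t) t).
Proof.
move=> u0; split=> [h|h t].
  have := @RP_uniq u (fun t => ic t * Z u t) u0.
  by move=> <- // t; exact/That0E.
apply/That0E; rewrite {1}h RP_sol; last by move=> s hs; rewrite (Z_supp u0 hs) mulr0.
by have <- : u = RP (fun t => ic t * Z u t) by exact/funext.
Qed.

Lemma Z_sup_L2supp : exists2 z, 0 <= z & forall u t, L2supp L u -> `|Z u t| <= z * Num.sqrt (sqnorm u).
Proof.
have [z z0 Zz] := Z_bound.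
exists (z * Num.sqrt L) => [|u t su]; first by rewrite mulr_ge0// sqrtr_ge0.
rewrite (le_trans (Zz u t (L2supp_intg su)))// -mulrA ler_wpM2l// -sqrtrM//.
rewrite -[leLHS]ger0_norm ?rint_ge0// -sqrtr_sqr ler_sqrt ?mulr_ge0 ?sqnorm_ge0//.
exact: norm1_L2supp.
Qed.

Lemma L2supp_Z_bs u : L2supp L u -> bs L (Z u).
Proof. by move=> su; apply: Z_bs; [exact: L2supp_intg su|case: su]. Qed.

Lemma sqb_Z : sqb L Z.
Proof.
have [z z0 Zz] := Z_sup_L2supp.
exists (z ^+ 2 * L) => [|u su]; first by rewrite mulr_ge0 ?sqr_ge0.
have bZ := L2supp_Z_bs su; split; first exact: bs_L2supp.
apply: le_trans (sqnorm_bs L0' bZ (fun t => Zz u t su)) _.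
by rewrite exprMn sqr_sqrtr ?sqnorm_ge0// mulrAC.
Qed.

Lemma sqb_That : sqb L That.
Proof.
rewrite (_ : That = fun u t => (cc t * u t + cc t * (-1 * P u t)) + -1 * Z u t); last first.
  by apply/funext => u; apply/funext => t; rewrite ThatE; ring.
have m1 : forall t : R, `|(-1 : R)| <= 1 by move=> t; rewrite normrN1.
apply: sqbD; last by apply: (@sqbM _ _ (fun=> -1)) => //; exact: sqb_Z.
apply: sqbD; first by apply: (sqbM cc_meas cc_bound); exact: sqb_id.
apply: (sqbM cc_meas cc_bound); apply: (@sqbM _ _ (fun=> -1)) => //; exact: sqb_P.
Qed.

Lemma ThatD u v t : intg u -> intg v -> That (fun t => u t + v t) t = That u t + That v t.
Proof. by move=> Iu Iv; rewrite !ThatE PD ZD//; ring. Qed.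

Lemma ThatZ a u t : intg u -> That (fun t => a * u t) t = a * That u t.
Proof. by move=> Iu; rewrite !ThatE PZ ZZ//; ring. Qed.

Lemma ThatB u v t : intg u -> intg v -> That (fun t => u t - v t) t = That u t - That v t.
Proof.
move=> Iu Iv; have -> : (fun t => u t - v t) = (fun t => u t + -1 * v t).
  by apply/funext => s; rewrite mulN1r.
by rewrite ThatD ?ThatZ ?mulN1r//; exact: intgZ.
Qed.

(** * From a trivial kernel on bounded functions to a bounded inverse on L2 *)

Section Invertible.
Hypothesis ker0 : forall u, bs L u -> (forall t, That u t = 0) -> forall t, u t = 0.

(** The hypothesis [ker0] asks for a bounded [u] with [That u] zero everywhere. Here [u] is the
    bounded function [u'] plus [RP r], of norm zero; [Z] does not see the latter, so [u'] satisfies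
    the kernel equation at every point. *)
Lemma That_inj u : L2supp L u -> sqnorm (That u) = 0 -> sqnorm u = 0.
Proof.
move=> su nT.
have [C C0 hR] := sqb_RP; have [C' C0' hT] := sqb_That.
have u0 : supp L u by case: su.
pose r t := ic t * That u t.
have [sT _] := hT u su.
have [sr nr] : L2supp L r /\ sqnorm r <= (1 + `|b^-1|) ^+ 2 * sqnorm (That u).
  exact: L2suppM ic_meas ic_bound sT.
have nr0 : sqnorm r = 0 by apply/eqP; rewrite eq_le sqnorm_ge0 andbT (le_trans nr)// nT mulr0.
have [sRr nRr] := hR r sr.
have nRr0 : sqnorm (RP r) = 0 by apply/eqP; rewrite eq_le sqnorm_ge0 andbT (le_trans nRr)// nr0 mulr0.
pose u' := RP (fun t => ic t * Z u t).
have uE : u = fun t => u' t + RP r t.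
  rewrite {1}(@RP_uniq u (fun t => ic t * Z u t + r t))//.
    by apply/funext => t; rewrite RPD.
  by move=> t; rewrite /r ThatE /ic; field; exact: cc_neq0.
have bu' : bs L u' by apply/RP_bs/bs_ic/L2supp_Z_bs.
have ZE t : Z u t = Z u' t.
  have [z z0 Zz] := Z_sup_L2supp.
  rewrite {1}uE ZD; [|exact: bs_intg|exact: L2supp_intg sRr].
  have := Zz _ t sRr; rewrite nRr0 sqrtr0 mulr0 normr_le0 => /eqP ->.
  by rewrite addr0.
have u'0 : forall t, u' t = 0.
  apply: ker0 => //; apply/That0_RP; first by case: bu'.
  by move=> t; rewrite {1}/u'; congr (RP _ t); apply/funext => s; rewrite ZE.
by rewrite uE (_ : (fun t => _) = RP r)//; apply/funext => t; rewrite u'0 add0r.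
Qed.

(** The part [x0 = RP (ic * h)] absorbs the square-integrable data. The remainder [w] solves
    [w = k + frk w] with [k = RP (ic * Z x0)] bounded, where the Fredholm alternative applies. *)
Lemma That_surj : exists2 C, 0 <= C & forall h, L2supp L h -> exists u,
  [/\ L2supp L u, forall t, That u t = h t & sqnorm u <= C * sqnorm h].
Proof.
have [E [n [phi [l [Lam [linE bE hE bphi [linl lb frkE]]]]]]] := RPZ_finite_rank.
have [C C0 hC] : exists2 C : R, 0 <= C & forall k, bs L k -> exists u, [/\ bs L u,
    forall t, u t = k t + frk E phi l u t &
    forall m, (forall t, `|k t| <= m) -> forall t, `|u t| <= C * m].
  apply: (fredholm_surj linE bE hE bphi linl lb) => u bu uE.
  apply: ker0 => //; apply/That0_RP; first by case: bu.
  by move=> t; rewrite -frkE -uE.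
have [z z0 Zz] := Z_sup_L2supp; have [Cr Cr0 hR] := sqb_RP.
(* [K1] bounds multiplication by [ic] in squared norm; [K2] bounds the supremum of [w] by the L2
   norm of [x0]. *)
pose K1 := (1 + `|b^-1|) ^+ 2.
pose K2 := C * (rbd * ((1 + `|b^-1|) * z)).
exists (2 * (Cr * K1) + 2 * (K2 ^+ 2 * (Cr * K1) * L)).
  have K10 : 0 <= K1 by rewrite sqr_ge0.
  have h1 : 0 <= Cr * K1 by exact: mulr_ge0.
  apply: addr_ge0; first by apply: mulr_ge0.
  apply: mulr_ge0 => //; apply: mulr_ge0 => //; apply: mulr_ge0 => //; exact: sqr_ge0.
move=> h sh.
have [si ni] := L2suppM ic_meas ic_bound sh.
pose x0 := RP (fun t => ic t * h t).
have [sx nx] : L2supp L x0 /\ sqnorm x0 <= Cr * K1 * sqnorm h.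
  have [s nn] := hR _ si; split => //; apply: le_trans nn _.
  by rewrite -[leRHS]mulrA; apply: ler_wpM2l.
have bZx := L2supp_Z_bs sx.
pose k := RP (fun t => ic t * Z x0 t).
have bk : bs L k by apply/RP_bs/bs_ic.
have km t : `|k t| <= rbd * ((1 + `|b^-1|) * (z * Num.sqrt (sqnorm x0))).
  apply: RP_bound => s; rewrite normrM ler_pM//; first exact: ic_bound.
  exact: Zz.
have [w [bw wE wb]] := hC k bk.
have wm := wb _ km.
have sw := bs_L2supp bw.
have [su nu] := L2suppD sx sw.
exists (fun t => x0 t + w t); split => //.
- move=> t; apply: ThatE_sol.
  have uE : (fun t => x0 t + w t) = RP (fun t => ic t * (h t + Z (fun t => x0 t + w t) t)).
    apply/funext => s; rewrite wE frkE /x0 /k -!RPD.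
    congr (RP _ s); apply/funext => r; rewrite -/x0 ZD; [ring|exact: L2supp_intg sx|exact: bs_intg].
  have sup : supp L (fun t => ic t * (h t + Z (fun t => x0 t + w t) t)).
    move=> s hs; rewrite Z_supp//; last by case: su.
    by have [_ _ ->] := sh; rewrite ?addr0 ?mulr0.
  have /(congr1 (fun F => F t)) /= -> := uE.
  rewrite (RP_sol t sup); congr (_ + _); by rewrite -uE.
- apply: le_trans nu _.
  rewrite [leRHS]mulrDl lerD//; first by rewrite -mulrA ler_wpM2l.
  have := sqnorm_bs L0' bw wm.
  have -> : C * (rbd * ((1 + `|b^-1|) * (z * Num.sqrt (sqnorm x0)))) = K2 * Num.sqrt (sqnorm x0).
    by rewrite /K2; ring.
  rewrite exprMn sqr_sqrtr ?sqnorm_ge0// => hw.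
  rewrite -[leRHS]mulrA ler_wpM2l// (le_trans hw)//.
  rewrite (_ : K2 ^+ 2 * (Cr * K1) * L * sqnorm h = K2 ^+ 2 * (Cr * K1 * sqnorm h) * L); last by ring.
  by rewrite ler_wpM2r// ler_wpM2l// sqr_ge0.
Qed.

(** The solution [v] that [That_surj] provides for the data [That u] comes with an estimate, and
    [u - v] has norm zero by injectivity. *)
Lemma That_bounded_below : exists2 C, 0 <= C & forall u, L2supp L u -> sqnorm u <= C * sqnorm (That u).
Proof.
have [C C0 hC] := That_surj; have [C' C0' hT] := sqb_That.
exists (2 * C) => [|u su]; first exact: mulr_ge0.
have [sT _] := hT u su.
have [v [sv vE vn]] := hC _ sT.
have [sd _] := L2suppB su sv.
have nd : sqnorm (fun t => u t - v t) = 0.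
  apply: That_inj => //; rewrite /sqnorm -[RHS](rint0 R); apply: eq_rint => t.
  by rewrite (ThatB t (L2supp_intg su) (L2supp_intg sv)) vE subrr expr0n.
have [_] := L2suppD sd sv.
rewrite (_ : (fun t => u t - v t + v t) = u); last by apply/funext => t; rewrite subrK.
by rewrite nd mulr0 add0r -mulrA => h; apply: le_trans h _; rewrite ler_wpM2l.
Qed.

End Invertible.
(** * Triviality of the kernel *)

Section Kernel.
Local Notation H := (Hv L).

(** [F1] and [F0] with the exponential replaced by a test function; [cexp_re] and [cexp_im] give
    back their real and imaginary parts. *)
Definition pairF1 (phi : R -> R) := b * phi D + rint (fun t => M t * phi t).
Definition pairF0 (phi : R -> R) :=
  phi 0 - a2 * phi tau2 - a3 * phi tau3 - a23 * phi t23 - rint (fun t => N t * phi t).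

Hypothesis rank : forall x y, ~ [/\ pairF1 (cexp_re x y) = 0, pairF1 (cexp_im x y) = 0,
  pairF0 (cexp_re x y) = 0 & pairF0 (cexp_im x y) = 0].

Let m1 := b + rint M.
Let m0 := 1 - a2 - a3 - a23 - rint N.

(** The rank condition at [s = 0], where [cexp_re] is constantly [1] and [cexp_im] constantly
    [0]. *)
Let m01 : m1 != 0 \/ m0 != 0.
Proof.
have [m10|] := eqVneq m1 0; last by left.
right; apply/eqP => m00; apply: (rank (x := 0) (y := 0)).
have e1 : cexp_re 0 0 = fun=> 1 :> R.
  by apply/funext => t; rewrite /cexp_re !mulr0 oppr0 expR0 cos0 mulr1.
have e2 : cexp_im 0 0 = fun=> 0 :> R.
  by apply/funext => t; rewrite /cexp_im !mulr0 sin0 mulr0 oppr0.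
have z u : rint (fun t => u t * 0) = 0.
  by rewrite -[RHS](rint0 R); apply: eq_rint => t; rewrite mulr0.
have o u : rint (fun t => u t * 1) = rint u by apply: eq_rint => t; rewrite mulr1.
by rewrite /pairF1 /pairF0 e1 e2 !z !o !mulr1 !mulr0 !subr0 addr0.
Qed.

Let cbH : cb H := cbH L0.
Let tau2_itv : 0 <= tau2 <= L. Proof. slra. Qed.
Let tau3_itv : 0 <= tau3 <= L. Proof. slra. Qed.
Let t23_itv : 0 <= t23 <= L. Proof. slra. Qed.
Let D_itv : 0 <= D <= L. Proof. slra. Qed.
Let tau2_ge0 : 0 <= tau2. Proof. by case/andP: tau2_itv. Qed.
Let tau3_ge0 : 0 <= tau3. Proof. by case/andP: tau3_itv. Qed.
Let t23_ge0 : 0 <= t23. Proof. by case/andP: t23_itv. Qed.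
Let D_ge0 : 0 <= D. Proof. exact: ltW. Qed.
Let t23_L : t23 <= L. Proof. by case/andP: t23_itv. Qed.
Let D_L : D <= L. Proof. by case/andP: D_itv. Qed.

(* [m1] and [m0] are the values of [F1] and [F0] at [s = 0].  For the transforms [G], [F] of [gpart u],
   [fpart u], the functions [gt u], [ft u] have transforms [(G - qq u * F1) / s], [(F + qq u * F0) / s]
   up to truncation at [L]; the choice of [qq u] makes the numerators vanish at [s = 0]. *)
Definition qq u := if m1 == 0 then - rint (fpart u) / m0 else rint (gpart u) / m1.
Definition gt u t := conv (gpart u) H t - qq u * (b * H (t - D) + conv M H t).
Definition ft u t := conv (fpart u) H t + qq u * (H t - At H t - conv N H t).
Definition divop u t := if t < D then gt u t else if t < L then ft u (t - D) else 0.

Lemma cb_At u : cb u -> cb (At u).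
Proof.
by move=> cu; apply: cbD; [apply: cbD|]; apply: cbZ; exact: cb_shift.
Qed.

Lemma conv_At u v t : cb u -> cb v -> conv (At u) v t = At (conv u v) t.
Proof.
move=> cu cv; rewrite /At.
have cs d : 0 <= d -> intg (fun t => u (t - d)) by move=> d0; apply/cb_intg/cb_shift.
have k1 : intg (fun t => u (t - tau2)) by exact: cs.
have k2 : intg (fun t => u (t - tau3)) by exact: cs.
have k3 : intg (fun t => u (t - t23)) by exact: cs.
have mu' := cb_meas cu; have mv := cb_meas cv.
rewrite convDl//; [|by apply: intgD; exact: intgZ|exact: intgZ].
rewrite convDl//; [|exact: intgZ|exact: intgZ].
by rewrite !convZl// !conv_shiftl.
Qed.

Lemma rint_At u : cb u -> rint (At u) = (a2 + a3 + a23) * rint u.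
Proof.
move=> cu; have Iu := cb_intg cu; have mu' := cb_meas cu.
have cs d : intg (fun t => u (t - d)) by exact: (intg_shift (- d) Iu).
rewrite /At rintD; [|by apply: intgD; exact: intgZ|exact: intgZ].
rewrite rintD; [|exact: intgZ|exact: intgZ].
rewrite !rintZ// (rint_shift (- tau2))// (rint_shift (- tau3))// (rint_shift (- t23))//.
ring.
Qed.

Lemma cb_gt u : bs L u -> cb (gt u).
Proof.
move=> bu; have cg := bs_cb (ltW D0) (gpart_bs bu).
apply: cbB; first exact: cb_conv.
apply: cbZ; apply: cbD; last exact: cb_conv.
by apply: cbZ; exact: cb_shift.
Qed.

Lemma cb_ft u : bs L u -> cb (ft u).
Proof.
move=> bu; have cf := bs_cb t23_ge0 (fpart_bs bu).
apply: cbD; first exact: cb_conv.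
by apply: cbZ; apply: cbB; [apply: cbB => //; exact: cb_At|exact: cb_conv].
Qed.

(** In transforms: [F0 (G - q F1) / s + F1 (F + q F0) / s = (F0 G + F1 F) / s]. The terms in [q]
    cancel by commutativity and associativity of convolution, for every [u] in [bs]. *)
Lemma TT_prim u t : bs L u -> TT (gt u) (ft u) t = conv (That u) H t.
Proof.
move=> bu.
have cg := bs_cb (ltW D0) (gpart_bs bu); have cf := bs_cb t23_ge0 (fpart_bs bu).
set G := gpart u in cg *; set F := fpart u in cf *; set q := qq u.
have cGH := cb_conv cg cbH; have cFH := cb_conv cf cbH.
have cMH := cb_conv cbM cbH; have cNH := cb_conv cbN cbH.
have cHD : cb (fun t => H (t - D)) by exact: cb_shift.
have cAH := cb_At cbH.
have E1 s : conv (ft u) M s = conv (conv F H) M s +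
    q * (conv H M s - At (conv H M) s - conv (conv N H) M s).
  rewrite /ft -/F -/q convDl ?convZl ?convBl ?conv_At//; try exact: cb_intg.
  - by apply: cb_intg; exact: cbB.
  - by apply: cb_intg; apply: cbB => //; exact: cbB.
  - by apply: cb_intg; apply: cbZ; apply: cbB => //; exact: cbB.
have E2 s : conv (gt u) N s = conv (conv G H) N s -
    q * (b * conv H N (s - D) + conv (conv M H) N s).
  rewrite /gt -/G -/q convBl ?convZl ?convDl ?convZl ?conv_shiftl//; try exact: cb_intg; try exact: cb_meas.
  - by apply: cb_intg; exact: cbZ.
  - by apply: cb_intg; apply: cbD => //; exact: cbZ.
  - by apply: cb_intg; apply: cbZ; apply: cbD => //; exact: cbZ.
have cFD : cb (fun t => F (t - D)) by exact: cb_shift.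
have E3 : conv (That u) H t = conv G H t - At (conv G H) t + b * conv F H (t - D)
    + conv (conv F M) H t - conv (conv G N) H t.
  have cA := cb_At cg; have cFM := cb_conv cf cbM; have cGN := cb_conv cg cbN.
  have c1 : cb (fun t => G t - At G t) by exact: cbB.
  have c2 : cb (fun t => b * F (t - D)) by exact: cbZ.
  have c3 : cb (fun t => G t - At G t + b * F (t - D)) by exact: cbD.
  have c4 : cb (fun t => G t - At G t + b * F (t - D) + conv F M t) by exact: cbD.
  rewrite /That /TT -/G -/F (convBl _ (cb_intg c4) (cb_intg cGN) cbH) (convDl _ (cb_intg c3) (cb_intg cFM) cbH).
  rewrite (convDl _ (cb_intg c1) (cb_intg c2) cbH) (convBl _ (cb_intg cg) (cb_intg cA) cbH).
  by rewrite (convZl _ _ (cb_intg cFD) cbH) conv_At// (conv_shiftl _ _ (cb_meas cf) (cb_meas cbH)).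
have MH : conv M H = conv H M by exact: convC (cb_meas cbM) (cb_meas cbH).
have NH : conv N H = conv H N by exact: convC (cb_meas cbN) (cb_meas cbH).
have A1 : conv (conv F M) H = conv (conv F H) M.
  by rewrite (convA cf cbM cbH) MH (convA cf cbH cbM).
have A2 : conv (conv G N) H = conv (conv G H) N.
  by rewrite (convA cg cbN cbH) NH (convA cg cbH cbN).
have A3 : conv (conv M H) N = conv (conv N H) M.
  by rewrite (convA cbM cbH cbN) NH (convC (cb_meas cbM) (cb_meas (cb_conv cbH cbN))).
rewrite E3 A1 A2 /TT E1 E2 A3 /gt /ft -/G -/F -/q /At MH NH.
have sh d : H (t - d - D) = H (t - D - d) by congr (Hv L _); ring.
rewrite !sh; ring.
Qed.

(** The value of [F0 G + F1 F] at [s = 0], obtained by integrating over the line. *)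
Lemma rint_That u : bs L u -> rint (That u) = rint (gpart u) * m0 + rint (fpart u) * m1.
Proof.
move=> bu.
have cg := bs_cb (ltW D0) (gpart_bs bu); have cf := bs_cb t23_ge0 (fpart_bs bu).
set G := gpart u in cg *; set F := fpart u in cf *.
have cA := cb_At cg; have cFM := cb_conv cf cbM; have cGN := cb_conv cg cbN.
have cFD : cb (fun t => F (t - D)) by exact: cb_shift.
have c1 : cb (fun t => G t - At G t) by exact: cbB.
have c2 : cb (fun t => b * F (t - D)) by exact: cbZ.
have c3 : cb (fun t => G t - At G t + b * F (t - D)) by exact: cbD.
have c4 : cb (fun t => G t - At G t + b * F (t - D) + conv F M t) by exact: cbD.
rewrite /That /TT -/G -/F (rintB (cb_intg c4) (cb_intg cGN)) (rintD (cb_intg c3) (cb_intg cFM)).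
rewrite (rintD (cb_intg c1) (cb_intg c2)) (rintB (cb_intg cg) (cb_intg cA)) (rintZ _ (cb_intg cFD)).
rewrite !rint_conv// rint_At// (rint_shift (- D)); last exact: cb_meas.
rewrite /m0 /m1; ring.
Qed.

Section InKernel.
Variable u : R -> R.
Hypotheses (bu : bs L u) (u0 : forall t, That u t = 0).

(** By [rint_That] the two masses are orthogonal to [(m0, m1)], hence a multiple of [(m1, - m0)];
    the factor is [qq u], read off from whichever coordinate is nonzero. *)
Lemma ker_mass : rint (gpart u) = qq u * m1 /\ rint (fpart u) = - (qq u * m0).
Proof.
have := rint_That bu.
rewrite (eq_rint u0) rint0 => e.
have {}e : rint (gpart u) * m0 = - (rint (fpart u) * m1) by apply/eqP; rewrite -addr_eq0 -e.
rewrite /qq; have [m10|m1n] := eqVneq m1 0.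
  have m0n : m0 != 0 by case: m01 => //; rewrite m10 eqxx.
  rewrite m10 mulr0 divfK// opprK; split => //.
  by move: e; rewrite m10 mulr0 oppr0 => /eqP; rewrite mulf_eq0 (negbTE m0n) orbF => /eqP.
rewrite divfK//; split => //.
apply: (mulIf m1n); rewrite mulNr mulrAC divfK//.
by rewrite -[LHS]opprK -e.
Qed.

(** On [[D, L)] all supports are exhausted and [gt u] equals [rint (gpart u) - qq u * m1], which is
    zero: the cut at [D] in [divop] loses nothing. *)
Lemma gtE s : s < L -> gpart (divop u) s = gt u s.
Proof.
move=> sL; rewrite /gpart /divop; have [sD|sD] := ltP s D; first by [].
have [_ _ g0] := gpart_bs bu; have [_ _ M0] := bsM.
rewrite /gt (conv_H_total g0 sD sL) (conv_H_total M0 sD sL).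
rewrite Hv1; last by move: D0; lra.
by rewrite mulr1 -/m1 ker_mass.1 subrr.
Qed.

(** From [tau2 + tau3] on, all delays have acted and [ft u] is the constant
    [rint (fpart u) + qq u * m0], again zero. *)
Lemma ftE s : s < L -> fpart (divop u) s = ft u s.
Proof.
have cf := bs_cb t23_ge0 (fpart_bs bu).
have At_neg x : x < 0 -> At H x = 0.
  by move=> x0; rewrite /At !Hv_neg ?mulr0 ?addr0//; slra.
move=> sL; rewrite /fpart; have [s0|s0] := leP 0 s; last first.
  by rewrite /ft (conv_H_neg L0)// (conv_H_neg L0)// Hv_neg// At_neg//; ring.
rewrite /divop ltNge lerDr s0 /= addrK.
case: ifP => // st.
have st' : t23 <= s by move: st; rewrite addrC ltrD2l => /negbT; rewrite -leNgt.
have [_ _ f0] := fpart_bs bu; have [_ _ N0] := bsN.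
rewrite /ft (conv_H_total f0 st' sL) (conv_H_total N0 st' sL) /At.
have H1 x : 0 <= x <= t23 -> H (s - x) = 1 by move=> hx; apply: Hv1; lra.
rewrite -[s in H s]subr0 !H1; try slra.
rewrite ker_mass.2 /m0; ring.
Qed.

(** From [L] on everything vanishes by support. Below [L], causality allows [gt u] and [ft u] in
    place of their truncations, and [TT_prim] leaves the primitive of [That u], which is zero. *)
Lemma divop_ker t : That (divop u) t = 0.
Proof.
have Bs : supp L (divop u).
  move=> s hs; rewrite /divop; case: ifP => sD.
    have s0 : s < 0 by slra.
    by apply: (cb_neg _ s0); exact: cb_gt.
  by case: ifP => // sL; exfalso; move/negP: hs; apply; move/negbT: sD; rewrite -leNgt => sD; apply/andP; split => //; slra.
have [tL|tL] := ltP t L; last first.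
  have hs : ~~ (0 <= t < L) by rewrite (ltNge t) tL andbF.
  by rewrite ThatE Bs// P_supp// Z_supp//; ring.
have N0 s : s < 0 -> N s = 0 by exact: cb_neg.
have M0 s : s < 0 -> M s = 0 by exact: cb_neg.
transitivity (TT (gt u) (ft u) t).
  rewrite /That /TT (conv_causal (u := fpart (divop u)) (u' := ft u) (A := L))//; last exact: ftE.
  rewrite (conv_causal (u := gpart (divop u)) (u' := gt u) (A := L))//; last exact: gtE.
  by rewrite /At !gtE ?ftE//; slra.
rewrite TT_prim// -[RHS](rint0 R); apply: eq_rint => s.
by rewrite u0 mul0r.
Qed.

(** For [phi = e^{-s t}] this says that [s] times the transform of [gt u] is [G - q F1]. The
    boundary terms in [phi L] cancel because [ker_mass] makes the total mass zero. *)
Lemma test_g phi psi : (forall x : R, is_derive x 1 phi (- psi x)) -> continuous psi ->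
  cb (cut L phi) -> cb (cut L psi) ->
  rint (fun t => cut L psi t * gt u t) = rint (fun t => gpart u t * phi t) - qq u * pairF1 phi.
Proof.
move=> dphi cpsi cp cs.
have cg := bs_cb (ltW D0) (gpart_bs bu).
have [_ _ g0] := gpart_bs bu; have [_ _ M0] := bsM.
have e1 := test_prim L0 dphi cpsi cp cs cg D_L g0.
have e2 := test_prim L0 dphi cpsi cp cs cbM D_L M0.
have e3 : rint (fun t => cut L psi t * H (t - D)) = phi D - phi L.
  exact: test_tail.
have [p p0 pp] := cb_bound cs.
have Ic v : cb v -> intg (fun t => cut L psi t * v t).
  move=> cv; have [n n0 vn] := cb_bound cv.
  by apply: (intg_mul (cb_intg cs) (cb_meas cv) vn).
have cHD : cb (fun t => H (t - D)) by exact: cb_shift.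
rewrite (_ : (fun t => _) = fun t => cut L psi t * conv (gpart u) H t -
   qq u * (b * (cut L psi t * H (t - D)) + cut L psi t * conv M H t)); last first.
  by apply/funext => t; rewrite /gt; ring.
have i1 := Ic _ (cb_conv cg cbH); have i2 := Ic _ cHD; have i3 := Ic _ (cb_conv cbM cbH).
rewrite rintB//; last by apply/intgZ/intgD => //; exact: intgZ.
rewrite rintZ; last by apply: intgD => //; exact: intgZ.
rewrite rintD//; last exact: intgZ.
rewrite rintZ// e1 e2 e3 ker_mass.1 /pairF1 /m1; ring.
Qed.

Lemma test_f phi psi : (forall x : R, is_derive x 1 phi (- psi x)) -> continuous psi ->
  cb (cut L phi) -> cb (cut L psi) ->
  rint (fun t => cut L psi t * ft u t) = rint (fun t => fpart u t * phi t) + qq u * pairF0 phi.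
Proof.
move=> dphi cpsi cp cs.
have cf := bs_cb t23_ge0 (fpart_bs bu).
have [_ _ f0] := fpart_bs bu; have [_ _ N0] := bsN.
have e1 := test_prim L0 dphi cpsi cp cs cf t23_L f0.
have e2 := test_prim L0 dphi cpsi cp cs cbN t23_L N0.
have e3 x : 0 <= x <= L -> rint (fun t => cut L psi t * H (t - x)) = phi x - phi L.
  by move=> hx; apply: test_tail.
have Ic v : cb v -> intg (fun t => cut L psi t * v t).
  move=> cv; have [n n0 vn] := cb_bound cv.
  by apply: (intg_mul (cb_intg cs) (cb_meas cv) vn).
have cHd d : 0 <= d -> cb (fun t => H (t - d)) by move=> d0; apply: cb_shift.
rewrite (_ : (fun t => _) = fun t => cut L psi t * conv (fpart u) H t +
   qq u * (cut L psi t * H (t - 0) - (a2 * (cut L psi t * H (t - tau2)) +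
     a3 * (cut L psi t * H (t - tau3)) + a23 * (cut L psi t * H (t - t23)))
     - cut L psi t * conv N H t)); last first.
  by apply/funext => t; rewrite /ft /At subr0; ring.
have i0 := Ic _ (cb_conv cf cbH).
have i1 := Ic _ (cHd 0 (lexx 0)).
have i2 : intg (fun t => cut L psi t * H (t - tau2)) by exact/Ic/cHd.
have i3 : intg (fun t => cut L psi t * H (t - tau3)) by exact/Ic/cHd.
have i4 : intg (fun t => cut L psi t * H (t - t23)) by exact/Ic/cHd.
have i5 := Ic _ (cb_conv cbN cbH).
have j2 := intgZ a2 i2; have j3 := intgZ a3 i3; have j4 := intgZ a23 i4.
have j23 := intgD j2 j3; have j234 := intgD j23 j4; have k1 := intgB i1 j234; have k2 := intgB k1 i5.
rewrite rintD//; last exact: intgZ.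
rewrite (rintZ _ k2) (rintB k1 i5) (rintB i1 j234) (rintD j23 j4) (rintD j2 j3) !rintZ//.
rewrite e1 e2 !e3//; last by rewrite lexx (ltW L0).
rewrite ker_mass.2 /pairF0 /m0; ring.
Qed.

End InKernel.

(** The branch taken in [qq] depends on [m1] alone and not on the function, whence linearity. *)
Lemma qqD u v : bs L u -> bs L v -> qq (fun t => u t + v t) = qq u + qq v.
Proof.
move=> bu bv; have Iu := bs_intg bu; have Iv := bs_intg bv.
rewrite /qq; case: ifP => _.
  by rewrite fpartD (rintD (fpart_intg Iu) (fpart_intg Iv)) -mulrDl opprD.
by rewrite gpartD (rintD (gpart_intg Iu) (gpart_intg Iv)) -mulrDl.
Qed.

Lemma qqZ a u : bs L u -> qq (fun t => a * u t) = a * qq u.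
Proof.
move=> bu; have Iu := bs_intg bu; rewrite /qq; case: ifP => _.
  by rewrite fpartZ (rintZ _ (fpart_intg Iu)) -mulrN mulrA.
by rewrite gpartZ (rintZ _ (gpart_intg Iu)) mulrA.
Qed.

Lemma lin_divop : lin L divop.
Proof.
split=> [u v t bu bv|a u t bu].
  have Iu := bs_intg bu; have Iv := bs_intg bv.
  rewrite /divop; case: ifP => _.
    rewrite /gt qqD// gpartD (convDl _ (gpart_intg Iu) (gpart_intg Iv) cbH); ring.
  case: ifP => _; last by rewrite addr0.
  rewrite /ft qqD// fpartD (convDl _ (fpart_intg Iu) (fpart_intg Iv) cbH); ring.
have Iu := bs_intg bu.
rewrite /divop; case: ifP => _.
  rewrite /gt qqZ// gpartZ (convZl _ _ (gpart_intg Iu) cbH); ring.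
case: ifP => _; last by rewrite mulr0.
rewrite /ft qqZ// fpartZ (convZl _ _ (fpart_intg Iu) cbH); ring.
Qed.

Lemma bs_divop u : bs L u -> bs L (divop u).
Proof.
move=> bu; have cg := cb_gt bu; have cf := cb_ft bu.
have [m m_ge0 gm] := cb_bound cg; have [n n_ge0 fn] := cb_bound cf.
split.
- apply: measurable_fun_ifT; [exact: meas_lt|exact: cb_meas|].
  apply: measurable_fun_ifT => //; first exact: meas_lt.
  by apply: meas_shift; exact: cb_meas.
- exists (m + n) => t; rewrite /divop; case: ifP => _.
    by rewrite (le_trans (gm t))// lerDl.
  by case: ifP => _; rewrite ?normr0 ?addr_ge0// (le_trans (fn _))// lerDr.
- move=> s hs; rewrite /divop; case: ifP => sD.
    have s0 : s < 0 by slra.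
    exact: (cb_neg cg s0).
  case: ifP => // sL; exfalso; move/negP: hs; apply.
  by move/negbT: sD; rewrite -leNgt => sD; apply/andP; split => //; slra.
Qed.

(* With [lam = al + i be], [s = x + i y], [C = (c1 + i d1) + i (c2 + i d2)], [q = q1 + i q2] and
   [m = mc + i md], the hypotheses give [lam s = 1] and [lam s C = C - q m], so [q m = 0]. *)
Lemma eigen_algebra (al be x y c1 d1 c2 d2 q1 q2 mc md : R) :
  al * x - be * y = 1 -> al * y + be * x = 0 ->
  al * (x * c1 - y * d1) - be * (x * c2 - y * d2) = c1 - q1 * mc ->
  al * (x * d1 + y * c1) - be * (x * d2 + y * c2) = d1 - q1 * md ->
  al * (x * c2 - y * d2) + be * (x * c1 - y * d1) = c2 - q2 * mc ->
  al * (x * d2 + y * c2) + be * (x * d1 + y * c1) = d2 - q2 * md ->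
  q1 ^+ 2 + q2 ^+ 2 != 0 -> mc = 0 /\ md = 0.
Proof.
move=> h1 h2 e1 e2 e3 e4 qn.
have k1 : q1 * mc = q2 * md.
  have : q1 * mc - q2 * md = (c1 - (al * (x * c1 - y * d1) - be * (x * c2 - y * d2)))
      - (d2 - (al * (x * d2 + y * c2) + be * (x * d1 + y * c1))).
    by rewrite e1 e4; ring.
  have -> : (c1 - (al * (x * c1 - y * d1) - be * (x * c2 - y * d2)))
      - (d2 - (al * (x * d2 + y * c2) + be * (x * d1 + y * c1))) =
     (1 - (al * x - be * y)) * (c1 - d2) + (al * y + be * x) * (d1 + c2) by ring.
  by rewrite h1 h2 subrr !mul0r addr0 => /eqP; rewrite subr_eq0 => /eqP.
have k2 : q1 * md = - (q2 * mc).
  have : q1 * md + q2 * mc =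
      (d1 - (al * (x * d1 + y * c1) - be * (x * d2 + y * c2)))
      + (c2 - (al * (x * c2 - y * d2) + be * (x * c1 - y * d1))).
    by rewrite e2 e3; ring.
  have -> : (d1 - (al * (x * d1 + y * c1) - be * (x * d2 + y * c2)))
      + (c2 - (al * (x * c2 - y * d2) + be * (x * c1 - y * d1))) =
     (1 - (al * x - be * y)) * (d1 + c2) - (al * y + be * x) * (c1 - d2) by ring.
  by rewrite h1 h2 subrr !mul0r subr0 => /eqP; rewrite addr_eq0 => /eqP.
have z1 : (q1 ^+ 2 + q2 ^+ 2) * mc = 0.
  have -> : (q1 ^+ 2 + q2 ^+ 2) * mc = q1 * (q1 * mc) + q2 * (q2 * mc) by ring.
  by rewrite k1 -[q2 * mc]opprK -k2; ring.
have z2 : (q1 ^+ 2 + q2 ^+ 2) * md = 0.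
  have -> : (q1 ^+ 2 + q2 ^+ 2) * md = q1 * (q1 * md) + q2 * (q2 * md) by ring.
  by rewrite k2 -k1; ring.
by split; [move/eqP: z1|move/eqP: z2]; rewrite mulf_eq0 (negbTE qn) /= => /eqP.
Qed.

Lemma pair_intg w (phi : R -> R) A : cb w -> A <= L -> (forall t, ~~ (0 <= t < A) -> w t = 0) ->
  continuous phi -> intg (fun t => w t * phi t).
Proof.
move=> cw AL w0 cphi; have cc' := cb_cut L0 cphi; have [n n0 pn] := cb_bound cc'.
have := intg_mul (cb_intg cw) (cb_meas cc') pn.
congr intg; apply/funext => t; rewrite /cut; case: ifPn => // h.
by rewrite w0 ?mul0r//; apply: contra h => /andP[-> h]; exact: lt_le_trans AL.
Qed.

Lemma pair_eq (al be : R) w w1 w2 (psi : R -> R) A : A <= L ->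
  cb w1 -> cb w2 -> (forall t, ~~ (0 <= t < A) -> w1 t = 0) ->
  (forall t, ~~ (0 <= t < A) -> w2 t = 0) -> continuous psi ->
  (forall t, t < L -> w t = al * w1 t + be * w2 t) ->
  rint (fun t => cut L psi t * w t) =
  al * rint (fun t => w1 t * psi t) + be * rint (fun t => w2 t * psi t).
Proof.
move=> AL c1 c2 w10 w20 cpsi wE.
have i1 := pair_intg c1 AL w10 cpsi; have i2 := pair_intg c2 AL w20 cpsi.
rewrite -!rintZ// -rintD; [|exact: intgZ|exact: intgZ].
apply: eq_rint => t; rewrite /cut; case: ifPn => h.
  by rewrite wE; [ring|case/andP: h].
have hA : ~~ (0 <= t < A) by apply: contra h => /andP[-> h]; exact: lt_le_trans AL.
by rewrite w10// w20// !mul0r !mulr0 addr0.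
Qed.

Lemma pair_exp w A x y : cb w -> A <= L -> (forall t, ~~ (0 <= t < A) -> w t = 0) ->
  rint (fun t => w t * (x * cexp_re x y t - y * cexp_im x y t)) =
    x * rint (fun t => w t * cexp_re x y t) - y * rint (fun t => w t * cexp_im x y t) /\
  rint (fun t => w t * (x * cexp_im x y t + y * cexp_re x y t)) =
    x * rint (fun t => w t * cexp_im x y t) + y * rint (fun t => w t * cexp_re x y t).
Proof.
move=> cw AL w0.
have i1 := pair_intg cw AL w0 (@cexp_re_cont _ x y); have i2 := pair_intg cw AL w0 (@cexp_im_cont _ x y).
rewrite -!rintZ// -rintB; [|exact: intgZ|exact: intgZ].
rewrite -rintD; [|exact: intgZ|exact: intgZ].
by split; apply: eq_rint => t; ring.
Qed.

(** * Real and imaginary parts of an eigenvector of [divop] in the kernel *)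

Section EigenPair.
Variables (al be : R) (u1 u2 : R -> R).
Hypotheses (bu1 : bs L u1) (bu2 : bs L u2).
Hypotheses (k1 : forall t, That u1 t = 0) (k2 : forall t, That u2 t = 0).
Hypothesis B1 : forall t, divop u1 t = al * u1 t - be * u2 t.
Hypothesis B2 : forall t, divop u2 t = al * u2 t + be * u1 t.

Let gt1 t : t < L -> gt u1 t = al * gpart u1 t + - be * gpart u2 t.
Proof.
move=> tL; rewrite -gtE// /gpart B1; case: ifP => _; ring.
Qed.
Let gt2 t : t < L -> gt u2 t = al * gpart u2 t + be * gpart u1 t.
Proof.
move=> tL; rewrite -gtE// /gpart B2; case: ifP => _; ring.
Qed.
Let ft1 t : t < L -> ft u1 t = al * fpart u1 t + - be * fpart u2 t.
Proof.
move=> tL; rewrite -ftE// /fpart B1; case: ifP => _; ring.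
Qed.
Let ft2 t : t < L -> ft u2 t = al * fpart u2 t + be * fpart u1 t.
Proof.
move=> tL; rewrite -ftE// /fpart B2; case: ifP => _; ring.
Qed.

Let cg1 := bs_cb D_ge0 (gpart_bs bu1).
Let cg2 := bs_cb D_ge0 (gpart_bs bu2).
Let cf1 := bs_cb t23_ge0 (fpart_bs bu1).
Let cf2 := bs_cb t23_ge0 (fpart_bs bu2).
Let g10 : forall t, ~~ (0 <= t < D) -> gpart u1 t = 0. Proof. by case: (gpart_bs bu1). Qed.
Let g20 : forall t, ~~ (0 <= t < D) -> gpart u2 t = 0. Proof. by case: (gpart_bs bu2). Qed.
Let f10 : forall t, ~~ (0 <= t < t23) -> fpart u1 t = 0. Proof. by case: (fpart_bs bu1). Qed.
Let f20 : forall t, ~~ (0 <= t < t23) -> fpart u2 t = 0. Proof. by case: (fpart_bs bu2). Qed.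

(** * The case of a nonzero eigenvalue [al + i be], with inverse [x + i y] *)

Section Nonzero.
Variables x y : R.
Hypotheses (h1 : al * x - be * y = 1) (h2 : al * y + be * x = 0).

Let psc t := x * cexp_re x y t - y * cexp_im x y t.
Let psd t := x * cexp_im x y t + y * cexp_re x y t.
Let cpsc : continuous psc.
Proof.
by move=> t; apply: cvgB; apply: cvgM; [exact: cvg_cst|exact: cexp_re_cont|exact: cvg_cst|exact: cexp_im_cont].
Qed.
Let cpsd : continuous psd.
Proof.
by move=> t; apply: cvgD; apply: cvgM; [exact: cvg_cst|exact: cexp_im_cont|exact: cvg_cst|exact: cexp_re_cont].
Qed.
Let cc1 := cb_cut L0 (@cexp_re_cont _ x y).
Let cc2 := cb_cut L0 (@cexp_im_cont _ x y).
Let cc3 := cb_cut L0 cpsc.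
Let cc4 := cb_cut L0 cpsd.

Lemma eigen_q0 : qq u1 = 0 /\ qq u2 = 0.
Proof.
have [//|qn] := pselect (qq u1 = 0 /\ qq u2 = 0); exfalso.
have {}qn : qq u1 ^+ 2 + qq u2 ^+ 2 != 0.
  apply/eqP => e; apply: qn; move/eqP: e.
  by rewrite paddr_eq0 ?sqr_ge0// !sqrf_eq0 => /andP[/eqP -> /eqP ->].
have [xg1 yg1] := pair_exp x y cg1 D_L g10; have [xg2 yg2] := pair_exp x y cg2 D_L g20.
have [xf1 yf1] := pair_exp x y cf1 t23_L f10; have [xf2 yf2] := pair_exp x y cf2 t23_L f20.
have [mc md] : pairF1 (cexp_re x y) = 0 /\ pairF1 (cexp_im x y) = 0.
  have e1 := test_g bu1 k1 (is_derive_cexp_re x y) cpsc cc1 cc3.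
  have e2 := test_g bu1 k1 (is_derive_cexp_im x y) cpsd cc2 cc4.
  have e3 := test_g bu2 k2 (is_derive_cexp_re x y) cpsc cc1 cc3.
  have e4 := test_g bu2 k2 (is_derive_cexp_im x y) cpsd cc2 cc4.
  rewrite (pair_eq D_L cg1 cg2 g10 g20 cpsc gt1) mulNr xg1 xg2 in e1.
  rewrite (pair_eq D_L cg1 cg2 g10 g20 cpsd gt1) mulNr yg1 yg2 in e2.
  rewrite (pair_eq D_L cg2 cg1 g20 g10 cpsc gt2) xg1 xg2 in e3.
  rewrite (pair_eq D_L cg2 cg1 g20 g10 cpsd gt2) yg1 yg2 in e4.
  exact: (eigen_algebra h1 h2 e1 e2 e3 e4 qn).
have [mc' md'] : pairF0 (cexp_re x y) = 0 /\ pairF0 (cexp_im x y) = 0.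
  have e1 := test_f bu1 k1 (is_derive_cexp_re x y) cpsc cc1 cc3.
  have e2 := test_f bu1 k1 (is_derive_cexp_im x y) cpsd cc2 cc4.
  have e3 := test_f bu2 k2 (is_derive_cexp_re x y) cpsc cc1 cc3.
  have e4 := test_f bu2 k2 (is_derive_cexp_im x y) cpsd cc2 cc4.
  rewrite (pair_eq t23_L cf1 cf2 f10 f20 cpsc ft1) mulNr xf1 xf2 in e1.
  rewrite (pair_eq t23_L cf1 cf2 f10 f20 cpsd ft1) mulNr yf1 yf2 in e2.
  rewrite (pair_eq t23_L cf2 cf1 f20 f10 cpsc ft2) xf1 xf2 in e3.
  rewrite (pair_eq t23_L cf2 cf1 f20 f10 cpsd ft2) yf1 yf2 in e4.
  (* In the equations for [f] the factor [q] has the opposite sign, so [eigen_algebra] is used with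
     [- qq u1] and [- qq u2]. *)
  rewrite -[qq u1]opprK mulNr in e1; rewrite -[qq u1]opprK mulNr in e2.
  rewrite -[qq u2]opprK mulNr in e3; rewrite -[qq u2]opprK mulNr in e4.
  have qn' : (- qq u1) ^+ 2 + (- qq u2) ^+ 2 != 0 by rewrite !sqrrN.
  exact: (eigen_algebra h1 h2 e1 e2 e3 e4 qn').
exact: (rank (x := x) (y := y)).
Qed.

(** With [q = 0] the primitive of the eigenvector is [lam] times it; multiplying by [x + i y] bounds
    each part by the two primitives, and [gronwall] applies with [K = |x| + |y|]. *)
Lemma eigen_zero t : u1 t = 0 /\ u2 t = 0.
Proof.
have [q1 q2] := eigen_q0.
have K0 : 0 <= `|x| + `|y| by rewrite addr_ge0.
have gv (w1 w2 : R -> R) A : cb w1 -> cb w2 -> A <= L ->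
    (forall t, ~~ (0 <= t < A) -> w1 t = 0) -> (forall t, ~~ (0 <= t < A) -> w2 t = 0) ->
    (forall t, t < L -> conv w1 H t = al * w1 t + - be * w2 t) ->
    (forall t, t < L -> conv w2 H t = al * w2 t + be * w1 t) ->
    forall s, w1 s = 0 /\ w2 s = 0.
  move=> c1 c2 AL w10 w20 e1 e2 s.
  have [sL|sL] := ltP s L; last first.
    have hs : ~~ (0 <= s < A) by rewrite (ltNge s) (le_trans AL sL) andbF.
    by rewrite w10 ?w20.
  apply: (gronwall c1 c2 K0 _ _ sL) => r rL.
    have -> : w1 r = x * conv w1 H r - y * conv w2 H r.
      rewrite e1// e2//.
      have -> : x * (al * w1 r + - be * w2 r) - y * (al * w2 r + be * w1 r) =
        (al * x - be * y) * w1 r - (al * y + be * x) * w2 r by ring.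
      by rewrite h1 h2 mul1r mul0r subr0.
    rewrite (le_trans (ler_normB _ _))// !normrM mulrDl !mulrDr.
    have := normr_ge0 x; have := normr_ge0 y.
    have := normr_ge0 (conv w1 H r); have := normr_ge0 (conv w2 H r).
    move=> p1 p2 p3 p4; have := mulr_ge0 p4 p1; have := mulr_ge0 p3 p2; lra.
  have -> : w2 r = y * conv w1 H r + x * conv w2 H r.
    rewrite e1// e2//.
    have -> : y * (al * w1 r + - be * w2 r) + x * (al * w2 r + be * w1 r) =
      (al * x - be * y) * w2 r + (al * y + be * x) * w1 r by ring.
    by rewrite h1 h2 mul1r mul0r addr0.
  rewrite (le_trans (ler_normD _ _))// !normrM mulrDl !mulrDr.
  have := normr_ge0 x; have := normr_ge0 y.
  have := normr_ge0 (conv w1 H r); have := normr_ge0 (conv w2 H r).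
  move=> p1 p2 p3 p4; have := mulr_ge0 p4 p2; have := mulr_ge0 p3 p1; lra.
have gz : forall s, gpart u1 s = 0 /\ gpart u2 s = 0.
  apply: (gv _ _ D cg1 cg2 D_L g10 g20) => s sL.
    by rewrite -gt1// /gt q1 mul0r subr0.
  by rewrite -gt2// /gt q2 mul0r subr0.
have fz : forall s, fpart u1 s = 0 /\ fpart u2 s = 0.
  apply: (gv _ _ t23 cf1 cf2 t23_L f10 f20) => s sL.
    by rewrite -ft1// /ft q1 mul0r addr0.
  by rewrite -ft2// /ft q2 mul0r addr0.
have [tD'|tD'] := ltP t D.
  by have := gz t; rewrite /gpart tD'.
by have := fz (t - D); rewrite /fpart subr_ge0 tD' subrK.
Qed.

End Nonzero.
End EigenPair.

Lemma divop_inj u : bs L u -> (forall t, That u t = 0) -> (forall t, divop u t = 0) ->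
  forall t, u t = 0.
Proof.
move=> bu u0 Bu.
have cg := bs_cb D_ge0 (gpart_bs bu); have cf := bs_cb t23_ge0 (fpart_bs bu).
have g_0 t : t < L -> gt u t = 0.
  by move=> tL; rewrite -gtE// /gpart Bu if_same.
have f_0 t : t < L -> ft u t = 0.
  by move=> tL; rewrite -ftE// /fpart Bu if_same.
(* Before time [tau2] no delayed step has started, so [ft u t] is [qq u] plus primitives of bounded
   functions over [[0, t]], of order [t]. *)
have q0 : qq u = 0.
  have [m m_ge0 fm] := cb_bound cf; have [n n_ge0 Nn] := bs_bound bsN.
  apply/eqP; rewrite -normr_le0 leNgt; apply/negP => qpos.
  pose K := m + `|qq u| * n.
  have K_ge0 : 0 <= K by rewrite addr_ge0// mulr_ge0.
  have bnd c : 0 < c -> c <= tau2 -> `|qq u| <= K * c.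
    move=> c0 c2; pose t := c / 2.
    have tc : 0 <= t < c by rewrite /t; lra.
    have tL : t < L by case/andP: tau2_itv => _ h; lra.
    have := f_0 t tL; rewrite /ft Hv1; last by rewrite tL; case/andP: tc => ->.
    have -> : At H t = 0.
      by rewrite /At !Hv_neg ?mulr0 ?addr0//; slra.
    have b1 := @conv_H_small _ L (fpart u) m 0 c t cf m_ge0 tc (fun s => cb_neg cf) (fun s _ => fm s).
    have b2 := @conv_H_small _ L N n 0 c t cbN n_ge0 tc (fun s => cb_neg cbN) (fun s _ => Nn s).
    rewrite subr0 in b1 b2.
    move=> e; have -> : qq u = qq u * conv N H t - conv (fpart u) H t by move: e; lra.
    rewrite (le_trans (ler_normB _ _))// normrM /K mulrDl addrC lerD//.
    by rewrite -mulrA ler_wpM2l.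
  (* Small enough for [2 * (K * c) + 2 * c <= |qq u|], which is incompatible with
     [|qq u| <= K * c]. *)
  pose c := Num.min tau2 (`|qq u| / (2 * (K + 1))).
  have d0 : 0 < 2 * (K + 1) by lra.
  have c0 : 0 < c by rewrite lt_min t2_gt0 divr_gt0.
  have c1 : c <= tau2 by rewrite ge_min lexx.
  have c2 : c <= `|qq u| / (2 * (K + 1)) by rewrite ge_min lexx orbT.
  have := bnd c c0 c1; rewrite leNgt => /negP; apply.
  rewrite ler_pdivlMr// in c2.
  have : c * (2 * (K + 1)) = 2 * (K * c) + 2 * c by ring.
  move=> e; rewrite e in c2; have := mulr_ge0 K_ge0 (ltW c0); lra.
have DL' : D < L by rewrite ltrDl; slra.
have tL' : t23 < L by rewrite ltrDr.
have [_ _ g0] := gpart_bs bu; have [_ _ f0] := fpart_bs bu.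
have rg : rint (fun t => `|gpart u t|) = 0.
  apply: (prim_zero cg DL' g0) => t tL.
  by have := g_0 t tL; rewrite /gt q0 mul0r subr0.
have rf : rint (fun t => `|fpart u t|) = 0.
  apply: (prim_zero cf tL' f0) => t tL.
  by have := f_0 t tL; rewrite /ft q0 mul0r addr0.
(* L1 norms alone give vanishing almost everywhere; but then [Z u] vanishes everywhere, and so does
   [u], which is [RP (ic * Z u)]. *)
have Z0 t : Z u t = 0.
  have [n n0 Nn] := bs_bound bsN; have [m m_ge0 Mm] := bs_bound bsM.
  have := conv_norm t (cb_intg cg) cbN Nn; rewrite rg mul0r normr_le0 => /eqP e1.
  have := conv_norm t (cb_intg cf) cbM Mm; rewrite rf mul0r normr_le0 => /eqP e2.
  by rewrite /Z e1 e2 subrr.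
have us : supp L u by case: bu.
move=> t; rewrite ((That0_RP us).1 u0 t).
rewrite (_ : (fun t => _) = fun=> 0); last by apply/funext => s; rewrite Z0 mulr0.
have h : `|RP (fun=> 0) t| <= rbd * 0 by apply: RP_bound => s; rewrite normr0.
by apply/eqP; rewrite -normr_le0 -[leRHS](mulr0 rbd).
Qed.

Lemma That_ker0 u : bs L u -> (forall t, That u t = 0) -> forall t, u t = 0.
Proof.
move=> bu u0; apply: contrapT => /existsNP[t0 /eqP ut0].
have [E [n [phi [l [Lam [linE bE hE bphi [linl lb frkE]]]]]]] := RPZ_finite_rank.
have kerE v : bs L v -> (forall t, v t = frk E phi l v t) <-> (forall t, That v t = 0).
  move=> bv; have vs : supp L v by case: bv.
  split=> [h|/(That0_RP vs) h t]; last by rewrite frkE -h.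
  by apply/(That0_RP vs) => t; rewrite -frkE -h.
have Bker v : bs L v -> (forall t, v t = frk E phi l v t) -> forall t, divop v t = frk E phi l (divop v) t.
  move=> bv /(kerE _ bv) v0; apply/kerE; first exact: bs_divop.
  exact: divop_ker.
have [al [be [u1 [u2 [[b1 b2] [/(kerE _ b1) v1 /(kerE _ b2) v2] [t ht] [e1 e2]]]]]] :=
  fredholm_eigen linE bE hE bphi linl lin_divop bs_divop Bker bu ((kerE _ bu).2 u0) (ex_intro _ t0 ut0).
suff : u1 t = 0 /\ u2 t = 0.
  by move=> [z1 z2]; move: ht; rewrite z1 z2 eqxx.
pose rho := al ^+ 2 + be ^+ 2.
have [r0|rn] := eqVneq rho 0.
  move/eqP: r0; rewrite paddr_eq0 ?sqr_ge0// !sqrf_eq0 => /andP[/eqP a0 /eqP b0'].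
  by split; apply: divop_inj => // s; rewrite ?e1 ?e2 a0 b0' !mul0r ?subr0 ?addr0.
(* The conjugate of [al + i be] divided by its squared modulus is the inverse. *)
apply: (@eigen_zero al be u1 u2 b1 b2 v1 v2 e1 e2 (al / rho) (- be / rho)).
- by rewrite mulNr mulrN opprK !mulrA -mulrDl -!expr2 divff.
- by rewrite mulNr mulrN !mulrA [be * al]mulrC addrC subrr.
Qed.

End Kernel.
End Operator.

(** * The operator on quadruples *)

Section FiniteSets.
Variable R : realType.
Local Notation mu := (@lebesgue_measure R).
Implicit Types (f g u v w : R -> R) (s : seq R) (a b c d t : R).

Lemma meas_opp_shift f t : measurable_fun setT f -> measurable_fun setT (fun x : R => f (t - x)).
Proof. by move=> mf; apply: measurableT_comp => //; exact: measurable_funB. Qed.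

(** The operator of the statement integrates over closed intervals, the glued one uses half-open
    supports; they differ at finitely many points, collected in [s]. *)
Lemma meas_off s f g : measurable_fun setT f -> (forall x, x \notin s -> f x = g x) ->
  measurable_fun setT g.
Proof.
move=> mf fg _ B mB; rewrite setTI.
have fin (A : set R) : A `<=` [set` s] -> measurable A.
  move=> As; apply: countable_measurable; first exact: measurable_set1.
  by apply: sub_countable (finite_set_countable (finite_seq s)); exact: subset_card_le.
have -> : g @^-1` B = (f @^-1` B `\` [set` s]) `|` (g @^-1` B `&` [set` s]).
  apply/seteqP; split=> x /=.
    move=> gB; have [xs|xs] := boolP (x \in s); first by right.
    by left; split; [rewrite fg|exact/negP].
  by move=> [[fB /negP xs]|[]//]; rewrite -fg.
apply: measurableU.
  apply: measurableD; last exact: fin.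
  by have := mf measurableT B mB; rewrite setTI.
by apply: fin => x [].
Qed.

Lemma ae_off s f g : (forall x, x \notin s -> f x = g x) -> {ae mu, forall x, f x = g x}.
Proof.
move=> fg; exists [set` s]; split.
- apply: countable_measurable; first exact: measurable_set1.
  exact/finite_set_countable/finite_seq.
- exact/countable_lebesgue_measure0/finite_set_countable/finite_seq.
- move=> x /= h; apply: contrapT => /negP xs; apply: h; exact: fg.
Qed.

Lemma rint_ae f g : measurable_fun setT f -> measurable_fun setT g ->
  {ae mu, forall x, f x = g x} -> rint f = rint g.
Proof.
move=> mf mg fg; congr fine; apply: ae_eq_integral => //.
- exact/measurable_EFinP.
- exact/measurable_EFinP.
- by move: fg; apply: (@filterS _ _ (ae_filter_ringOfSetsType mu)) => x /= ->.
Qed.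

Lemma rint_off s f g : measurable_fun setT f -> (forall x, x \notin s -> f x = g x) ->
  rint f = rint g.
Proof.
by move=> mf fg; apply: rint_ae => //; [exact: meas_off fg|exact: ae_off fg].
Qed.

Lemma RintE a b f : Defs.Rint a b f = rint (fun x => if a <= x <= b then f x else 0).
Proof.
rewrite /Defs.Rint Rintegral_mkcond; apply: eq_rint => x; rewrite patchE.
congr (if _ then _ else _); apply/idP/idP; rewrite inE /= in_itv//.
Qed.

Definition pc a b w t : R := if a < t < b then w t else 0.

Lemma meas_pc a b w : measurable_fun `]a, b[ w <-> measurable_fun setT (pc a b w).
Proof.
rewrite (measurable_restrictT _ (measurable_itv _ : measurable (`]a, b[%classic : set R))).
rewrite (_ : w \_ _ = pc a b w)//; apply/funext => x; rewrite patchE /pc.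
by congr (if _ then _ else _); apply/idP/idP; rewrite inE /= in_itv.
Qed.

Lemma L2_pc a b w : L2norm2 a b w = (\int[mu]_x ((pc a b w x) ^+ 2)%:E)%E.
Proof.
rewrite /L2norm2 integral_mkcond; apply: eq_integral => x _; rewrite patchE /pc.
case: ifPn => h; case: ifPn => h'//.
- by move: h; rewrite inE /= in_itv /= (negbTE h').
- by exfalso; move/negP: h; apply; rewrite inE /= in_itv.
- by rewrite expr0n.
Qed.

Lemma supp_pc a b w : 0 <= a -> supp b (pc a b w).
Proof.
move=> a0 t h; rewrite /pc; case: ifPn => // /andP[h1 h2]; exfalso; move/negP: h; apply.
by rewrite h2 andbT (le_trans a0)// ltW.
Qed.

Lemma L2on_L2supp a b w : 0 <= a -> L2on a b w <-> L2supp b (pc a b w).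
Proof.
move=> a0; rewrite /L2on; split=> [[mw lw]|[mw /intg_P[_ lw] _]].
  have mp := (meas_pc a b w).1 mw; split => //; last exact: supp_pc.
  apply/intg_P; split; first exact: measurable_funX.
  rewrite (_ : (\int[_]_x _)%E = L2norm2 a b w)//.
  by rewrite L2_pc; apply: eq_integral => x _; rewrite ger0_norm// sqr_ge0.
split; first exact/meas_pc.
rewrite -/(L2norm2 a b w) L2_pc (_ : (\int[_]_x _)%E = (\int[mu]_x `|pc a b w x ^+ 2|%:E)%E)//.
by apply: eq_integral => x _; rewrite ger0_norm// sqr_ge0.
Qed.

Lemma L2norm2_sqnorm a b w : 0 <= a -> L2on a b w -> L2norm2 a b w = (sqnorm (pc a b w))%:E.
Proof.
move=> a0 /(L2on_L2supp _ _ a0)[mw Iw _]; rewrite L2_pc /sqnorm /rint /Rintegral fineK//.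
by have := integrable_fin_num measurableT Iw.
Qed.

Lemma sqnorm0_ae L w : L2supp L w -> sqnorm w = 0 <-> {ae mu, forall x, w x = 0}.
Proof.
move=> [mw Iw _].
have h := ae_eq_integral_abs mu measurableT (measurable_int mu Iw).
have e : (\int[mu]_x `|(EFin \o (fun t => w t ^+ 2)%R) x| = (sqnorm w)%:E)%E.
  rewrite /sqnorm /rint /Rintegral fineK; last by have := integrable_fin_num measurableT Iw.
  by apply: eq_integral => x _ /=; rewrite ger0_norm// sqr_ge0.
rewrite e in h; split.
  move=> n0; have := h.1; rewrite n0 => /(_ erefl).
  apply: (@filterS _ _ (ae_filter_ringOfSetsType mu)) => x /= /(_ I) [].
  by move/eqP; rewrite sqrf_eq0 => /eqP.
move=> w0; have : (sqnorm w)%:E = 0%E.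
  apply/h; move: w0; apply: (@filterS _ _ (ae_filter_ringOfSetsType mu)) => x /= -> _.
  by rewrite expr0n.
by case.
Qed.

Lemma sqnorm_off L s f g : L2supp L f -> supp L g -> (forall x, x \notin s -> f x = g x) ->
  L2supp L g /\ sqnorm g = sqnorm f.
Proof.
move=> [mf If f0] g0 fg; have mg := meas_off mf fg.
have e : rint (fun t => f t ^+ 2) = rint (fun t => g t ^+ 2).
  by apply: (@rint_off s) => [|x xs]; [exact: measurable_funX|rewrite fg].
split => //; split => //.
apply/intg_P; split; first exact: measurable_funX.
have [_] := (intg_P _).1 If; congr (_ < _)%E; apply: ae_eq_integral => //.
- by apply/measurable_EFinP; apply: measurableT_comp => //; exact: measurable_funX.
- by apply/measurable_EFinP; apply: measurableT_comp => //; exact: measurable_funX.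
- have := ae_off fg; apply: (@filterS _ _ (ae_filter_ringOfSetsType mu)) => x /= -> //.
Qed.

Lemma intg_off s f g : intg f -> (forall x, x \notin s -> f x = g x) -> intg g.
Proof.
move=> /[dup] If /intg_P[mf lf] fg; have mg := meas_off mf fg.
apply/intg_P; split => //; move: lf; congr (_ < _)%E; apply: ae_eq_integral => //.
- by apply/measurable_EFinP; apply: measurableT_comp.
- by apply/measurable_EFinP; apply: measurableT_comp.
- have := ae_off fg; apply: (@filterS _ _ (ae_filter_ringOfSetsType mu)) => x /= -> //.
Qed.

Lemma pcB a b u v t : pc a b (fun t => u t - v t) t = pc a b u t - pc a b v t.
Proof. by rewrite /pc; case: ifP => // _; rewrite subr0. Qed.

Lemma L2onB a b u v : 0 <= a -> L2on a b u -> L2on a b v -> L2on a b (fun t => u t - v t).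
Proof.
move=> a0 /(L2on_L2supp _ _ a0) su /(L2on_L2supp _ _ a0) sv; apply/L2on_L2supp => //.
by rewrite (_ : pc _ _ _ = fun t => pc a b u t - pc a b v t);
  [have [] := L2suppB su sv|apply/funext => t; exact: pcB].
Qed.

Lemma aeeq_sqnorm a b u v : 0 <= a -> L2on a b u -> L2on a b v ->
  aeeq a b u v <-> sqnorm (pc a b (fun t => u t - v t)) = 0.
Proof.
move=> a0 hu hv; have := L2onB a0 hu hv => /(L2on_L2supp _ _ a0) sd.
rewrite (sqnorm0_ae sd); split; apply: (@filterS _ _ (ae_filter_ringOfSetsType mu)) => x /=.
  by rewrite /pc; case: ifP => // h /(_ isT) ->; rewrite subrr.
by rewrite /pc => + h; rewrite h => /eqP; rewrite subr_eq0 => /eqP.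
Qed.

(** The one-sided limits bound [h] near both ends and compactness bounds it in between; the value
    [h p] is unrelated to the limit at [p] and is counted separately. *)
Lemma pwc_piece (h : R -> R) (p q : R) : p < q ->
  (forall z, p < z < q -> {for z, continuous h}) -> cvg (h @ p^'+) -> cvg (h @ q^'-) ->
  measurable_fun `[p, q[ h /\ exists m, forall t, p <= t < q -> `|h t| <= m.
Proof.
move=> pq ch cp cq.
have mo : measurable_fun (`]p, q[%classic : set R) h.
  apply: open_continuous_measurable_fun; first exact: interval_open.
  by move=> x; rewrite inE /= in_itv /=; exact: ch.
split.
  rewrite (_ : `[p, q[%classic = [set p] `|` `]p, q[%classic); last first.
    by rewrite setU1itv// bnd_simp.
  apply/measurable_funU; [exact: measurable_set1|exact: measurable_itv|].
  by split => //; exact: measurable_fun_set1.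
have [l hl] := (cvg_ex _).1 cp; have [r hr] := (cvg_ex _).1 cq.
have [d d0 dP] : exists2 d : R, 0 < d & forall t, p < t < p + d -> `|h t| <= `|l| + 1.
  move/cvgrPdist_lt : hl => /(_ 1 ltr01) /nbhs_ballP[d /= d0 dP].
  exists d => // t /andP[pt td].
  have := dP t; rewrite /ball /= ltr_norml => /(_ _ pt) hh.
  rewrite -[h t](subrK l) (le_trans (ler_normD _ _))// addrC lerD2l distrC ltW// hh//.
  by apply/andP; split; lra.
have [e e0 eP] : exists2 d : R, 0 < d & forall t, q - d < t < q -> `|h t| <= `|r| + 1.
  move/cvgrPdist_lt : hr => /(_ 1 ltr01) /nbhs_ballP[e /= e0 eP].
  exists e => // t /andP[qt tq].
  have := eP t; rewrite /ball /= ltr_norml => /(_ _ tq) hh.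
  rewrite -[h t](subrK r) (le_trans (ler_normD _ _))// addrC lerD2l distrC ltW// hh//.
  by apply/andP; split; lra.
have cK := @segment_compact R (p + d / 2) (q - e / 2).
have /compact_bounded[m [_ hm]] : compact (h @` `[p + d / 2, q - e / 2]%classic).
  apply: continuous_compact cK; apply: continuous_in_subspaceT => x.
  by rewrite inE /= in_itv /= => /andP[x1 x2]; apply: ch; lra.
exists (`|h p| + (`|l| + 1) + (`|r| + 1) + `|m + 1|) => t /andP[pt tq].
have := normr_ge0 (h p); have := normr_ge0 l; have := normr_ge0 r; have := normr_ge0 (m + 1).
move=> n1 n2 n3 n4.
have [->|tp] := eqVneq t p; first by lra.
have {}pt : p < t by rewrite lt_neqAle eq_sym tp.
have [h1|h1] := ltP t (p + d).
  by have := dP t; rewrite pt h1 => /(_ isT); lra.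
have [h2|h2] := ltP (q - e) t.
  by have := eP t; rewrite tq h2 => /(_ isT); lra.
have : `|h t| <= m + 1.
  apply: (hm (m + 1)); first by rewrite ltrDl.
  by exists t => //=; rewrite in_itv /=; apply/andP; split; lra.
have := ler_norm (m + 1); lra.
Qed.

Lemma pwc_seq (h : R -> R) (x : R) (s : seq R) : sorted <%R (x :: s) ->
  (forall i : nat, (i.+1 < size (x :: s))%N ->
    [/\ forall z, nth 0 (x :: s) i < z < nth 0 (x :: s) i.+1 -> {for z, continuous h},
        cvg (h @ (nth 0 (x :: s) i)^'+) & cvg (h @ (nth 0 (x :: s) i.+1)^'-)]) ->
  [/\ x <= last x s, measurable_fun `[x, last x s[ h &
      exists m, forall t, x <= t < last x s -> `|h t| <= m].
Proof.
elim: s x => [|y s IH] x.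
  move=> _ _; split => //=; last by exists 0 => t /andP[h1 h2]; lra.
  by rewrite set_itvco0//; exact: measurable_fun_set0.
rewrite [sorted _ _]/= => /andP[xy ss] hs.
have [c1 c2 c3] := hs 0%N isT.
have [mp [m1 b1]] := pwc_piece xy c1 c2 c3.
have [yl ms [m2 b2]] := IH y ss (fun i hi => hs i.+1 hi).
have xl : x <= last y s by rewrite (le_trans (ltW xy)).
split => //=.
- rewrite (_ : `[x, last y s[%classic = `[x, y[%classic `|` `[y, last y s[%classic); last first.
    by rewrite -itv_bndbnd_setU// bnd_simp// ltW.
  by apply/measurable_funU; [exact: measurable_itv|exact: measurable_itv|].
- exists (Num.max m1 m2) => t /andP[xt tl]; rewrite le_max.
  have [ty|yt] := ltP t y; first by rewrite b1// xt.
  by rewrite b2 ?orbT// yt.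
Qed.

Lemma pwc_bs (h : R -> R) A : piecewise_continuous 0 A h ->
  bs A (fun t => if 0 <= t < A then h t else 0).
Proof.
move=> [[|x s] [// _ ss /= hx hl hs]]; rewrite hx in ss hl hs *.
have [_ mh [m hm]] := pwc_seq ss hs.
have lE : last 0 s = A by [].
rewrite lE in mh hm.
split.
- have /(measurable_restrictT _ (measurable_itv _ : measurable (`[0, A[%classic : set R))) := mh.
  congr (measurable_fun _ _); apply/funext => t; rewrite patchE.
  by congr (if _ then _ else _); apply/idP/idP; rewrite inE /= in_itv.
- exists `|m| => t; case: ifP => h0; last by rewrite normr0.
  by rewrite (le_trans (hm t h0))// ler_norm.
- by move=> t /negbTE ->.
Qed.

End FiniteSets.

(** * Transfer between quadruples and glued functions *)

Section Link.
Variables (R : realType) (a2 a3 a23 b tau2 tau3 D : R) (N M : R -> R).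
Local Notation mu := (@lebesgue_measure R).
Local Notation t23 := (tau2 + tau3).
Local Notation L := (D + (tau2 + tau3)).
Hypothesis b0 : b != 0.
Hypothesis t2_gt0 : 0 < tau2.
Hypothesis t23_le : tau2 <= tau3.
Hypothesis tD : tau2 + tau3 < D.
(* Half-open truncations, as [bs] requires; they differ from [N] and [M] at one endpoint. *)
Definition N0 t := if 0 <= t < t23 then N t else 0.
Definition M0 t := if 0 <= t < D then M t else 0.
Hypothesis bsN : bs t23 N0.
Hypothesis bsM : bs D M0.

Local Notation TX := (Defs.T tau2 tau3 D a2 a3 a23 b N M).
Local Notation TH := (That a2 a3 a23 b tau2 tau3 D N0 M0).
Local Notation inX := (Defs.inX tau2 tau3 D).
Local Notation Xeq := (Defs.Xeq tau2 tau3 D).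

Let tau2_0 : 0 <= tau2. Proof. exact: ltW. Qed.
Let tau3_0 : 0 <= tau3. Proof. exact: le_trans t23_le. Qed.
Let t23_0 : 0 <= t23. Proof. exact: addr_ge0. Qed.
Let D_0 : 0 <= D. Proof. by rewrite (le_trans t23_0)// ltW. Qed.
Let tau3_t23 : tau3 <= t23. Proof. by rewrite lerDr. Qed.
Let tau2_t23 : tau2 <= t23. Proof. by rewrite lerDl. Qed.

(* [g] on [(0, D)] followed by [f] on [(D, D + t23)]. *)
Definition U (x : Xel R) t :=
  pc 0 D (xg x) t + (pc 0 tau2 (xf2 x) (t - D) + pc tau2 tau3 (xf3 x) (t - D)
    + pc tau3 t23 (xf23 x) (t - D)).

Definition dX (x y : Xel R) := mkX (fun t => xg x t - xg y t) (fun t => xf2 x t - xf2 y t)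
  (fun t => xf3 x t - xf3 y t) (fun t => xf23 x t - xf23 y t).

Lemma UB x y t : U (dX x y) t = U x t - U y t.
Proof. by rewrite /U /= !pcB; ring. Qed.

Lemma inXB x y : inX x -> inX y -> inX (dX x y).
Proof. by move=> [x1 x2 x3 x4] [y1 y2 y3 y4]; split; exact: L2onB. Qed.

Lemma L2supp_widen L1 L2 (w : R -> R) : L1 <= L2 -> L2supp L1 w -> L2supp L2 w.
Proof.
move=> LL [mw Iw w0]; split => // t h; apply: w0; apply: contra h => /andP[-> h] /=.
exact: lt_le_trans LL.
Qed.

Lemma L2supp_shift d A (w : R -> R) : 0 <= d -> L2supp A w ->
  L2supp (A + d) (fun t => w (t - d)) /\ sqnorm (fun t => w (t - d)) = sqnorm w.
Proof.
move=> d0 [mw Iw w0]; split; first split.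
- exact: meas_shift.
- exact: (intg_shift (- d) Iw).
- by move=> t h; apply: w0; apply: contra h => /andP[h1 h2]; apply/andP; split; lra.
- by rewrite /sqnorm (@rint_shift _ (fun t => w t ^+ 2) (- d))//; exact: intg_meas.
Qed.

Lemma rint_sum_L2supp (w1 w2 : R -> R) A : L2supp A w1 -> L2supp A w2 -> (forall t, w1 t * w2 t = 0) ->
  sqnorm (fun t => w1 t + w2 t) = sqnorm w1 + sqnorm w2.
Proof.
move=> [m1 I1' _] [m2 I2' _] w0; rewrite /sqnorm -rintD//; apply: eq_rint => t.
by rewrite sqrrD w0 mul0rn addr0.
Qed.

Lemma U_sqnorm x : inX x -> L2supp L (U x) /\
  sqnorm (U x) = sqnorm (pc 0 D (xg x)) + (sqnorm (pc 0 tau2 (xf2 x)) + sqnorm (pc tau2 tau3 (xf3 x))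
    + sqnorm (pc tau3 t23 (xf23 x))).
Proof.
move=> [/(L2on_L2supp _ _ (lexx 0)) s1 /(L2on_L2supp _ _ (lexx 0)) s2
  /(L2on_L2supp _ _ tau2_0) s3 /(L2on_L2supp _ _ tau3_0) s4].
have e1 : L2supp L (pc 0 D (xg x)) by apply: L2supp_widen s1; rewrite lerDl.
have [e2 n2] := L2supp_shift D_0 (L2supp_widen tau2_t23 s2).
have [e3 n3] := L2supp_shift D_0 (L2supp_widen tau3_t23 s3).
have [e4 n4] := L2supp_shift D_0 s4.
have LE : t23 + D = L by rewrite addrC.
rewrite LE in e2 e3 e4.
have [e23 _] := L2suppD e2 e3; have [e234 _] := L2suppD e23 e4; have [e _] := L2suppD e1 e234.
split => //; rewrite /U (rint_sum_L2supp e1 e234).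
  rewrite (rint_sum_L2supp e23 e4).
    rewrite (rint_sum_L2supp e2 e3) ?n2 ?n3 ?n4// => t.
    rewrite /pc; case: ifP => [h|]; last by rewrite mul0r.
    by case: ifP => [h'|]; rewrite ?mulr0//; exfalso; move: h h'; lra.
  move=> t; rewrite /pc; case: (ifP (tau3 < _ < _)) => [h|]; last by rewrite mulr0.
  rewrite ifF; last by apply/negP => h'; move: t23_le h h'; lra.
  by rewrite ifF ?addr0 ?mul0r//; apply/negP => h'; move: t23_le h h'; lra.
move=> t; rewrite /pc; case: (ifP (0 < t < D)) => [h|]; last by rewrite mul0r.
rewrite ifF; last by apply/negP => h'; move: h h'; lra.
rewrite ifF; last by apply/negP => h'; move: t2_gt0 h h'; lra.
by rewrite ifF ?addr0 ?mulr0//; apply/negP => h'; move: t2_gt0 t23_le h h'; lra.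
Qed.

Lemma Xnorm2E x : inX x -> Xnorm2 tau2 tau3 D x = (sqnorm (U x))%:E.
Proof.
move=> hx; have [_ ->] := U_sqnorm hx; case: hx => [x1 x2 x3 x4].
rewrite /Xnorm2 !L2norm2_sqnorm// -!EFinD; congr (_ %:E); ring.
Qed.

Lemma XeqE x y : inX x -> inX y -> Xeq x y <-> sqnorm (fun t => U x t - U y t) = 0.
Proof.
move=> hx hy; have [_] := U_sqnorm (inXB hx hy).
rewrite (_ : U (dX x y) = fun t => U x t - U y t); last by apply/funext => t; rewrite UB.
move=> ->; case: hx => [x1 x2 x3 x4]; case: hy => [y1 y2 y3 y4].
have i1 := aeeq_sqnorm (lexx 0) x1 y1; have i2 := aeeq_sqnorm (lexx 0) x2 y2.
have i3 := aeeq_sqnorm tau2_0 x3 y3; have i4 := aeeq_sqnorm tau3_0 x4 y4.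
split=> [[/i1 -> /i2 -> /i3 -> /i4 ->]|]; first by rewrite !addr0.
move: i1 i2 i3 i4; rewrite /dX /=.
set n1 := sqnorm _; set n2 := sqnorm _; set n3 := sqnorm _; set n4 := sqnorm _ => i1 i2 i3 i4 h.
have p1 : 0 <= n1 by exact: sqnorm_ge0.
have p2 : 0 <= n2 by exact: sqnorm_ge0.
have p3 : 0 <= n3 by exact: sqnorm_ge0.
have p4 : 0 <= n4 by exact: sqnorm_ge0.
split; [apply/i1|apply/i2|apply/i3|apply/i4];
  by apply/eqP; rewrite eq_le ?p1 ?p2 ?p3 ?p4 andbT; move: p1 p2 p3 p4 h; lra.
Qed.

(** The junctions of the four pieces: quadruples live on open intervals, so the values of a glued
    function there carry no information. *)
Definition brk : seq R := [:: 0; D; D + tau2; D + tau3].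

Lemma inX_off x u : L2supp L u -> (forall t, 0 < t < D -> xg x t = u t) ->
  (forall t, 0 < t < tau2 -> xf2 x t = u (t + D)) ->
  (forall t, tau2 < t < tau3 -> xf3 x t = u (t + D)) ->
  (forall t, tau3 < t < t23 -> xf23 x t = u (t + D)) ->
  inX x /\ forall t, t \notin brk -> U x t = u t.
Proof.
move=> su h1 h2 h3 h4; have [mu' Iu u0] := su.
have key d c e (w : R -> R) : 0 <= c -> (forall t, c < t < e -> w t = u (t + d)) -> L2on c e w.
  move=> c0 h; apply/L2on_L2supp => //.
  have mi : measurable_fun setT (fun t : R => if c < t < e then 1 else 0 : R).
    apply: measurable_fun_ifT => //; apply: measurable_and.
      exact: measurable_fun_ltr.
    exact: measurable_fun_ltr.
  have pE : pc c e w = fun t => (if c < t < e then 1 else 0) * u (t + d).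
    by apply/funext => t; rewrite /pc; case: ifP => [hh|]; rewrite ?mul0r ?mul1r ?h.
  have mp : measurable_fun setT (pc c e w).
    by rewrite pE; apply: measurable_funM => //; exact: meas_shift.
  split => //; last exact: supp_pc.
  apply: intg_le (intg_shift d Iu) _; first exact: measurable_funX.
  move=> t; rewrite pE ger0_norm ?sqr_ge0//; case: ifP; rewrite ?mul1r// mul0r expr0n.
  by rewrite sqr_ge0.
split.
  split.
  - by apply: (key 0) => // t ht; rewrite addr0 h1.
  - exact: (key D).
  - exact: (key D).
  - exact: (key D).
move=> t; rewrite !inE !negb_or => /and4P[n1 n2 n3 n4].
have [tL|tL] := boolP (0 <= t < L); last first.
  rewrite u0// /U /pc; rewrite ifF; last by apply/negP => h; move/negP: tL; apply; move: h; move: t23_0; lra.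
  rewrite ifF; last by apply/negP => h; move/negP: tL; apply; move: D_0 h tau2_t23; lra.
  rewrite ifF; last by apply/negP => h; move/negP: tL; apply; move: D_0 h tau2_0 tau3_t23; lra.
  rewrite ifF ?addr0//; apply/negP => h; move/negP: tL; apply; move: D_0 h tau3_0; lra.
have t0 : 0 < t by rewrite lt_neqAle eq_sym n1; case/andP: tL.
have tL' : t < L by case/andP: tL.
rewrite /U /pc.
have [c1|c1] := ltP t D.
  rewrite ifT ?t0// h1 ?t0// ifF; last by apply/negP => h; move: h c1; lra.
  rewrite ifF; last by apply/negP => h; move: h c1 tau2_0; lra.
  by rewrite ifF ?addr0//; apply/negP => h; move: h c1 tau3_0; lra.
have {}c1 : D < t by rewrite lt_neqAle eq_sym n2.
rewrite ifF; last by apply/negP => h; move: h c1; lra.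
have [c2|c2] := ltP t (D + tau2).
  have hh : 0 < t - D < tau2 by move: c1 c2; lra.
  rewrite hh h2// subrK ifF; last by apply/negP => h; move: h hh; lra.
  by rewrite ifF ?addr0 ?add0r//; apply/negP => h; move: h hh t23_le; lra.
have {}c2 : D + tau2 < t by rewrite lt_neqAle eq_sym n3.
rewrite ifF; last by apply/negP => h; move: h c2; lra.
have [c3|c3] := ltP t (D + tau3).
  have hh : tau2 < t - D < tau3 by move: c2 c3; lra.
  rewrite hh h3// subrK ifF ?addr0 ?add0r//; apply/negP => h; move: h hh; lra.
have {}c3 : D + tau3 < t by rewrite lt_neqAle eq_sym n4.
rewrite ifF; last by apply/negP => h; move: h c3; lra.
have hh : tau3 < t - D < t23 by move: c3 tL'; lra.
by rewrite hh h4// subrK !add0r.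
Qed.

Lemma gpartU x t : gpart D (U x) t = pc 0 D (xg x) t.
Proof.
rewrite /gpart /U; case: ltP => h; last by rewrite /pc (ltNge t) h andbF.
rewrite /pc ![if _ < t - D < _ then _ else _]ifF ?addr0//;
  apply/negP => h'; move: h h' tau2_0 tau3_0; lra.
Qed.

Lemma fpartU x t : t \notin [:: 0; tau2; tau3; t23] ->
  fpart D (U x) t = if 0 <= t <= t23 then fcat tau2 tau3 (xf2 x) (xf3 x) (xf23 x) t else 0.
Proof.
rewrite !inE !negb_or => /and4P[n1 n2 n3 n4].
rewrite /fpart /U addrK; have [t0|t0] := leP 0 t; last by [].
have {}t0 : 0 < t by rewrite lt_neqAle eq_sym n1.
rewrite /= /fcat /pc ifF; last by apply/negP => h; move: h t0; lra.
have [c2|c2] := ltP t tau2.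
  rewrite t0 ifF; last by apply/negP => h; move: h c2; lra.
  rewrite ifF; last by apply/negP => h; move: h c2 t23_le; lra.
  by rewrite ifT ?addr0 ?add0r// (le_trans (ltW c2)).
have {}c2 : tau2 < t by rewrite lt_neqAle eq_sym n2.
rewrite [in X in _ + (X + _ + _)]ifF; last by rewrite t0.
have [c3|c3] := ltP t tau3.
  rewrite c2 ifF; last by apply/negP => h; move: h c3; lra.
  by rewrite ifT ?addr0 ?add0r// (le_trans (ltW c3)).
have {}c3 : tau3 < t by rewrite lt_neqAle eq_sym n3.
rewrite c2 c3 /= !add0r; have [c4|c4] := ltP t t23.
  by rewrite (ltW c4).
by rewrite ifF//; apply/negP => h; move/eqP: n4; apply; apply/eqP; rewrite eq_le h.
Qed.

Section Element.
Variable x : Xel R.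
Hypothesis hx : inX x.
Local Notation f := (fcat tau2 tau3 (xf2 x) (xf3 x) (xf23 x)).
Local Notation g := (xg x).
Local Notation F := (fpart D (U x)).
Local Notation G := (gpart D (U x)).

Let sU : L2supp L (U x). Proof. by have [] := U_sqnorm hx. Qed.

Let IF t : intg (fun s => F s * M0 (t - s)).
Proof.
have [mM [m Mm] _] := bsM.
by apply: (@intg_mul _ _ _ m) => //; [apply: fpart_intg; exact: L2supp_intg sU|exact: meas_opp_shift].
Qed.

Let IG t : intg (fun s => G s * N0 (t - s)).
Proof.
have [mN [m Nm] _] := bsN.
by apply: (@intg_mul _ _ _ m) => //; [apply: gpart_intg; exact: L2supp_intg sU|exact: meas_opp_shift].
Qed.

(** Each range of integration in [T] is the support of [f] intersected with the window where [M]
    lives, as the hypothesis on [a] and [c] states; all the cases thus become one convolution. *)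
Let convF t a c : (forall s, (a <= s <= c) = (0 <= s <= t23) && (t - D <= s <= t)) ->
  let w s := if a <= s <= c then f s * M (t - s) else 0 in
  intg w /\ rint w = conv F M0 t.
Proof.
(* The point [t - D] is excluded because [M0] drops the value of [M] at [D]. *)
move=> ac w; have e s : s \notin [:: 0; tau2; tau3; t23; t - D] -> F s * M0 (t - s) = w s.
  rewrite [[:: _; _; _; _; _]](_ : _ = [:: 0; tau2; tau3; t23] ++ [:: t - D])// mem_cat negb_or.
  move=> /andP[s1]; rewrite inE => s2; rewrite fpartU// /w ac; case: ifP => _; rewrite ?mul0r//=.
  rewrite /M0 (_ : (0 <= t - s < D) = (t - D <= s <= t)); first by case: ifP; rewrite ?mulr0.
  rewrite [t - D <= s]le_eqVlt eq_sym (negbTE s2) /=; apply/idP/idP => h; apply/andP; split; move: h; lra.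
by split; [exact: intg_off (IF t) e|rewrite -(rint_off (intg_meas (IF t)) e)].
Qed.

Let convG t a c : (forall s, (a <= s <= c) = (0 <= s <= D) && (t - t23 <= s <= t)) ->
  let w s := if a <= s <= c then g s * N (t - s) else 0 in
  intg w /\ rint w = conv G N0 t.
Proof.
move=> ac w; have e s : s \notin [:: 0; D; t - t23] -> G s * N0 (t - s) = w s.
  rewrite !inE !negb_or => /and3P[s1 s2 s3]; rewrite gpartU /w ac /pc.
  rewrite (_ : (0 <= s <= D) = (0 < s < D)); last first.
    by rewrite [0 <= s]le_eqVlt eq_sym (negbTE s1) /= [s <= D]le_eqVlt (negbTE s2).
  case: ifP => _; rewrite ?mul0r//=.
  rewrite /N0 (_ : (0 <= t - s < t23) = (t - t23 <= s <= t)); first by case: ifP; rewrite ?mulr0.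
  rewrite [t - t23 <= s]le_eqVlt eq_sym (negbTE s3) /=; apply/idP/idP => h; apply/andP; split; move: h; lra.
by split; [exact: intg_off (IG t) e|rewrite -(rint_off (intg_meas (IG t)) e)].
Qed.

Lemma TX_g nu : 0 < nu < D -> xg (TX x) nu = TH (U x) nu.
Proof.
move=> /andP[n0 nD]; rewrite /That /TT /At /= !gpartU.
have -> : F (nu - D) = 0 by rewrite /fpart ifF//; apply/negP => h; move: h nD; lra.
have pcE d : 0 <= d -> pc 0 D g (nu - d) = if d < nu then g (nu - d) else 0.
  by move=> d0; rewrite /pc subr_gt0 (_ : nu - d < D) ?andbT//; move: d0 nD; lra.
rewrite !pcE// {1}/pc n0 nD /=.
have -> : (if nu <= t23 then
     Defs.Rint 0 nu (fun eta => f eta * M (nu - eta) - g eta * N (nu - eta))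
   else Defs.Rint 0 t23 (fun eta => f eta * M (nu - eta))
     - Defs.Rint (nu - t23) nu (fun eta => g eta * N (nu - eta)))
   = conv F M0 nu - conv G N0 nu; last first.
  by case: (tau2 < nu); case: (tau3 < nu); case: (t23 < nu); ring.
case: ifPn => [nt|]; last rewrite -ltNge => nt; rewrite !RintE.
  have [|I1w <-] := @convF nu 0 nu.
    by move=> s; apply/idP/idP; lra.
  have [|I2w <-] := @convG nu 0 nu.
    by move=> s; apply/idP/idP; lra.
  by rewrite -rintB//; apply: eq_rint => s; case: ifP; rewrite ?subr0.
have [|_ <-] := @convF nu 0 t23.
  by move=> s; apply/idP/idP; lra.
have [|_ <-] := @convG nu (nu - t23) nu.
  by move=> s; apply/idP/idP; lra.
by [].
Qed.

(** A delayed term [g (nu + D - d)] survives the cut of [g] at [D] only when [nu < d], which is why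
    the later components carry fewer delays. *)
Lemma TH_tail nu : 0 < nu < t23 -> nu \notin [:: tau2; tau3] -> TH (U x) (nu + D) =
  b * f nu - (if nu < tau2 then a2 * g (nu + D - tau2) else 0)
  - (if nu < tau3 then a3 * g (nu + D - tau3) else 0) - a23 * g (nu + D - t23)
  + (Defs.Rint nu t23 (fun eta => f eta * M (nu + D - eta))
    - Defs.Rint (nu + D - t23) D (fun eta => g eta * N (nu + D - eta))).
Proof.
move=> /andP[n0 nt] nn.
have pcE d : 0 <= d <= t23 -> pc 0 D g (nu + D - d) = if nu < d then g (nu + D - d) else 0.
  move=> /andP[d0 dt]; rewrite /pc; congr (if _ then _ else _); apply/idP/idP.
    by move=> /andP[_]; lra.
  by move=> nd; apply/andP; split; move: nd n0 dt tD; lra.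
rewrite /That /TT /At !gpartU !pcE ?lexx ?andbT//; [|exact/andP|exact/andP].
rewrite {1}/pc ifF; last by apply/negP => h; move: h n0; lra.
rewrite addrK fpartU; last first.
  by move: nn; rewrite !inE !negb_or => /andP[-> ->]; rewrite /= gt_eqF// lt_eqF.
rewrite nt (ltW n0) (ltW nt) /=.
rewrite !RintE.
have [|_ <-] := @convF (nu + D) nu t23.
  by move=> s; apply/idP/idP; move: n0 nt tD; lra.
have [|_ <-] := @convG (nu + D) (nu + D - t23) D.
  by move=> s; apply/idP/idP; move: n0 nt tD; lra.
by case: (nu < tau2); case: (nu < tau3); ring.
Qed.

Lemma TX_f2 nu : 0 < nu < tau2 -> xf2 (TX x) nu = TH (U x) (nu + D).
Proof.
move=> /andP[n0 n2]; have n3 : nu < tau3 by exact: lt_le_trans t23_le.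
have nt : nu < t23 by exact: lt_le_trans tau3_t23.
have e : f nu = xf2 x nu by rewrite /fcat n2.
by rewrite TH_tail ?n0 ?nt// ?inE ?lt_eqF// e n2 n3 /=; ring.
Qed.

Lemma TX_f3 nu : tau2 < nu < tau3 -> xf3 (TX x) nu = TH (U x) (nu + D).
Proof.
move=> /andP[n2 n3]; have n0 : 0 < nu by exact: lt_trans n2.
have nt : nu < t23 by exact: lt_le_trans tau3_t23.
have n2' : (nu < tau2) = false by rewrite ltNge ltW.
have e : f nu = xf3 x nu by rewrite /fcat n2' n3.
by rewrite TH_tail ?n0 ?nt// ?inE ?(gt_eqF n2) ?(lt_eqF n3)// e n2' n3 /=; ring.
Qed.

Lemma TX_f23 nu : tau3 < nu < t23 -> xf23 (TX x) nu = TH (U x) (nu + D).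
Proof.
move=> /andP[n3 nt]; have n2 : tau2 < nu by exact: le_lt_trans n3.
have n0 : 0 < nu by exact: lt_trans n2.
have n2' : (nu < tau2) = false by rewrite ltNge ltW.
have n3' : (nu < tau3) = false by rewrite ltNge ltW.
have e : f nu = xf23 x nu by rewrite /fcat n2' n3'.
by rewrite TH_tail ?n0 ?nt// ?inE ?(gt_eqF n2) ?(gt_eqF n3)// e n2' n3' /=; ring.
Qed.

Lemma TX_off : inX (TX x) /\ forall t, t \notin brk -> U (TX x) t = TH (U x) t.
Proof.
have [C C0 hC] := sqb_That a2 a3 a23 b0 t2_gt0 t23_le tD bsN bsM; have [sT _] := hC _ sU.
by apply: inX_off sT TX_g TX_f2 TX_f3 TX_f23.
Qed.

End Element.

Let L2suppU x : inX x -> L2supp L (U x). Proof. by case/U_sqnorm. Qed.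

Let sT : sqb L TH. Proof. exact: sqb_That. Qed.

Let nsq0 w : (forall t : R, w t = 0) -> sqnorm w = 0.
Proof. by move=> w0; rewrite /sqnorm -[RHS](rint0 R); apply: eq_rint => t; rewrite w0 expr0n. Qed.

Let TH_nsq0 w : L2supp L w -> sqnorm w = 0 -> sqnorm (TH w) = 0.
Proof.
have [C C0 hC] := sT; move=> sw n0; have [_] := hC _ sw; rewrite n0 mulr0 => h.
by apply/eqP; rewrite eq_le h sqnorm_ge0.
Qed.

Lemma TX_XeqE x x' : inX x -> inX x' ->
  Xeq (TX x) (TX x') <-> sqnorm (TH (fun t => U x t - U x' t)) = 0.
Proof.
move=> hx hx'; have [h1 e1] := TX_off hx; have [h2 e2] := TX_off hx'.
have [sd _] := L2suppB (L2suppU hx) (L2suppU hx'); have [C C0 hC] := sT; have [sTd _] := hC _ sd.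
have [sd' _] := L2suppB (L2suppU h1) (L2suppU h2).
rewrite XeqE//; have [||_ ->//] := @sqnorm_off _ L brk (TH (fun t => U x t - U x' t))
  (fun t => U (TX x) t - U (TX x') t) sTd; first by case: sd'.
by move=> t tb; rewrite e1// e2// ThatB//; [exact: L2supp_intg (L2suppU hx)|exact: L2supp_intg (L2suppU hx')].
Qed.

Lemma TX_Xeq x x' : inX x -> inX x' -> Xeq x x' -> Xeq (TX x) (TX x').
Proof.
move=> hx hx' /(XeqE hx hx') e; apply/TX_XeqE => //.
by apply: TH_nsq0 => //; have [] := L2suppB (L2suppU hx) (L2suppU hx').
Qed.

Hypothesis ker0 : forall u, bs L u -> (forall t, TH u t = 0) -> forall t, u t = 0.

Lemma TX_inj x x' : inX x -> inX x' -> Xeq (TX x) (TX x') -> Xeq x x'.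
Proof.
move=> hx hx' /(TX_XeqE hx hx') e; apply/XeqE => //.
by apply: (That_inj b0 t2_gt0 t23_le tD bsN bsM ker0) e; have [] := L2suppB (L2suppU hx) (L2suppU hx').
Qed.

Lemma TX_surj y : inX y -> exists x, inX x /\ Xeq (TX x) y.
Proof.
move=> hy; have [C _ hC] := That_surj b0 t2_gt0 t23_le tD bsN bsM ker0.
have [u [su uy _]] := hC _ (L2suppU hy).
have ud : forall a c t, a < t < c -> (fun t => u (t + D)) t = u (t + D) by [].
(* The last three components may be one and the same function, as each is read only on its own
   interval. *)
have [] := @inX_off (mkX u (fun t => u (t + D)) (fun t => u (t + D)) (fun t => u (t + D))) u su
  (fun _ _ => erefl) (ud _ _) (ud _ _) (ud _ _).
set x := mkX _ _ _ _ => hx xu; exists x; split => //.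
have [h1 e1] := TX_off hx; have sx := L2suppU hx.
have [sd _] := L2suppB sx su; have [C1 _ hC1] := sT; have [sTd _] := hC1 _ sd.
have [sd' _] := L2suppB (L2suppU h1) (L2suppU hy).
apply/XeqE => //; have [||_ ->] := @sqnorm_off _ L brk (TH (fun t => U x t - u t))
  (fun t => U (TX x) t - U y t) sTd; first by case: sd'.
  by move=> t tb; rewrite e1// -uy ThatB//; [exact: L2supp_intg sx|exact: L2supp_intg su].
apply: TH_nsq0 => //; have s0 : L2supp L (fun=> 0 : R).
  split => //; rewrite (_ : (fun=> _) = fun=> 0); first exact: intg_0.
  by apply/funext => t; rewrite expr0n.
have [||_ ->] := @sqnorm_off _ L brk (fun=> 0) (fun t => U x t - u t) s0; first by case: sd.
  by move=> t tb; rewrite xu// subrr.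
exact: nsq0.
Qed.

Lemma TX_bounded_below : exists C : R, 0 < C /\ forall x, inX x ->
  (Xnorm2 tau2 tau3 D x <= C%:E * Xnorm2 tau2 tau3 D (TX x))%E.
Proof.
have [C C0 hC] := That_bounded_below b0 t2_gt0 t23_le tD bsN bsM ker0.
(* [C] is only known to be nonnegative, while a positive constant is required. *)
exists (C + 1); split; first by rewrite ltr_wpDl.
move=> x hx; have [h1 e1] := TX_off hx; have [C1 _ hC1] := sT; have [sTd _] := hC1 _ (L2suppU hx).
have [sU1 _] := U_sqnorm h1.
have [_ e] := @sqnorm_off _ L brk (TH (U x)) (U (TX x)) sTd (let: And3 _ _ h := sU1 in h)
  (fun t tb => esym (e1 t tb)).
rewrite !Xnorm2E// -EFinM lee_fin e (le_trans (hC _ (L2suppU hx)))// ler_wpM2r ?sqnorm_ge0//.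
by rewrite lerDl.
Qed.

Lemma inX_rhs : inX (rhs tau2 tau3 N).
Proof.
have z a c : L2on a c (fun=> 0 : R).
  by split => //; under eq_integral do rewrite expr0n; rewrite integral0.
split => //=; apply/L2on_L2supp => //.
have sN : L2supp D (fun t => - N0 t).
  have [mN [m Nm] Ns] := bsN; split.
  - exact: measurableT_comp.
  - apply: (@intg_compact _ _ 0 t23 (m ^+ 2)).
    + by apply: measurable_funX; exact: measurableT_comp.
    + by move=> t; rewrite sqrrN normrX lerXn2r ?nnegrE// (le_trans _ (Nm t)).
    + by move=> t h; rewrite Ns// oppr0 expr0n.
  - by move=> t h; rewrite Ns ?oppr0//; apply: contra h => /andP[-> h] /=; exact: lt_trans tD.
have [] // := @sqnorm_off _ D [:: 0; t23] _ (pc 0 D (fun t => if t <= t23 then - N t else 0)) sN.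
  exact: supp_pc.
move=> t; rewrite !inE negb_or => /andP[n0 n1]; rewrite /N0 /pc.
rewrite [0 <= t]le_eqVlt eq_sym (negbTE n0) /= [t <= t23]le_eqVlt (negbTE n1) /=.
case: (ltP 0 t) => h /=; last by rewrite oppr0.
case: (ltP t t23) => [h2|h2]; last by rewrite oppr0 if_same.
by rewrite (lt_trans h2).
Qed.

Lemma TX_rhs : exists x, inX x /\ Xeq (TX x) (rhs tau2 tau3 N) /\
  forall x', inX x' -> Xeq (TX x') (rhs tau2 tau3 N) -> Xeq x' x.
Proof.
have hr := inX_rhs; have [x [hx xr]] := TX_surj hr; exists x; split => //; split => //.
move=> x' hx' xr'; apply: TX_inj => //.
have tr a c (u v w : R -> R) : aeeq a c u v -> aeeq a c w v -> aeeq a c u w.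
  apply: (@filterS2 _ _ (ae_filter_ringOfSetsType mu)) => t h1 h2 h.
  by rewrite h1// h2.
case: xr => [p1 p2 p3 p4]; case: xr' => [q1 q2 q3 q4].
by split; [exact: tr q1 p1|exact: tr q2 p2|exact: tr q3 p3|exact: tr q4 p4].
Qed.

End Link.

(** * The rank condition expressed by real integrals *)

Section Rank.
Local Open Scope complex_scope.
Variables (R : realType) (a2 a3 a23 b tau2 tau3 D : R) (N M : R -> R).
Local Notation t23 := (tau2 + tau3).

Lemma cexpmE (nu x y : R) : cexpm nu (x +i* y) = cexp_re x y nu +i* cexp_im x y nu.
Proof. by []. Qed.

Lemma cexp_re_meas x y : measurable_fun setT (@cexp_re R x y).
Proof. by apply: continuous_measurable_fun; exact: cexp_re_cont. Qed.

Lemma cexp_im_meas x y : measurable_fun setT (@cexp_im R x y).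
Proof. by apply: continuous_measurable_fun; exact: cexp_im_cont. Qed.

Let Rint_cut A (h phi : R -> R) : bs A (fun t => if 0 <= t < A then h t else 0) ->
  measurable_fun setT phi ->
  Defs.Rint 0 A (fun t => h t * phi t) = rint (fun t => (if 0 <= t < A then h t else 0) * phi t).
Proof.
move=> [mh _ _] mp; rewrite RintE; symmetry; apply: (@rint_off _ [:: A]).
  exact: measurable_funM.
move=> t; rewrite inE => tA; rewrite [t <= A]le_eqVlt (negbTE tA) /=.
by case: ifP; rewrite ?mul0r.
Qed.

Let Cint_cut A h (x y : R) : bs A (fun t => if 0 <= t < A then h t else 0) ->
  Cint 0 A (fun t => (h t)%:C * cexpm t (x +i* y)) =
  rint (fun t => (if 0 <= t < A then h t else 0) * cexp_re x y t) +i*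
  rint (fun t => (if 0 <= t < A then h t else 0) * cexp_im x y t).
Proof.
move=> bh; rewrite -!Rint_cut//; [|exact: cexp_im_meas|exact: cexp_re_meas]; rewrite /Cint /=.
by congr (_ +i* _); congr (Defs.Rint _ _ _); apply/funext => t;
  rewrite mul0r ?subr0 ?addr0.
Qed.

Lemma F1E x y : bs D (M0 D M) ->
  F1 b D M (x +i* y) = pairF1 b D (M0 D M) (cexp_re x y) +i* pairF1 b D (M0 D M) (cexp_im x y).
Proof. by move=> bM; rewrite /F1 Cint_cut// cexpmE /pairF1; simpc. Qed.

Lemma F0E x y : bs t23 (N0 tau2 tau3 N) -> F0 a2 a3 a23 tau2 tau3 N (x +i* y) =
  pairF0 a2 a3 a23 tau2 tau3 (N0 tau2 tau3 N) (cexp_re x y) +i*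
  pairF0 a2 a3 a23 tau2 tau3 (N0 tau2 tau3 N) (cexp_im x y).
Proof.
move=> bN; rewrite /F0 Cint_cut// !cexpmE /pairF0.
have -> : cexp_re x y 0 = 1 by rewrite /cexp_re !mul0r oppr0 expR0 cos0 mulr1.
have -> : cexp_im x y 0 = 0 by rewrite /cexp_im !mul0r sin0 mulr0 oppr0.
by apply/eqP; rewrite eq_complex /=; apply/andP; split; apply/eqP; rewrite /N0 !mul0r; ring.
Qed.

End Rank.

Local Open Scope complex_scope.

Theorem theorem1 (R : realType) (a2 a3 a23 b tau2 tau3 D : R) (N M : R -> R) :
  b != 0 -> 0 < tau2 -> tau2 <= tau3 -> tau2 + tau3 < D ->
  piecewise_continuous 0 (tau2 + tau3) N ->
  piecewise_continuous 0 D M ->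
  (forall s : R[i], F0 a2 a3 a23 tau2 tau3 N s != 0 \/ F1 b D M s != 0) ->
  let T := T tau2 tau3 D a2 a3 a23 b N M in
  let inX := inX tau2 tau3 D in
  let Xeq := Xeq tau2 tau3 D in
  (* T is a well-defined operator X -> X *)
  ((forall x, inX x -> inX (T x)) /\
   (forall x x', inX x -> inX x' -> Xeq x x' -> Xeq (T x) (T x'))) /\
  (* T is invertible on X: bijective with bounded inverse *)
  ((forall y, inX y -> exists x, inX x /\ Xeq (T x) y) /\
   (forall x x', inX x -> inX x' -> Xeq (T x) (T x') -> Xeq x x') /\
   (exists C : R, 0 < C /\ forall x, inX x ->
      (Xnorm2 tau2 tau3 D x <= C%:E * Xnorm2 tau2 tau3 D (T x))%E)) /\
  (* consequence: unique solution of T x = (-N 1_[0,tau2+tau3], 0, 0, 0) *)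
  (exists x, inX x /\ Xeq (T x) (rhs tau2 tau3 N) /\
     forall x', inX x' -> Xeq (T x') (rhs tau2 tau3 N) -> Xeq x' x).
Proof.
move=> b0 t2 t23 tD /pwc_bs bN /pwc_bs bM rank T inX Xeq.
have ker0 : forall u, bs (D + (tau2 + tau3)) u ->
    (forall t, That a2 a3 a23 b tau2 tau3 D (N0 tau2 tau3 N) (M0 D M) u t = 0) ->
    forall t, u t = 0.
  apply: That_ker0 => // x y [z1 z2 z3 z4]; have [/eqP|/eqP] := rank (x +i* y)%C; apply.
    by rewrite F0E// z3 z4.
  by rewrite F1E// z1 z2.
split.
  split=> [x|x x']; last exact: TX_Xeq.
  by move=> /(@TX_off _ a2 a3 a23 _ _ _ _ _ _ b0 t2 t23 tD bN bM)[].
split; last exact: TX_rhs.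
by split; [exact: TX_surj|split; [exact: TX_inj|exact: TX_bounded_below]].
Qed.
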